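(* Let $T$ be a complete continuous first order theory in a countable language, having non compact models, and let $\mathfrak p$ be a perturbation system for $T$. Then the following are equivalent: (i) The theory $T$ is $\mathfrak p$-$\aleph_0$-categorical. (ii) For every $n \in \mathbb N$, every finite tuple $\bar a$ (in a model of $T$), every $p \in S_n(\bar a)$ and every $\varepsilon > 0$, the set $[p^{\mathfrak p(\varepsilon)}(\bar x^\varepsilon,\bar a^\varepsilon)]$ has non empty interior in $S_n(\bar a)$. (iii) The same as (ii) restricted to $n = 1$.
   Context: We work in continuous first order logic; structures are bounded complete metric structures with metric $d$. $S_n(T)$ is the compact Hausdorff space of complete $n$-types of $T$ (without parameters) with the logic topology, and for $\bar a \in M \models T$, $S_n(\bar a)$ is the space of complete $n$-types over $\bar a$ (of the theory $\mathrm{Th}(M,\bar a)$) with the logic topology. Closed sets of types correspond to partial types; $[p]$ is the set of complete types extending the partial type $p$. The metric on finite tuples is the supremum metric. Perturbation pre-radii. A perturbation pre-radius $\rho$ for $T$ is a family of closed sets $\rho_n \subseteq S_n(T)^2$ ($n\in\mathbb N$), each containing the diagonal. For $X \subseteq S_n(T)$, $X^\rho = \{q : (\exists p \in X)\,(p,q) \in \rho_n\}$; if $p$ is a partial type, $p^\rho$ is the partial type with $[p^\rho]=[p]^\rho$. For $M,N \models T$, a $\rho$-perturbation from $M$ into $N$ is a map $f\colon M \to N$ such that $\mathrm{tp}^N(f(\bar a)) \in \{\mathrm{tp}^M(\bar a)\}^\rho$ for every finite tuple $\bar a\in M$; $\mathrm{Pert}_\rho(M,N)$ is the set of these. $\mathrm{BiPert}_\rho(M,N)$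 is the set of bijective $f\in\mathrm{Pert}_\rho(M,N)$ with $f^{-1}\in\mathrm{Pert}_\rho(N,M)$. A perturbation radius is a pre-radius $\rho$ such that for every $n$ and $(p,q)\in\rho_n$ there are $M,N\models T$ and a $\rho$-perturbation $f\colon M\to N$ sending some realisation of $p$ to a realisation of $q$. $\rho$ is symmetric if each $\rho_n$ is a symmetric relation. $\rho\le\rho'$ means $\rho_n\subseteq\rho'_n$ for all $n$. Composition: $(\rho'\circ\rho)_n=\{(p,q):\exists r\,(p,r)\in\rho_n,\ (r,q)\in\rho'_n\}$. $\mathrm{id}$ is the pre-radius consisting of the diagonals. A perturbation system $\mathfrak p$ for $T$ assigns to each real $\varepsilon\ge0$ a perturbation radius $\mathfrak p(\varepsilon)$ such that: if $\varepsilon_k\searrow\varepsilon$ then $\mathfrak p(\varepsilon)=\bigcap_k\mathfrak p(\varepsilon_k)$; each $\mathfrak p(\varepsilon)$ is symmetric; $\mathfrak p(\varepsilon)\circ\mathfrak p(\varepsilon')\le\mathfrak p(\varepsilon+\varepsilon')$; $\mathfrak p(0)=\mathrm{id}$. Two models $M,N$ of $T$ are $\mathfrak p$-isomorphic if $\mathrm{BiPert}_{\mathfrak p(\varepsilon)}(M,N)\neq\emptyset$ for every $\varepsilon>0$. $T$ is $\mathfrak p$-$\aleph_0$-categorical if it has a model of density character $\aleph_0$ and any two models of $T$ of density character $\aleph_0$ are $\mathfrak p$-isomorphic. For $p(\bar x,\bar a)\in S_n(\bar a)$, with $p(\bar x,\bar y)$ the corresponding complete type without parameters, $p^{\mathfrak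 p(\varepsilon)}(\bar x^\varepsilon,\bar a^\varepsilon)$ is the partial type over $\bar a$ satisfied by $\bar b$ if and only if, in some elementary extension, there exist $\bar b',\bar a'$ with $d(\bar b,\bar b')\le\varepsilon$, $d(\bar a,\bar a')\le\varepsilon$ and $\mathrm{tp}(\bar b',\bar a')\in p(\bar x,\bar y)^{\mathfrak p(\varepsilon)}$. *)

(* Defs.v *)
(* Continuous first order logic, following Ben Yaacov,
   Berenstein, Henson and Usvyatsov. *)
From HB Require Import structures.
From mathcomp Require Import all_boot all_order all_algebra.
From mathcomp Require Import all_classical all_reals all_analysis.
Set Implicit Arguments.
Unset Strict Implicit.
Unset Printing Implicit Defensive.
Import Order.TTheory GRing.Theory Num.Theory.
Import numFieldNormedType.Exports.
Local Open Scope classical_set_scope.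
Local Open Scope ring_scope.

(* The sup metric on n-tuples, which are functions from 'I_n; it is 0 when
   n = 0. *)
Definition tdist (R : realType) (M : metricType R) (n : nat)
    (a b : 'I_n -> M) : R :=
  \big[Num.max/0]_(i < n) mdist (a i) (b i).

Definition tcat (A : Type) (n m : nat) (b : 'I_n -> A) (a : 'I_m -> A) :
    'I_(n + m) -> A :=
  fun i => match fintype.split i with inl j => b j | inr k => a k end.

Definition trcons (A : Type) (n : nat) (v : 'I_n -> A) (x : A) :
    'I_n.+1 -> A :=
  fun i => oapp v x (unlift ord_max i).

(* As usual, a signature prescribes a bound on the diameter, a closed interval
   of values for each predicate symbol, and moduli of uniform continuity.
   Constant symbols are function symbols of arity 0. *)
Record language (R : realType) := Language {
  fsym : Type;
  farity : fsym -> nat;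
  fmod : fsym -> R -> R;
  fmod_gt0 : forall f e, 0 < e -> 0 < fmod f e;
  psym : Type;
  parity : psym -> nat;
  pmod : psym -> R -> R;
  pmod_gt0 : forall P e, 0 < e -> 0 < pmod P e;
  plow : psym -> R;
  phigh : psym -> R;
  diam : R }.

Definition countable_language (R : realType) (L : language R) : Prop :=
  countable [set: fsym L] /\ countable [set: psym L].

Record structure (R : realType) (L : language R) := Structure {
  carrier :> metricType R;
  carrier_inhabited : inhabited carrier;
  carrier_complete : forall F : set_system carrier,
    ProperFilter F -> cauchy F -> exists x : carrier, F --> x;
  carrier_diam : forall x y : carrier, mdist x y <= diam L;
  fint : forall f : fsym L, ('I_(farity f) -> carrier) -> carrier;
  fint_unif : forall f e (a b : 'I_(farity f) -> carrier),
    0 < e -> tdist a b < fmod f e -> mdist (fint a) (fint b) <= e;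
  pint : forall P : psym L, ('I_(parity P) -> carrier) -> R;
  pint_bounds : forall P (a : 'I_(parity P) -> carrier),
    plow P <= pint a <= phigh P;
  pint_unif : forall P e (a b : 'I_(parity P) -> carrier),
    0 < e -> tdist a b < pmod P e -> `|pint a - pint b| <= e }.

Inductive term (R : realType) (L : language R) (n : nat) : Type :=
| Var of 'I_n
| App (f : fsym L) of ('I_(farity f) -> term L n).

(* [formula L n]: formulas with free variables among x_0, ..., x_(n-1); [FSup]
   binds the last variable x_n. The connectives 1, +, rational scaling and max
   generate a Q-vector lattice; on compact boxes it is uniformly dense in all
   continuous connectives (Stone-Weierstrass), so it defines the same complete
   types and logic topology. Infima are - sup (- phi). *)
Inductive formula (R : realType) (L : language R) : nat -> Type :=
| FDist n of term L n & term L n : formula L n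
| FPred n (P : psym L) of ('I_(parity P) -> term L n) : formula L n
| FOne n : formula L n
| FAdd n of formula L n & formula L n : formula L n
| FScale n of rat & formula L n : formula L n
| FMax n of formula L n & formula L n : formula L n
| FSup n of formula L n.+1 : formula L n.

Fixpoint teval (R : realType) (L : language R) (M : structure L) (n : nat)
    (v : 'I_n -> M) (t : term L n) : M :=
  match t with
  | Var i => v i
  | App f ts => fint (fun i => teval v (ts i))
  end.

Fixpoint eval (R : realType) (L : language R) (M : structure L) (n : nat)
    (phi : formula L n) : ('I_n -> M) -> R :=
  match phi in formula _ n return ('I_n -> M) -> R with
  | FDist _ s t => fun v => mdist (teval v s) (teval v t)
  | FPred _ P ts => fun v => pint (fun i => teval v (ts i))
  | FOne _ => fun _ => 1
  | FAdd _ phi psi => fun v => eval phi v + eval psi v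
  | FScale _ q phi => fun v => ratr q * eval phi v
  | FMax _ phi psi => fun v => Num.max (eval phi v) (eval psi v)
  | FSup _ phi => fun v => sup [set eval phi (trcons v x) | x in [set: M]]
  end.

(* A theory is a set of sentences; phi in T stands for the condition phi = 0. *)
Definition theory (R : realType) (L : language R) := set (formula L 0).

Record model (R : realType) (L : language R) (T : theory L) := Model {
  mstr :> structure L;
  modelP : forall phi, T phi -> forall v : 'I_0 -> mstr, eval phi v = 0 }.

Definition complete_theory (R : realType) (L : language R) (T : theory L) :
    Prop :=
  inhabited (model T) /\
  forall (M N : model T) (phi : formula L 0) (v : 'I_0 -> M) (w : 'I_0 -> N),
    eval phi v = eval phi w.

Definition elementary (R : realType) (L : language R) (M N : structure L)
    (h : M -> N) : Prop :=
  forall n (phi : formula L n) (v : 'I_n -> M), eval phi (h \o v) = eval phi v.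

(* A complete type is identified with the values it gives to formulas; the
   logic topology is then that of pointwise convergence. *)
Definition fvalues (R : realType) (L : language R) (n : nat) :
    topologicalType :=
  prod_topology (fun _ : formula L n => R).

Definition tpfun (R : realType) (L : language R) (M : structure L) (n : nat)
    (a : 'I_n -> M) : fvalues L n :=
  fun phi => eval phi a.

Definition types_set (R : realType) (L : language R) (T : theory L) (n : nat) :
    set (fvalues L n) :=
  [set p | exists (M : model T) (a : 'I_n -> M), p = tpfun a].
Arguments types_set {R L} T n.

(* S_n(T) *)
Definition types (R : realType) (L : language R) (T : theory L) (n : nat) :
    topologicalType :=
  set_type (types_set T n).

Lemma tp_subproof (R : realType) (L : language R) (T : theory L) (M : model T)
  (n : nat) (a : 'I_n -> M) : tpfun a \in types_set T n.
Proof. by apply/mem_set; exists M, a. Qed.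

Definition tp (R : realType) (L : language R) (T : theory L) (M : model T)
    (n : nat) (a : 'I_n -> M) : types T n :=
  exist _ (tpfun a) (tp_subproof a).

(* S_n(a), for an m-tuple a in M. A formula over a is phi(x, a) with phi(x, y)
   in formula L (n + m), and a model of Th(M, a) is a pair (N, c) with
   tp(c) = tp(a); hence a complete type over a is given by the values of the
   phi(b, c). *)
Definition types_over_set (R : realType) (L : language R) (T : theory L)
    (M : model T) (m : nat) (a : 'I_m -> M) (n : nat) :
    set (fvalues L (n + m)) :=
  [set p | exists (N : model T) (c : 'I_m -> N) (b : 'I_n -> N),
     tp c = tp a /\ p = tpfun (tcat b c)].
Arguments types_over_set {R L T M m} a n.

Definition types_over (R : realType) (L : language R) (T : theory L)
    (M : model T) (m : nat) (a : 'I_m -> M) (n : nat) : topologicalType :=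
  set_type (types_over_set a n).

Lemma forget_subproof (R : realType) (L : language R) (T : theory L)
  (M : model T) (m : nat) (a : 'I_m -> M) (n : nat) (p : types_over a n) :
  sval p \in types_set T (n + m).
Proof.
case: p => p /= /set_mem[N [c [b [_ ->]]]].
by apply/mem_set; exists N, (tcat b c).
Qed.

(* From p(x, a) to the parameter-free type p(x, y). *)
Definition forget (R : realType) (L : language R) (T : theory L)
    (M : model T) (m : nat) (a : 'I_m -> M) (n : nat) (p : types_over a n) :
    types T (n + m) :=
  exist _ (sval p) (forget_subproof p).

Definition type_rel (R : realType) (L : language R) (T : theory L) :=
  forall n, set (types T n * types T n).

Definition pre_radius (R : realType) (L : language R) (T : theory L)
    (rho : type_rel T) : Prop :=
  forall n, closed (rho n) /\ forall p, rho n (p, p).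

Definition pert_types (R : realType) (L : language R) (T : theory L)
    (rho : type_rel T) (n : nat) (X : set (types T n)) : set (types T n) :=
  [set q | exists2 p, X p & rho n (p, q)].

Definition Pert (R : realType) (L : language R) (T : theory L)
    (rho : type_rel T) (M N : model T) : set (M -> N) :=
  [set f : M -> N | forall n (a : 'I_n -> M), pert_types rho [set tp a] (tp (f \o a))].

Definition BiPert (R : realType) (L : language R) (T : theory L)
    (rho : type_rel T) (M N : model T) : set (M -> N) :=
  [set f : M -> N | Pert rho f /\
     exists g : N -> M, [/\ cancel f g, cancel g f & Pert rho g]].
Arguments BiPert {R L T} rho M N.

Definition pert_radius (R : realType) (L : language R) (T : theory L)
    (rho : type_rel T) : Prop :=
  pre_radius rho /\
  forall n (p q : types T n), rho n (p, q) ->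
    exists (M N : model T) (f : M -> N) (a : 'I_n -> M),
      [/\ Pert rho f, tp a = p & tp (f \o a) = q].

Definition rel_symmetric (R : realType) (L : language R) (T : theory L)
    (rho : type_rel T) : Prop :=
  forall n (p q : types T n), rho n (p, q) -> rho n (q, p).

Definition rel_le (R : realType) (L : language R) (T : theory L)
    (rho rho' : type_rel T) : Prop :=
  forall n, rho n `<=` rho' n.

(* rho' o rho *)
Definition rel_comp (R : realType) (L : language R) (T : theory L)
    (rho' rho : type_rel T) : type_rel T :=
  fun n => [set pq | exists r, rho n (pq.1, r) /\ rho' n (r, pq.2)].

Definition rel_id (R : realType) (L : language R) (T : theory L) :
    type_rel T :=
  fun n => [set pq | pq.1 = pq.2].

(* The values of pp at negative reals are irrelevant. *)
Record pert_system (R : realType) (L : language R) (T : theory L)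
    (pp : R -> type_rel T) : Prop := PertSystem {
  pert_system_radius : forall e, 0 <= e -> pert_radius (pp e);
  pert_system_cont : forall (e : R) (u : nat -> R),
    0 <= e -> (forall k, u k.+1 <= u k) -> u @ \oo --> e ->
    forall n, pp e n = \bigcap_k pp (u k) n;
  pert_system_sym : forall e, 0 <= e -> rel_symmetric (pp e);
  pert_system_comp : forall e e', 0 <= e -> 0 <= e' ->
    rel_le (rel_comp (pp e) (pp e')) (pp (e + e'));
  pert_system_id : pp 0 = @rel_id R L T }.

Definition pert_isomorphic (R : realType) (L : language R) (T : theory L)
    (pp : R -> type_rel T) (M N : model T) : Prop :=
  forall e, 0 < e -> BiPert (pp e) M N !=set0.

(* The least cardinality of a dense subset is aleph_0. *)
Definition density_aleph0 (T : topologicalType) : Prop :=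
  (exists2 D : set T, countable D & dense D) /\
  forall D : set T, dense D -> infinite_set D.

Definition pert_aleph0_categorical (R : realType) (L : language R)
    (T : theory L) (pp : R -> type_rel T) : Prop :=
  (exists M : model T, density_aleph0 M) /\
  forall M N : model T,
    density_aleph0 M -> density_aleph0 N -> pert_isomorphic pp M N.

(* (b, c) satisfies p^rho(x^e, y^e) *)
Definition sat_fuzzy (R : realType) (L : language R) (T : theory L)
    (rho : type_rel T) (e : R) (n m : nat) (p : types T (n + m))
    (N : model T) (b : 'I_n -> N) (c : 'I_m -> N) : Prop :=
  exists (N' : model T) (h : N -> N') (b' : 'I_n -> N') (c' : 'I_m -> N'),
    [/\ elementary h, tdist (h \o b) b' <= e, tdist (h \o c) c' <= e &
        pert_types rho [set p] (tp (tcat b' c'))].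

(* [p^rho(x^e, a^e)]: the types q over a having a realisation (b, c), in a
   model (N, c) of Th(M, a), that satisfies p^rho(x^e, a^e). *)
Definition fuzzy_types (R : realType) (L : language R) (T : theory L)
    (rho : type_rel T) (e : R) (M : model T) (m : nat) (a : 'I_m -> M)
    (n : nat) (p : types_over a n) : set (types_over a n) :=
  [set q | exists (N : model T) (c : 'I_m -> N) (b : 'I_n -> N),
     [/\ tp c = tp a, sval q = tpfun (tcat b c) &
         sat_fuzzy rho e (forget p) b c]].

Definition fuzzy_types_nonempty_interior (R : realType) (L : language R)
    (T : theory L) (pp : R -> type_rel T) (n : nat) : Prop :=
  forall (M : model T) (m : nat) (a : 'I_m -> M) (p : types_over a n) (e : R),
    0 < e -> interior (fuzzy_types (pp e) e p) !=set0.

(* Main.v *)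
From Pilot Require Import Defs.
From mathcomp Require Import all_boot all_order all_algebra.
From mathcomp Require Import all_classical all_reals all_analysis.
From HB Require Import structures.
From Stdlib Require Eqdep_dec PeanoNat.
From mathcomp Require Import lra zify.
Import Pilot.Defs.
Local Open Scope classical_set_scope.

Set Implicit Arguments.
Unset Strict Implicit.
Unset Printing Implicit Defensive.
Import Order.TTheory GRing.Theory Num.Theory.
Import numFieldNormedType.Exports.
Local Open Scope ring_scope.

(** The theorem is a Ryll-Nardzewski theorem up to perturbation, and the proof
    is the implication from the case n = 1 to categoricity, followed by the
    implication from categoricity to the case of all n.

    Everything is compared inside one saturated model U, an ultrapower over the
    natural numbers: every type is realised in U, and types over finite tuples
    of U are realised over those tuples (eval_ultraproduct, ultra_saturated,
    realize_over). This makes the type spaces compact (types_compact), and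
    compactness gives the two tools used for perturbations: a perturbation of a
    tuple extends to any longer tuple (pp_extend, extend_tuple), and a
    perturbation by a small amount changes distances by a small amount
    (exists_modulus). The relation [fuzzy d e p q], which says that a point at
    distance e from a realisation of q realises a perturbation of p by d, is
    closed, composes up to small errors, and describes the sets
    [p^(pp e)(x^e, a^e)] (fuzzy_closed, fuzzy_comp, fuzzy_types_fuzzy).

    Interiors for n = 1 imply categoricity. In every model the types realised
    over a tuple are dense, so a set of types with non empty interior is
    realised: any element can be matched up to an arbitrarily small fuzzy error
    (one_point). Matching single elements repeatedly matches finite tuples
    (many_steps). In a back-and-forth between two separable models the errors
    in distance must tend to 0 while the perturbations only stay bounded.
    Therefore the finite tuples that are already matched are moved a little at
    each stage: the auxiliary tuple that witnesses the current error is itself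
    realised approximately in the model, and replaces the old tuple (forth).
    The moves are summable, the limits are dense sequences that are exact
    perturbations of each other, and the closure of their correspondence is
    the graph of the required bijection (back_and_forth, bipert_of_dense).

    Categoricity implies interiors. If the set attached to a type p over a has
    empty interior, then a generic sequence in U, obtained by a Baire category
    argument over open conditions on sequences, has an elementary submodel as
    its closure and avoids this set (baire_generic, omitting_model). A Skolem
    hull gives a separable model in which over every perturbation of a there is
    a fuzzy realisation of p (realizing_model). A perturbation isomorphism from
    the first model to the second would transport such a realisation back, and
    the errors add up to less than what the first model avoids. *)

(** * Formulas: bounds, uniform continuity, renaming, projection *)

Section Formulas.
Variables (R : realType) (L : language R).

Lemma tdist_le (M : metricType R) n (a b : 'I_n -> M) (e : R) : 0 <= e ->
  (tdist a b <= e) <-> (forall i, mdist (a i) (b i) <= e).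
Proof.
move=> e0; split=> [h i|h].
  apply: le_trans h; rewrite /tdist.
  exact: (@le_bigmax _ _ _ 0 (fun i => mdist (a i) (b i)) i).
by rewrite /tdist; apply/bigmax_leP; split.
Qed.

Lemma tdist_lt (M : metricType R) n (a b : 'I_n -> M) (e : R) : 0 < e ->
  (tdist a b < e) <-> (forall i, mdist (a i) (b i) < e).
Proof.
move=> e0; split=> [h i|h].
  apply: le_lt_trans h; rewrite /tdist.
  exact: (@le_bigmax _ _ _ 0 (fun i => mdist (a i) (b i)) i).
by rewrite /tdist; apply/bigmax_ltP; split.
Qed.

(** A bound that depends on the formula alone: limits along ultrafilters of the
    values in different models then exist. *)
Fixpoint fbound n (phi : formula L n) : R :=
  match phi with
  | FDist _ _ _ => `|diam L|
  | FPred _ P _ => `|plow P| + `|phigh P|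
  | FOne _ => 1
  | FAdd _ phi psi => fbound phi + fbound psi
  | FScale _ q phi => `|ratr q| * fbound phi
  | FMax _ phi psi => fbound phi + fbound psi
  | FSup _ phi => fbound phi
  end.

Lemma trconsK n (A : Type) (v : 'I_n -> A) x (i : 'I_n) :
  trcons v x (lift ord_max i) = v i.
Proof. by rewrite /trcons liftK. Qed.

Lemma trcons_max n (A : Type) (v : 'I_n -> A) x : trcons v x ord_max = x.
Proof. by rewrite /trcons unlift_none. Qed.

Lemma trcons_eta n (A : Type) (w : 'I_n.+1 -> A) :
  trcons (fun i => w (lift ord_max i)) (w ord_max) = w.
Proof. by apply/funext => i; rewrite /trcons; case: unliftP => [j|] ->. Qed.

Lemma eval_bound (M : structure L) n (phi : formula L n) (v : 'I_n -> M) :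
  `|eval phi v| <= fbound phi.
Proof.
elim: phi v => //= {n}.
- move=> n s t v; rewrite ger0_norm ?mdist_ge0//.
  by apply: le_trans (ler_norm _); exact: carrier_diam.
- move=> n P ts v; have := pint_bounds (fun i => teval v (ts i)).
  move=> /andP[h1 h2]; rewrite ler_norml.
  have := ler_norm (plow P); have := ler_norm (phigh P).
  have := ler_norm (- plow P); have := ler_norm (- phigh P); rewrite !normrN.
  have := normr_ge0 (plow P); have := normr_ge0 (phigh P).
  move=> *; apply/andP; split; lra.
- by move=> n v; rewrite normr1.
- move=> n phi IH psi IH' v; apply: le_trans (ler_normD _ _) _.
  exact: lerD.
- by move=> n q phi IH v; rewrite normrM ler_wpM2l.
- move=> n phi IH psi IH' v.
  have := IH v; have := IH' v; have := normr_ge0 (eval phi v).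
  have := normr_ge0 (eval psi v).
  by rewrite /Num.max; case: ifP => _ *; lra.
- move=> n phi IH v.
  have [x0] := carrier_inhabited M.
  have hs : has_sup [set eval phi (trcons v x) | x in [set: M]].
    split; first by exists (eval phi (trcons v x0)), x0.
    exists (fbound phi) => _ [x _ <-]; exact: le_trans (ler_norm _) (IH _).
  rewrite ler_norml; apply/andP; split.
    apply: (@le_trans _ _ (eval phi (trcons v x0))).
      by have := IH (trcons v x0); rewrite ler_norml => /andP[].
    by apply: ub_le_sup; [exact: hs.2|exists x0].
  apply: ge_sup; first exact: hs.1.
  by move=> _ [x _ <-]; exact: le_trans (ler_norm _) (IH _).
Qed.

Lemma eval_has_sup (M : structure L) n (phi : formula L n.+1) (v : 'I_n -> M) :
  has_sup [set eval phi (trcons v x) | x in [set: M]].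
Proof.
have [x0] := carrier_inhabited M.
split; first by exists (eval phi (trcons v x0)), x0.
exists (fbound phi) => _ [x _ <-]; exact: le_trans (ler_norm _) (eval_bound _ _).
Qed.

Lemma FSup_ub (M : structure L) n (phi : formula L n.+1) (v : 'I_n -> M) x :
  eval phi (trcons v x) <= eval (FSup phi) v.
Proof. by apply: ub_le_sup; [exact: (eval_has_sup _ _).2|exists x]. Qed.

Lemma FSup_le (M : structure L) n (phi : formula L n.+1) (v : 'I_n -> M) r :
  (forall x, eval phi (trcons v x) <= r) -> eval (FSup phi) v <= r.
Proof.
move=> h; apply: ge_sup; first exact: (eval_has_sup _ _).1.
by move=> _ [x _ <-].
Qed.

Lemma FSup_gt (M : structure L) n (phi : formula L n.+1) (v : 'I_n -> M) r :
  r < eval (FSup phi) v <-> exists x, r < eval phi (trcons v x).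
Proof.
split=> [h|[x h]]; last exact: lt_le_trans h (FSup_ub _ _ _).
apply: contrapT => /forallNP hn; move: h; rewrite ltNge => /negP; apply.
by apply: FSup_le => x; rewrite leNgt; apply/negP/hn.
Qed.

Lemma positive_lower_bound n (g : 'I_n -> R) : (forall i, 0 < g i) ->
  exists d, 0 < d /\ forall i, d <= g i.
Proof.
elim: n g => [|n IH] g g0; first by exists 1; split=> // -[].
have [d [d0 dg]] := IH (fun i => g (lift ord_max i)) (fun i => g0 _).
exists (Num.min d (g ord_max)); split; first by rewrite lt_min d0 g0.
move=> i; rewrite ge_min; case: (unliftP ord_max i) => [j|] ->.
  by rewrite dg.
by rewrite lexx orbT.
Qed.

Lemma teval_unif n (t : term L n) (e : R) : 0 < e ->
  exists d, 0 < d /\ forall (M : structure L) (a b : 'I_n -> M),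
    (forall i, mdist (a i) (b i) <= d) -> mdist (teval a t) (teval b t) <= e.
Proof.
elim: t e => [i|f ts IH] e e0 /=; first by exists e.
have h i : exists d, 0 < d /\ forall (M : structure L) (a b : 'I_n -> M),
    (forall i, mdist (a i) (b i) <= d) ->
    mdist (teval a (ts i)) (teval b (ts i)) <= fmod f e / 2.
  by apply: IH; rewrite divr_gt0// fmod_gt0.
have [g gP] := choice h.
have [d [d0 dg]] := positive_lower_bound (fun i => (gP i).1).
exists d; split=> // M a b ab; apply: fint_unif => //.
apply/tdist_lt => [|i]; first exact: fmod_gt0.
apply: (@le_lt_trans _ _ (fmod f e / 2)).
  by apply: (gP i).2 => j; exact: le_trans (ab j) (dg i).
have := fmod_gt0 f e0; lra.
Qed.

(** One modulus serves all structures, since the language prescribes those of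
    the symbols. It transfers estimates between a model and its extensions. *)
Lemma eval_unif n (phi : formula L n) (e : R) : 0 < e ->
  exists d, 0 < d /\ forall (M : structure L) (a b : 'I_n -> M),
    (forall i, mdist (a i) (b i) <= d) -> `|eval phi a - eval phi b| <= e.
Proof.
elim: phi e => {n}.
- move=> n s t e e0.
  have e20 : 0 < e / 2 by rewrite divr_gt0.
  have [d1 [d10 h1]] := teval_unif s e20.
  have [d2 [d20 h2]] := teval_unif t e20.
  exists (Num.min d1 d2); split; first by rewrite lt_min d10 d20.
  move=> M a b ab.
  have {}h1 : mdist (teval a s) (teval b s) <= e / 2.
    by apply: h1 => i; apply: le_trans (ab i) _; rewrite ge_min lexx.
  have {}h2 : mdist (teval a t) (teval b t) <= e / 2.
    by apply: h2 => i; apply: le_trans (ab i) _; rewrite ge_min lexx orbT.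
  have t1 := metric_triangle (teval a s) (teval b s) (teval a t).
  have t2 := metric_triangle (teval b s) (teval b t) (teval a t).
  have t3 := metric_triangle (teval b s) (teval a s) (teval b t).
  have t4 := metric_triangle (teval a s) (teval a t) (teval b t).
  have s1 := metric_sym (teval b s) (teval a s).
  have s2 := metric_sym (teval b t) (teval a t).
  by rewrite /= ler_norml; apply/andP; split; lra.
- move=> n P ts e e0.
  have h i : exists d, 0 < d /\ forall (M : structure L) (a b : 'I_n -> M),
      (forall i, mdist (a i) (b i) <= d) ->
      mdist (teval a (ts i)) (teval b (ts i)) <= pmod P e / 2.
    by apply: teval_unif; rewrite divr_gt0// pmod_gt0.
  have [g gP] := choice h.
  have [d [d0 dg]] := positive_lower_bound (fun i => (gP i).1).
  exists d; split=> // M a b ab; apply: pint_unif => //.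
  apply/tdist_lt => [|i]; first exact: pmod_gt0.
  apply: (@le_lt_trans _ _ (pmod P e / 2)).
    by apply: (gP i).2 => j; exact: le_trans (ab j) (dg i).
  have := pmod_gt0 P e0; lra.
- by move=> n e e0; exists 1; split=> // M a b _; rewrite /= subrr normr0 ltW.
- move=> n phi IH psi IH' e e0; have e20 : 0 < e / 2 by rewrite divr_gt0.
  have [d1 [d10 h1]] := IH _ e20; have [d2 [d20 h2]] := IH' _ e20.
  exists (Num.min d1 d2); split; first by rewrite lt_min d10 d20.
  move=> M a b ab.
  have {}h1 : `|eval phi a - eval phi b| <= e / 2.
    by apply: h1 => i; apply: le_trans (ab i) _; rewrite ge_min lexx.
  have {}h2 : `|eval psi a - eval psi b| <= e / 2.
    by apply: h2 => i; apply: le_trans (ab i) _; rewrite ge_min lexx orbT.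
  move: h1 h2; rewrite /= !ler_norml => /andP[? ?] /andP[? ?].
  by apply/andP; split; lra.
- move=> n q phi IH e e0.
  have q0 : 0 < `|ratr q : R| + 1 by rewrite ltr_wpDl.
  have e20 : 0 < e / (`|ratr q : R| + 1) by rewrite divr_gt0.
  have [d1 [d10 h1]] := IH _ e20; exists d1; split=> // M a b ab /=.
  rewrite -mulrBr normrM.
  apply: (@le_trans _ _ (`|ratr q : R| * (e / (`|ratr q : R| + 1)))).
    by rewrite ler_wpM2l// h1.
  rewrite mulrCA ger_pMr// ler_pdivrMr// mul1r lerDl//.
- move=> n phi IH psi IH' e e0.
  have [d1 [d10 h1]] := IH _ e0; have [d2 [d20 h2]] := IH' _ e0.
  exists (Num.min d1 d2); split; first by rewrite lt_min d10 d20.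
  move=> M a b ab.
  have {}h1 : `|eval phi a - eval phi b| <= e.
    by apply: h1 => i; apply: le_trans (ab i) _; rewrite ge_min lexx.
  have {}h2 : `|eval psi a - eval psi b| <= e.
    by apply: h2 => i; apply: le_trans (ab i) _; rewrite ge_min lexx orbT.
  move: h1 h2; rewrite /= !ler_norml => /andP[? ?] /andP[? ?].
  by rewrite /Num.max; do 2 case: ltP => ?; apply/andP; split; lra.
- move=> n phi IH e e0.
  have [d [d0 h]] := IH _ e0; exists d; split=> // M a b ab.
  have hx x : `|eval phi (trcons a x) - eval phi (trcons b x)| <= e.
    apply: h => i; case: (unliftP ord_max i) => [j|] ->.
      by rewrite !trconsK.
    by rewrite !trcons_max mdistxx ltW.
  have h1 : eval (FSup phi) a <= eval (FSup phi) b + e.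
    apply: FSup_le => x; have := FSup_ub phi b x; have := hx x.
    rewrite ler_norml => /andP[? ?] ?; lra.
  have h2 : eval (FSup phi) b <= eval (FSup phi) a + e.
    apply: FSup_le => x; have := FSup_ub phi a x; have := hx x.
    rewrite ler_norml => /andP[? ?] ?; lra.
  by rewrite ler_norml; apply/andP; split; lra.
Qed.

Fixpoint trename n m (s : 'I_n -> 'I_m) (t : term L n) : term L m :=
  match t with
  | Var i => Var L (s i)
  | App f ts => App (fun i => trename s (ts i))
  end.

Definition up n m (s : 'I_n -> 'I_m) : 'I_n.+1 -> 'I_m.+1 :=
  trcons (fun i => lift ord_max (s i)) ord_max.

Fixpoint frename n (phi : formula L n) : forall m, ('I_n -> 'I_m) -> formula L m :=
  match phi with
  | FDist _ s t => fun m r => FDist (trename r s) (trename r t)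
  | FPred _ P ts => fun m r => FPred (fun i => trename r (ts i))
  | FOne _ => fun m r => FOne L m
  | FAdd _ phi psi => fun m r => FAdd (frename phi r) (frename psi r)
  | FScale _ q phi => fun m r => FScale q (frename phi r)
  | FMax _ phi psi => fun m r => FMax (frename phi r) (frename psi r)
  | FSup _ phi => fun m r => FSup (frename phi (up r))
  end.

Lemma teval_rename (M : structure L) n m (s : 'I_n -> 'I_m) (t : term L n)
  (v : 'I_m -> M) : teval v (trename s t) = teval (v \o s) t.
Proof.
elim: t => [i|f ts IH] //=; congr fint; apply/funext => i; exact: IH.
Qed.

Lemma eval_rename (M : structure L) n (phi : formula L n) m (s : 'I_n -> 'I_m)
  (v : 'I_m -> M) : eval (frename phi s) v = eval phi (v \o s).
Proof.
elim: phi m s v => {n} /=.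
- by move=> *; rewrite !teval_rename.
- by move=> n P ts m s v; congr pint; apply/funext => i; rewrite teval_rename.
- by [].
- by move=> n phi IH psi IH' m s v; rewrite IH IH'.
- by move=> n q phi IH m s v; rewrite IH.
- by move=> n phi IH psi IH' m s v; rewrite IH IH'.
- move=> n phi IH m s v; congr sup; apply/seteqP; split=> _ [x _ <-];
  exists x => //; rewrite IH; congr (eval phi); apply/funext => i;
  rewrite /up /=; case: (unliftP ord_max i) => [j|] ->;
  by rewrite ?trconsK ?trcons_max ?trconsK ?trcons_max.
Qed.

Definition FConst n (q : rat) : formula L n := FScale q (FOne L n).
Definition FOpp n (phi : formula L n) := FScale (-1) phi.
Definition FSub n (phi psi : formula L n) := FAdd phi (FOpp psi).
Definition FMin n (phi psi : formula L n) := FOpp (FMax (FOpp phi) (FOpp psi)).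

Variable M : structure L.
Lemma eval_FConst n q (v : 'I_n -> M) : eval (FConst n q) v = ratr q.
Proof. by rewrite /= mulr1. Qed.
Lemma eval_FOpp n (phi : formula L n) (v : 'I_n -> M) :
  eval (FOpp phi) v = - eval phi v.
Proof. by rewrite /= rmorphN rmorph1 mulN1r. Qed.
Lemma eval_FSub n (phi psi : formula L n) (v : 'I_n -> M) :
  eval (FSub phi psi) v = eval phi v - eval psi v.
Proof. by rewrite -eval_FOpp. Qed.
Lemma eval_FMin n (phi psi : formula L n) (v : 'I_n -> M) :
  eval (FMin phi psi) v = Num.min (eval phi v) (eval psi v).
Proof.
rewrite eval_FOpp.
have -> : eval (FMax (FOpp phi) (FOpp psi)) v =
   Num.max (eval (FOpp phi) v) (eval (FOpp psi) v) by [].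
by rewrite !eval_FOpp oppr_max !opprK.
Qed.

End Formulas.

Section DerivedFormulas.
Variables (R : realType) (L : language R).

(** Projections of open conditions are open conditions: psi' is psi with its new
    variables quantified by suprema, and a supremum is positive iff some value
    is. The map sg says which variables of psi are kept, so that no reordering
    of variables is needed to apply this. *)
Lemma proj_formula q k n (sg : 'I_k -> 'I_n + 'I_q) (psi : formula L k) :
  exists psi' : formula L n, forall (M : structure L) (v : 'I_n -> M),
    0 < eval psi' v <-> exists z : 'I_q -> M,
      0 < eval psi (fun i => match sg i with inl j => v j | inr j => z j end).
Proof.
elim: q n sg => [|q IH] n sg.
  have hs i : {j : 'I_n | sg i = inl j}.
    by case: (sg i) => [j|[]//]; exists j.
  exists (frename psi (fun i => sval (hs i))) => M v; rewrite eval_rename.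
  have e (z : 'I_0 -> M) : (fun i => match sg i with inl j => v j | inr j => z j end)
      = v \o (fun i => sval (hs i)).
    by apply/funext => i /=; case: (hs i) => j /= ->.
  split=> [h|[z]]; last by rewrite e.
  have z : 'I_0 -> M by case.
  by exists z; rewrite e.
pose sg' i : 'I_n.+1 + 'I_q := match sg i with
  | inl j => inl (lift ord_max j)
  | inr j => if unlift ord_max j is Some j' then inr j' else inl ord_max end.
have [psi' h] := IH _ sg'; exists (FSup psi') => M v.
have e (x : M) (z : 'I_q -> M) :
    (fun i => match sg' i with inl j => trcons v x j | inr j => z j end) =
    (fun i => match sg i with inl j => v j | inr j => trcons z x j end).
  apply/funext => i; rewrite /sg'; case: (sg i) => j; first by rewrite trconsK.
  by rewrite {2}/trcons; case: unliftP => [j'|] _ //=; rewrite trcons_max.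
split=> [/FSup_gt [x /h[z]]|[z hz]].
  by rewrite e => hz; exists (trcons z x).
apply/FSup_gt; exists (z ord_max); apply/h; exists (fun i => z (lift ord_max i)).
by rewrite e trcons_eta.
Qed.

Fixpoint FMins n (s : seq (formula L n)) : formula L n :=
  if s is phi :: s' then FMin phi (FMins s') else FConst L n 1.

Lemma FMins_gt0 n (s : seq (formula L n)) (M : structure L) (v : 'I_n -> M) :
  0 < eval (FMins s) v <-> (forall i, (i < size s)%N -> 0 < eval (nth (FOne L n) s i) v).
Proof.
elim: s => [|phi s IH].
  by rewrite [FMins _]/= eval_FConst rmorph1; split.
rewrite [FMins _]/= eval_FMin lt_min; split.
  by move=> /andP[h1 /IH h2] [|i] //= /h2.
move=> h; rewrite (h 0%N)//=; apply/IH => i hi; exact: (h i.+1).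
Qed.

(** Rational scalars suffice to isolate the values of phi near a real r: choose
    rationals a < r < b close to r and take min(phi - a, b - phi). *)
Lemma near_formula n (phi : formula L n) (r e : R) : 0 < e ->
  exists psi : formula L n,
    (exists2 d, 0 < d & forall (M : structure L) (v : 'I_n -> M),
       `|eval phi v - r| <= d -> 0 < eval psi v) /\
    forall (M : structure L) (v : 'I_n -> M),
       0 < eval psi v -> `|eval phi v - r| <= e.
Proof.
move=> e0.
have [a] : exists a : rat, ratr a \in `]r - e, r[ by apply: rat_in_itvoo; lra.
rewrite in_itv /= => /andP[a1 a2].
have [b] : exists b : rat, ratr b \in `]r, r + e[ by apply: rat_in_itvoo; lra.
rewrite in_itv /= => /andP[b1 b2].
exists (FMin (FSub phi (FConst L n a)) (FSub (FConst L n b) phi)); split.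
  exists (Num.min (r - ratr a) (ratr b - r) / 2).
    by rewrite divr_gt0// lt_min !subr_gt0 a2 b1.
  move=> M v; rewrite eval_FMin !eval_FSub !eval_FConst lt_min !subr_gt0.
  have : Num.min (r - ratr a) (ratr b - r) <= r - ratr a by rewrite ge_min lexx.
  have : Num.min (r - ratr a) (ratr b - r) <= ratr b - r by rewrite ge_min lexx orbT.
  have : 0 < Num.min (r - ratr a) (ratr b - r) by rewrite lt_min !subr_gt0 a2 b1.
  by move=> ? ? ?; rewrite ler_norml => /andP[? ?]; apply/andP; split; lra.
move=> M v; rewrite eval_FMin !eval_FSub !eval_FConst lt_min !subr_gt0.
by move=> /andP[? ?]; rewrite ler_norml; apply/andP; split; lra.
Qed.

End DerivedFormulas.

(** * Metric spaces cut out of a set with a distance, and completeness *)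

Section SubMetric.
Record is_distance (R : realType) (X : Type) (P : X -> Prop) (d : X -> X -> R) := {
  isd_xx : forall x, d x x = 0;
  isd_pos : forall x y, P x -> P y -> d x y = 0 -> x = y;
  isd_sym : forall x y, d x y = d y x;
  isd_tri : forall y x z, d x z <= d x y + d y z }.

(** The carrier depends on the proof H, so that the metric can be recovered from
    the type. Both ultrapowers and substructures are obtained in this way: no
    quotient is formed, a set of representatives is cut out instead. *)
Definition distance_on (R : realType) (X : Type) (P : X -> Prop) (d : X -> X -> R)
  (H : is_distance P d) := {x : X | P x}.

Variables (R : realType) (X : Type) (P : X -> Prop) (d : X -> X -> R).
Variable H : is_distance P d.

Lemma distance_on_inj (x y : distance_on H) : sval x = sval y -> x = y.
Proof. by case: x y => x px [y py] /= e; subst y; congr exist; exact: Prop_irrelevance. Qed.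

HB.instance Definition _ := gen_eqMixin (distance_on H).
HB.instance Definition _ := gen_choiceMixin (distance_on H).
HB.instance Definition _ := @isMetric.Build R (distance_on H)
  (fun x y => d (sval x) (sval y))
  (fun x => isd_xx H _)
  (fun x y e => distance_on_inj (isd_pos H (svalP x) (svalP y) e))
  (fun x y => isd_sym H _ _) (fun y x z => isd_tri H _ _ _).

Lemma distance_onE (x y : distance_on H) : mdist x y = d (sval x) (sval y).
Proof. by []. Qed.
End SubMetric.

Section Rapid.
Variables (R : realType).

Definition half_pow (s : nat) : R := 2^-1 ^+ s.

Lemma half_pow_gt0 s : 0 < half_pow s. Proof. by rewrite exprn_gt0// invr_gt0. Qed.
Lemma half_powS s : half_pow s = 2 * half_pow s.+1.
Proof. by rewrite /half_pow exprS mulrA divff ?mul1r// pnatr_eq0. Qed.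
Lemma half_pow_le s t : (s <= t)%N -> half_pow t <= half_pow s.
Proof. by move=> st; apply: ler_wiXn2l => //; lra. Qed.
Lemma half_pow_small (e : R) : 0 < e -> exists s, half_pow s <= e.
Proof.
move=> e0.
have [s hs] : exists s : nat, e^-1 < s%:R.
  by exists (Num.truncn e^-1).+1; exact: truncnS_gt.
exists s; rewrite /half_pow exprVn -(invrK e) lef_pV2 ?posrE ?invr_gt0 ?exprn_gt0//.
apply: le_trans (ltW hs) _; rewrite -natrX ler_nat; exact/ltnW/ltn_expl.
Qed.

(** Rapidly Cauchy sequences suffice for completeness, and unlike filters they
    can be handled coordinate by coordinate in an ultrapower. *)
Definition rapid_complete (M : metricType R) :=
  forall x : nat -> M, (forall s, mdist (x s) (x s.+1) <= half_pow s) ->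
     exists y, forall s, mdist (x s) y <= 8 * half_pow s.

(** The series of the c / 2^i is telescoping: its terms from s to t - 1 sum to
    2 c (1 / 2^s - 1 / 2^t). *)
Lemma rapid_dist (M : metricType R) (x : nat -> M) c s0 :
  (forall s, (s0 <= s)%N -> mdist (x s) (x s.+1) <= c * half_pow s) ->
  forall s t, (s0 <= s)%N -> (s <= t)%N ->
    mdist (x s) (x t) <= 2 * c * (half_pow s - half_pow t).
Proof.
move=> h s t s0s; elim: t => [|t IH].
  by rewrite leqn0 => /eqP->; rewrite mdistxx subrr mulr0.
rewrite leq_eqVlt => /orP[/eqP->|]; first by rewrite mdistxx subrr mulr0.
rewrite ltnS => st; apply: le_trans (metric_triangle _ (x t) _) _.
have := IH st; have := h _ (leq_trans s0s st); rewrite (half_powS t); lra.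
Qed.

Lemma complete_of_rapid (M : metricType R) : rapid_complete M ->
  forall F : set_system M, ProperFilter F -> cauchy F -> exists x : M, F --> x.
Proof.
move=> hM F PF /cauchyP cF.
have hx s : exists x : M, F (ball x (half_pow s / 4)).
  by apply: cF; rewrite divr_gt0// half_pow_gt0.
have [x xP] := choice hx.
have [y yP] : exists y, forall s, mdist (x s) y <= 8 * half_pow s.
  apply: hM => s; have [z []] := filter_ex (filterI (xP s) (xP s.+1)).
  rewrite !ballEmdist /= => h1 h2.
  apply: le_trans (metric_triangle _ z _) _.
  by rewrite (metric_sym z); have := half_powS s; have := half_pow_gt0 s.+1; lra.
exists y => A /nbhs_ballP[e /= e0 eA]; apply: (filterS eA).
have [s hs] := half_pow_small (divr_gt0 e0 (ltr0Sn R 15)).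
apply: filterS (xP s) => z; rewrite !ballEmdist /= => h1.
apply: le_lt_trans (metric_triangle _ (x s) _) _.
by rewrite (metric_sym y); have := yP s; have := half_pow_gt0 s; lra.
Qed.

Lemma rapid_of_complete (M : metricType R) :
  (forall F : set_system M, ProperFilter F -> cauchy F -> exists x : M, F --> x) ->
  forall c s0 (x : nat -> M),
    (forall s, (s0 <= s)%N -> mdist (x s) (x s.+1) <= c * half_pow s) ->
     exists y, forall s, (s0 <= s)%N -> mdist (x s) y <= 2 * c * half_pow s.
Proof.
move=> hM c s0 x hx.
have c0 : 0 <= c.
  have := hx _ (leqnn _); have := mdist_ge0 (x s0) (x s0.+1).
  by move=> h1 /(le_trans h1); rewrite pmulr_lge0// half_pow_gt0.
have [y xy] : exists y : M, x @ \oo --> y.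
  apply: (hM (x @ \oo)); apply/cauchyP => e e0.
  have c10 : 0 < 2 * c + 1 by lra.
  have [s hs] := half_pow_small (divr_gt0 e0 c10).
  exists (x (maxn s0 s)); exists (maxn s0 s) => // t /= st.
  rewrite ballEmdist /=; apply: le_lt_trans (rapid_dist hx _ st) _.
    by rewrite leq_maxl.
  have h1 := half_pow_gt0 t; have h2 := half_pow_le (leq_maxr s0 s).
  have h3 := half_pow_gt0 (maxn s0 s).
  move: hs; rewrite ler_pdivlMr// => hs.
  have h4 : 2 * c * (half_pow (maxn s0 s) - half_pow t) <= 2 * c * half_pow s.
    apply: ler_wpM2l; [lra|lra].
  have := half_pow_gt0 s; lra.
exists y => s s0s; apply/ler_addgt0Pl => e e0.
have : \forall t \near \oo, ball y e (x t).
  by apply: xy; exact: nbhsx_ballx.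
move=> [t0 _ ht0].
have := ht0 (maxn t0 s) (leq_maxl _ _); rewrite /= ballEmdist /= => h1.
have := rapid_dist hx s0s (leq_maxr t0 s).
have := metric_triangle (x s) (x (maxn t0 s)) y.
have := metric_sym y (x (maxn t0 s)).
have : 0 <= 2 * c * half_pow (maxn t0 s) by rewrite !mulr_ge0// ltW// half_pow_gt0.
lra.
Qed.

End Rapid.

(** * Limits along ultrafilters and ultrapowers *)

Section UltraLimit.
Variables (R : realType) (X : Type).
Variables (G : set_system X) (GU : UltraFilter G).

(** The default 0 is taken only when no limit exists. *)
Definition ulim (f : X -> R) : R :=
  xget 0 [set l | forall e : R, 0 < e -> G [set k | `|f k - l| <= e]].

Definition bounded_seq (f : X -> R) := exists B : R, forall k, `|f k| <= B.

(** The limit is the supremum of the r such that r <= f holds almost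
    everywhere: a slightly larger value is exceeded on a set outside G, whose
    complement lies in G. *)
Lemma ulimP f : bounded_seq f ->
  forall e : R, 0 < e -> G [set k | `|f k - ulim f| <= e].
Proof.
move=> [B fB].
suff [l hl] : exists l, forall e : R, 0 < e -> G [set k | `|f k - l| <= e].
  by rewrite /ulim; case: xgetP => [x _ //|h]; case: (h l hl).
pose A := [set r : R | G [set k | r <= f k]].
have hA : has_sup A.
  split.
    exists (- B); apply: filterS filterT => k _ /=.
    by have := fB k; rewrite ler_norml => /andP[].
  exists B => r Ar; have [k /= rk] := filter_ex Ar.
  by apply: le_trans rk _; apply: le_trans (ler_norm _) (fB k).
exists (sup A) => e e0.
have h1 : G [set k | sup A - e <= f k].
  have [r Ar rs] := sup_adherent e0 hA.
  by apply: filterS Ar => k /= rk; apply: le_trans rk; exact: ltW.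
have h2 : G (~` [set k | sup A + e <= f k]).
  have [h|//] := in_ultra_setVsetC [set k | sup A + e <= f k] GU.
  have := ub_le_sup hA.2 h; lra.
apply: filterS (filterI h1 h2) => k [/= ? /negP]; rewrite -ltNge => ?.
by rewrite ler_norml; apply/andP; split; lra.
Qed.

Lemma ulim_eq f l : (forall e : R, 0 < e -> G [set k | `|f k - l| <= e]) -> ulim f = l.
Proof.
move=> h; rewrite /ulim; case: xgetP => [x _ hx|hn]; last by case: (hn l h).
apply/eqP; rewrite eq_sym -subr_eq0 -normr_le0; apply/ler_addgt0Pl => e e0.
have e20 : 0 < e / 2 by rewrite divr_gt0.
have [k /= []] := filter_ex (filterI (h _ e20) (hx _ e20)).
rewrite addr0 !ler_norml => /andP[? ?] /andP[? ?].
by apply/andP; split; lra.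
Qed.

Lemma ulim_le (f g : X -> R) : bounded_seq f -> bounded_seq g ->
  (forall e : R, 0 < e -> G [set k | f k <= g k + e]) -> ulim f <= ulim g.
Proof.
move=> bf bg h; apply/ler_addgt0Pl => e e0.
have e30 : 0 < e / 3 by rewrite divr_gt0.
have [k /= [[]]] := filter_ex (filterI (filterI (ulimP bf e30) (ulimP bg e30)) (h _ e30)).
rewrite /= !ler_norml => /andP[? ?] /andP[? ?] ?; lra.
Qed.

Lemma ulim_leD (f g : X -> R) (c : R) : bounded_seq f -> bounded_seq g ->
  (forall e : R, 0 < e -> G [set k | f k <= g k + c + e]) -> ulim f <= ulim g + c.
Proof.
move=> bf bg h; apply/ler_addgt0Pl => e e0.
have e30 : 0 < e / 3 by rewrite divr_gt0.
have [k /= [[]]] := filter_ex (filterI (filterI (ulimP bf e30) (ulimP bg e30)) (h _ e30)).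
rewrite /= !ler_norml => /andP[? ?] /andP[? ?] ?; lra.
Qed.

Lemma ulim_const c : ulim (fun=> c) = c.
Proof.
by apply: ulim_eq => e e0; apply: filterS filterT => k _ /=; rewrite subrr normr0 ltW.
Qed.

Lemma ulim_le_const (f : X -> R) c : bounded_seq f ->
  (forall e : R, 0 < e -> G [set k | f k <= c + e]) -> ulim f <= c.
Proof.
move=> bf h; rewrite -(ulim_const c); apply: ulim_le => //.
by exists `|c|.
Qed.

Lemma ulim_gt (f : X -> R) c : bounded_seq f -> c < ulim f -> G [set k | c < f k].
Proof.
move=> bf cf; have e0 : 0 < (ulim f - c) / 2 by rewrite divr_gt0// subr_gt0.
apply: filterS (ulimP bf e0) => k /=; rewrite ler_norml => /andP[? ?]; lra.
Qed.

Lemma ulim_lt (f : X -> R) c : bounded_seq f -> ulim f < c -> G [set k | f k < c].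
Proof.
move=> bf cf; have e0 : 0 < (c - ulim f) / 2 by rewrite divr_gt0// subr_gt0.
apply: filterS (ulimP bf e0) => k /=; rewrite ler_norml => /andP[? ?]; lra.
Qed.

Lemma ulim_dist (f g : X -> R) (e : R) : bounded_seq f -> bounded_seq g ->
  (forall e' : R, 0 < e' -> G [set k | `|f k - g k| <= e + e']) ->
  `|ulim f - ulim g| <= e.
Proof.
move=> bf bg h; apply/ler_addgt0Pl => e' e0.
have e30 : 0 < e' / 3 by rewrite divr_gt0.
have [k /= [[]]] := filter_ex (filterI (filterI (ulimP bf e30) (ulimP bg e30)) (h _ e30)).
rewrite /= !ler_norml => /andP[? ?] /andP[? ?] /andP[? ?].
by apply/andP; split; lra.
Qed.

End UltraLimit.

Section Ultra.
Variables (R : realType).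
Variables (G : set_system nat) (GU : UltraFilter G) (Goo : \oo `<=` G).

Lemma ultra_tail s : G [set k | (s <= k)%N].
Proof. by apply: Goo; exists s. Qed.

(** If each A s holds almost everywhere, one can let s tend to infinity with the
    index k: take the largest s <= k such that A s k. As G contains all final
    segments, this s exceeds any bound almost everywhere. This is the source
    of both the completeness and the saturation of the ultrapower. *)
Lemma ultra_diagonal (A : nat -> nat -> Prop) : (forall s, G (A s)) ->
  (forall k, A 0 k) ->
  exists S : nat -> nat, (forall k, A (S k) k) /\ forall s, G [set k | (s <= S k)%N].
Proof.
move=> GA A0.
pose S k : nat := [arg max_(i > ord0 :> 'I_k.+1 | `[< A i k >]) (i : nat)].
have SP k : A (S k) k /\ forall i, (i <= k)%N -> A i k -> (i <= S k)%N.
  rewrite /S; case: arg_maxnP => /=; first exact/asboolP.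
  move=> i /asboolP Ai h; split=> // j jk Aj.
  by have := h (Ordinal (jk : (j < k.+1)%N)); apply; exact/asboolP.
exists S; split=> [k|s]; first exact: (SP k).1.
apply: filterS (filterI (ultra_tail s) (GA s)) => k [sk Ask].
exact: (SP k).2.
Qed.

Lemma filter_ord n (P : 'I_n -> set nat) : (forall i, G (P i)) ->
  G [set k | forall i, P i k].
Proof. exact: filter_forall. Qed.

Variables (L : language R) (M : structure L).

Definition udist (x y : nat -> M) : R := ulim G (fun k => mdist (x k) (y k)).

Lemma udist_bounded (x y : nat -> M) : bounded_seq (fun k => mdist (x k) (y k)).
Proof.
by exists (diam L) => k; rewrite ger0_norm ?mdist_ge0// carrier_diam.
Qed.

Lemma udist_small (x y : nat -> M) e : udist x y < e ->
  G [set k | mdist (x k) (y k) < e].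
Proof. exact/(ulim_lt GU)/udist_bounded. Qed.

Lemma udist_xx x : udist x x = 0.
Proof. by rewrite /udist; under eq_fun do rewrite mdistxx; exact: (ulim_const GU). Qed.
Lemma udist_sym x y : udist x y = udist y x.
Proof. by rewrite /udist; under eq_fun do rewrite metric_sym. Qed.
Lemma udist_ge0 x y : 0 <= udist x y.
Proof.
rewrite -[leLHS](ulim_const GU); apply: (ulim_le GU).
- by exists 0 => _; rewrite normr0.
- exact: udist_bounded.
- move=> e e0; apply: filterS filterT => k _ /=.
  have := mdist_ge0 (x k) (y k); lra.
Qed.
Lemma udist_tri y x z : udist x z <= udist x y + udist y z.
Proof.
apply: (ulim_le_const GU); first exact: udist_bounded.
move=> e e0; have h1 : udist x y < udist x y + e/2 by lra.
have h2 : udist y z < udist y z + e/2 by lra.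
apply: filterS (filterI (udist_small h1) (udist_small h2)) => k [/= ? ?].
have := metric_triangle (x k) (y k) (z k); lra.
Qed.

Lemma udist_le (x y : nat -> M) (e : R) :
  (forall e', 0 < e' -> G [set k | mdist (x k) (y k) <= e + e']) -> udist x y <= e.
Proof. by move=> h; apply: (ulim_le_const GU) => //; exact: udist_bounded. Qed.

Lemma udist_eq0 (x y : nat -> M) :
  (forall e', 0 < e' -> G [set k | mdist (x k) (y k) <= e']) -> udist x y = 0.
Proof.
move=> h; apply/eqP; rewrite eq_le udist_ge0 andbT; apply: udist_le => e' e0.
by rewrite add0r; exact: h.
Qed.

Lemma udist_lt (x y : nat -> M) (e : R) : udist x y = 0 -> 0 < e ->
  G [set k | mdist (x k) (y k) <= e].
Proof.
move=> h e0; have : udist x y < e by rewrite h.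
by move=> /udist_small; apply: filterS => k /= /ltW.
Qed.

Lemma udist_cong (x x' y y' : nat -> M) : udist x x' = 0 -> udist y y' = 0 ->
  udist x y = udist x' y'.
Proof.
move=> hx hy; have hx' := hx; have hy' := hy.
rewrite udist_sym in hx'; rewrite udist_sym in hy'.
apply/eqP; rewrite eq_le; apply/andP; split.
  have := udist_tri x' x y; have := udist_tri y' x' y; lra.
have := udist_tri x x' y'; have := udist_tri y x y'; lra.
Qed.

Let carrier_ex : exists x : M, True.
Proof. by case: (carrier_inhabited M) => x; exists x. Qed.

(** A representative of the class of x, which depends on this class only since
    the default point is fixed. *)
Definition urepr (x : nat -> M) : nat -> M :=
  xget (fun=> sval (cid carrier_ex)) [set y | udist x y = 0].

Lemma urepr_dist x : udist x (urepr x) = 0.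
Proof.
by rewrite /urepr; case: xgetP => // /(_ x); case; exact: udist_xx.
Qed.

Lemma urepr_eq x y : udist x y = 0 -> urepr x = urepr y.
Proof.
move=> xy; rewrite /urepr; congr xget; apply/seteqP; split=> z /= <-;
  by apply: udist_cong; rewrite ?udist_xx// udist_sym.
Qed.

Lemma urepr_id x : urepr (urepr x) = urepr x.
Proof. by apply/esym/urepr_eq/urepr_dist. Qed.

Lemma udist_is_distance : is_distance (fun x => urepr x = x) udist.
Proof.
split; [exact: udist_xx| |exact: udist_sym|exact: udist_tri].
by move=> x y <- <- h; apply: urepr_eq; rewrite (udist_cong (urepr_dist _) (urepr_dist _)).
Qed.

Definition ucarrier : metricType R := distance_on udist_is_distance.

Definition uof (x : nat -> M) : ucarrier := exist _ (urepr x) (urepr_id x).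

Lemma mdist_uof (x : ucarrier) (y : nat -> M) : mdist x (uof y) = udist (sval x) y.
Proof. by rewrite distance_onE /=; apply: udist_cong;
  rewrite ?udist_xx// udist_sym urepr_dist. Qed.

Lemma mdist_uof2 (x y : nat -> M) : mdist (uof x) (uof y) = udist x y.
Proof. by rewrite mdist_uof /=; apply: udist_cong;
  rewrite ?udist_xx// udist_sym urepr_dist. Qed.

Lemma ucarrier_inhabited : inhabited ucarrier.
Proof. by constructor; exact: uof (fun=> sval (cid carrier_ex)). Qed.

Lemma ucarrier_diam (x y : ucarrier) : mdist x y <= diam L.
Proof.
apply: udist_le => e e0; apply: filterS filterT => k _ /=.
by have := carrier_diam (sval x k) (sval y k); lra.
Qed.

Definition ufint (f : fsym L) (a : 'I_(farity f) -> ucarrier) : ucarrier :=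
  uof (fun k => fint (fun i => sval (a i) k)).

Lemma tdist_small n (x y : 'I_n -> nat -> M) (e : R) : 0 < e ->
  (forall i, udist (x i) (y i) < e) ->
  G [set k | tdist (x ^~ k) (y ^~ k) < e].
Proof.
move=> e0 h; have := @filter_ord n (fun i => [set k | mdist (x i k) (y i k) < e])
  (fun i => udist_small (h i)).
by apply: filterS => k /= hk; apply/tdist_lt.
Qed.

Lemma ufint_unif (f : fsym L) e (a b : 'I_(farity f) -> ucarrier) :
    0 < e -> tdist a b < fmod f e -> mdist (ufint a) (ufint b) <= e.
Proof.
move=> e0 /(tdist_lt _ _ (fmod_gt0 f e0)) h.
rewrite mdist_uof2; apply: udist_le => e' e'0.
have := @tdist_small _ (fun i => sval (a i)) (fun i => sval (b i)) _ (fmod_gt0 f e0) h.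
by apply: filterS => k /= /(fint_unif e0); lra.
Qed.

Lemma upint_bounded (P : psym L) (a : nat -> 'I_(parity P) -> M) :
  bounded_seq (fun k => pint (a k)).
Proof.
exists (`|plow P| + `|phigh P|) => k; have /andP[h1 h2] := pint_bounds (a k).
rewrite ler_norml.
have := ler_norm (plow P); have := ler_norm (phigh P).
have := ler_norm (- plow P); have := ler_norm (- phigh P); rewrite !normrN.
by move=> *; apply/andP; split; lra.
Qed.

Definition upint (P : psym L) (a : 'I_(parity P) -> ucarrier) : R :=
  ulim G (fun k => pint (fun i => sval (a i) k)).

Lemma upint_bounds (P : psym L) (a : 'I_(parity P) -> ucarrier) :
    plow P <= upint a <= phigh P.
Proof.
apply/andP; split.
  rewrite -[leLHS](ulim_const GU); apply: (ulim_le GU); first by exists `|plow P|.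
    exact: upint_bounded.
  move=> e e0; apply: filterS filterT => k _ /=.
  by have /andP[] := pint_bounds (fun i => sval (a i) k); lra.
apply: (ulim_le_const GU); first exact: upint_bounded.
move=> e e0; apply: filterS filterT => k _ /=.
by have /andP[] := pint_bounds (fun i => sval (a i) k); lra.
Qed.

Lemma upint_unif (P : psym L) e (a b : 'I_(parity P) -> ucarrier) :
    0 < e -> tdist a b < pmod P e -> `|upint a - upint b| <= e.
Proof.
move=> e0 /(tdist_lt _ _ (pmod_gt0 P e0)) h.
apply: (ulim_dist GU); [exact: upint_bounded|exact: upint_bounded|] => e' e'0.
have := @tdist_small _ (fun i => sval (a i)) (fun i => sval (b i)) _ (pmod_gt0 P e0) h.
by apply: filterS => k /= /(pint_unif e0); lra.
Qed.

(** The limit is a diagonal sequence: its value at k is read off from the x s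
    with the largest s for which the first s distances at k are as small as
    they are in the limit. *)
Lemma ucarrier_rapid : rapid_complete ucarrier.
Proof.
move=> x hx.
pose A s := [set k | forall i : 'I_s,
  mdist (sval (x i) k) (sval (x i.+1) k) <= 2 * half_pow R i].
have GA s : G (A s).
  apply: (@filter_ord s
    (fun i => [set k | mdist (sval (x i) k) (sval (x i.+1) k) <= 2 * half_pow R i])).
  move=> i; have h : udist (sval (x i)) (sval (x i.+1)) < 2 * half_pow R i.
    by apply: le_lt_trans (hx i) _; have := half_pow_gt0 R i; lra.
  by apply: filterS (udist_small h) => k /= /ltW.
have [S [SA SG]] := ultra_diagonal GA
  (fun k => (fun i : 'I_0 => match i with Ordinal _ p => match notF p with end end)).
exists (uof (fun k => sval (x (S k)) k)) => s.
rewrite mdist_uof; apply: udist_le => e e0; apply: filterS (SG s) => k /= sk.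
have h t : (s <= t)%N -> (t <= S k)%N ->
    mdist (sval (x s) k) (sval (x t) k) <= 4 * (half_pow R s - half_pow R t).
  elim: t => [|t IH]; first by rewrite leqn0 => /eqP->; rewrite mdistxx subrr mulr0.
  rewrite leq_eqVlt => /orP[/eqP->|]; first by rewrite mdistxx subrr mulr0.
  rewrite ltnS => st tS; apply: le_trans (metric_triangle _ (sval (x t) k) _) _.
  have := IH st (ltnW tS); have := SA k (Ordinal tS); rewrite /= (half_powS R t); lra.
have := h _ sk (leqnn _); have := half_pow_gt0 R (S k); have := half_pow_gt0 R s; lra.
Qed.

Definition ustructure : structure L :=
  Structure ucarrier_inhabited (complete_of_rapid ucarrier_rapid) ucarrier_diam
    ufint_unif upint_bounds upint_unif.

Lemma ufint_cong (f : fsym L) (x y : 'I_(farity f) -> nat -> M) :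
  (forall i, udist (x i) (y i) = 0) ->
  udist (fun k => fint (x ^~ k)) (fun k => fint (y ^~ k)) = 0.
Proof.
move=> h; apply: udist_eq0 => e e0.
have := @tdist_small _ x y _ (fmod_gt0 f e0).
move=> /(_ _)/wrap[i|]; first by rewrite h fmod_gt0.
by apply: filterS => k /= /(fint_unif e0).
Qed.

Lemma teval_ultra n (t : term L n) (v : 'I_n -> ustructure) :
  udist (sval (teval v t)) (fun k => teval (fun i => sval (v i) k) t) = 0.
Proof.
elim: t => [i|f ts IH] /=; first exact: udist_xx.
rewrite udist_sym -[RHS](urepr_dist (fun k => fint (fun i => sval (teval v (ts i)) k))).
apply: udist_cong; last exact: udist_xx.
by apply: (@ufint_cong f (fun i k => _) (fun i k => _)) => i; rewrite udist_sym; exact: IH.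
Qed.

Lemma eval_bounded n (phi : formula L n) (v : nat -> 'I_n -> M) :
  bounded_seq (fun k => eval phi (v k)).
Proof. by exists (fbound phi) => k; exact: eval_bound. Qed.

(** The theorem of Los. Only the supremum is not immediate: for the lower bound,
    near-optimal witnesses chosen at each index form an element of the
    ultrapower. *)
Theorem eval_ultraproduct n (phi : formula L n) (v : 'I_n -> ustructure) :
  eval phi v = ulim G (fun k => eval phi (fun i => sval (v i) k)).
Proof.
elim: phi v => {n}.
- move=> n s t v; apply/esym => /=.
  by apply: udist_cong; rewrite udist_sym; exact: teval_ultra.
- move=> n P ts v /=; apply/eqP; rewrite -subr_eq0 -normr_le0.
  apply/ler_addgt0Pl => e e0; rewrite addr0.
  apply: (ulim_dist GU); [exact: upint_bounded|exact: upint_bounded|] => e' e'0.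
  have := @tdist_small _ (fun i => sval (teval v (ts i)))
    (fun i k => teval (fun i => sval (v i) k) (ts i)) _ (pmod_gt0 P e0).
  move=> /(_ _)/wrap[i|]; first by rewrite teval_ultra pmod_gt0.
  by apply: filterS => k /= /(pint_unif e0); lra.
- by move=> n v /=; rewrite (ulim_const GU).
- move=> n phi IH psi IH' v /=; rewrite IH IH'; apply/esym/(ulim_eq GU) => e e0.
  have e20 : 0 < e / 2 by rewrite divr_gt0.
  apply: filterS (filterI (ulimP GU (eval_bounded phi (fun k i => sval (v i) k)) e20)
     (ulimP GU (eval_bounded psi (fun k i => sval (v i) k)) e20)) => k [/=];
       rewrite !ler_norml => /andP[? ?] /andP[? ?].
  by apply/andP; split; lra.
- move=> n q phi IH v /=; rewrite IH; apply/esym/(ulim_eq GU) => e e0.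
  have q0 : 0 < `|ratr q : R| + 1 by rewrite ltr_wpDl.
  have := ulimP GU (eval_bounded phi (fun k i => sval (v i) k)) (divr_gt0 e0 q0).
  apply: filterS => k /= h; rewrite -mulrBr normrM.
  apply: (@le_trans _ _ (`|ratr q : R| * (e / (`|ratr q : R| + 1)))).
    by rewrite ler_wpM2l.
  by rewrite mulrCA ger_pMr// ler_pdivrMr// mul1r lerDl.
- move=> n phi IH psi IH' v /=; rewrite IH IH'; apply/esym/(ulim_eq GU) => e e0.
  apply: filterS (filterI (ulimP GU (eval_bounded phi (fun k i => sval (v i) k)) e0)
     (ulimP GU (eval_bounded psi (fun k i => sval (v i) k)) e0)) => k [/=];
       rewrite !ler_norml => /andP[? ?] /andP[? ?].
  by rewrite /Num.max; do 2 case: ltP => ?; apply/andP; split; lra.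
- move=> n phi IH v; set vk := fun k i => sval (v i) k.
  have tr (x : ustructure) k : (fun i => sval (trcons v x i) k) = trcons (vk k) (sval x k).
    by apply/funext => i; rewrite /trcons; case: unliftP.
  apply/eqP; rewrite eq_le; apply/andP; split.
    apply: FSup_le => x; rewrite IH;
      apply: (ulim_le GU (eval_bounded phi _) (eval_bounded (FSup phi) _)).
    move=> e e0; apply: filterS filterT => k _ /=; rewrite tr.
    by have := FSup_ub phi (vk k) (sval x k); rewrite /=; lra.
  apply/ler_addgt0Pl => e e0.
  have hx k : exists x : M, eval (FSup phi) (vk k) - e / 2 < eval phi (trcons (vk k) x).
    by apply/FSup_gt; lra.
  have [x xP] := choice hx.
  apply: (@le_trans _ _ (eval phi (trcons v (uof x)) + e)); last first.
    by rewrite addrC lerD2l FSup_ub.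
  rewrite IH; apply: (ulim_leD GU); [exact: eval_bounded..|].
  move=> e' e'0; have e20 : 0 < e / 2 by rewrite divr_gt0.
  have [d [d0 hd]] := eval_unif phi e20.
  apply: filterS (udist_lt (urepr_dist x) d0) => k /= hk.
  rewrite tr; have := xP k.
  have : `|eval phi (trcons (vk k) (x k)) - eval phi (trcons (vk k) (urepr x k))| <= e / 2.
    apply: hd => i; case: (unliftP ord_max i) => [j|] ->.
      by rewrite !trconsK mdistxx ltW.
    by rewrite !trcons_max.
  by rewrite ler_norml /= => /andP[? ?] ?; lra.
Qed.

End Ultra.

(** * Countability of formulas and saturation *)

Section Codes.
Variables (R : realType) (L : language R).
Variables (cf : fsym L -> nat) (cp : psym L -> nat).
Hypotheses (cfI : injective cf) (cpI : injective cp).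

Fixpoint term_code n (t : term L n) : GenTree.tree nat :=
  match t with
  | Var i => GenTree.Leaf (nat_of_ord i)
  | App f ts => GenTree.Node (cf f) [seq term_code (ts i) | i <- enum 'I_(farity f)]
  end.

Lemma map_enum_inj n (T : eqType) (f g : 'I_n -> T) :
  [seq f i | i <- enum 'I_n] = [seq g i | i <- enum 'I_n] -> f =1 g.
Proof. by move=> /eq_in_map h i; apply: h; rewrite mem_enum. Qed.

Lemma term_code_inj n : injective (@term_code n).
Proof.
elim=> [i|f ts IH] [j|g us] //=; first by case=> /val_inj->.
case=> /cfI e; subst g => /map_enum_inj h; congr App.
by apply/funext => i; apply: IH; exact: h.
Qed.

Fixpoint formula_code n (phi : formula L n) : GenTree.tree nat :=
  match phi with
  | FDist _ s t => GenTree.Node 0 [:: term_code s; term_code t]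
  | FPred _ P ts => GenTree.Node 1
      (GenTree.Leaf (cp P) :: [seq term_code (ts i) | i <- enum 'I_(parity P)])
  | FOne _ => GenTree.Node 2 [::]
  | FAdd _ phi psi => GenTree.Node 3 [:: formula_code phi; formula_code psi]
  | FScale _ q phi => GenTree.Node 4 [:: GenTree.Leaf (pickle q); formula_code phi]
  | FMax _ phi psi => GenTree.Node 5 [:: formula_code phi; formula_code psi]
  | FSup _ phi => GenTree.Node 6 [:: formula_code phi]
  end.

(** The arity n is an index of the family, so that the second formula is
    inspected with all data of the first generalised over n. *)
Lemma formula_code_inj n : injective (@formula_code n).
Proof.
move=> phi; elim: phi => {n}.
- move=> n s t psi; case: psi s t => //= {}n s' t' s t.
  by case=> /term_code_inj-> /term_code_inj->.
- move=> n P ts psi; case: psi P ts => //= {}n P' ts' P ts.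
  case=> /cpI e; subst P' => /map_enum_inj h; congr FPred.
  by apply/funext => i; apply: term_code_inj; exact: h.
- by move=> n psi; case: psi.
- move=> n phi IH psi IH' chi; case: chi phi psi IH IH' => //= {}n f g phi psi IH IH'.
  by case=> /IH-> /IH'->.
- move=> n q phi IH chi; case: chi phi IH => //= {}n r f phi IH.
  by case=> /(pcan_inj pickleK)-> /IH->.
- move=> n phi IH psi IH' chi; case: chi phi psi IH IH' => //= {}n f g phi psi IH IH'.
  by case=> /IH-> /IH'->.
- move=> n phi IH chi; case: chi phi IH => //= {}n f phi IH.
  by case=> /IH->.
Qed.

End Codes.

Section CountableFormulas.
Variables (R : realType) (L : language R).

Lemma countable_formulas : countable_language L ->
  exists c : {n : nat & formula L n} -> nat, injective c.
Proof.
move=> [/countable_injP[cf cfI] /countable_injP[cp cpI]].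
have cfI' : injective cf by move=> x y; apply: cfI; rewrite inE.
have cpI' : injective cp by move=> x y; apply: cpI; rewrite inE.
exists (fun x => pickle (tag x, formula_code cf cp (tagged x))).
move=> [n phi] [m psi] /(pcan_inj pickleK) /= [e]; subst m.
by move=> /(formula_code_inj cfI' cpI')->.
Qed.
End CountableFormulas.

Section Saturation.
Variables (R : realType).
Variables (G : set_system nat) (GU : UltraFilter G) (Goo : \oo `<=` G).
Variables (L : language R) (M : structure L).

(** Variables of conditions are either parameters (left) or unknowns (right);
    copair is the corresponding assignment. *)
Definition copair (I J A : Type) (b : I -> A) (d : J -> A) (x : I + J) : A :=
  match x with inl i => b i | inr j => d j end.

(** Approximate solutions of finitely many conditions at a time suffice, since
    solutions of better and better approximations are glued by the diagonal
    argument. This needs countably many conditions, but the parameters and the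
    unknowns are arbitrary. *)
Lemma ultra_saturated (I J : Type) (b : I -> ustructure GU Goo M)
  (S : Type) (enc : S -> nat) (n : S -> nat) (psi : forall s, formula L (n s))
  (t : S -> R) (sg : forall s, 'I_(n s) -> I + J) :
  injective enc ->
  (forall (N : nat) (e : R), 0 < e -> exists d : J -> ustructure GU Goo M,
     forall s, (enc s < N)%N -> eval (psi s) (copair b d \o sg s) <= t s + e) ->
  exists d : J -> ustructure GU Goo M,
    forall s, eval (psi s) (copair b d \o sg s) <= t s.
Proof.
move=> encI h.
have [d dP] := choice (fun N => h N (half_pow R N) (half_pow_gt0 R N)).
pose vk (d : J -> nat -> M) s k : 'I_(n s) -> M :=
  fun i => copair (fun i => sval (b i)) d (sg s i) k.
have vkE d' s k : (fun i => sval ((copair b d' \o sg s) i) k) =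
    vk (fun j => sval (d' j)) s k.
  by apply/funext => i; rewrite /vk /copair /=; case: (sg s i).
pose A N := [set k | forall s, (enc s < N)%N ->
   eval (psi s) (vk (fun j => sval (d N j)) s k) <= t s + 2 * half_pow R N].
have GA N : G (A N).
  have := @filter_ord G GU N (fun i => [set k | forall s, enc s = i ->
     eval (psi s) (vk (fun j => sval (d N j)) s k) <= t s + 2 * half_pow R N]).
  move=> /(_ _)/wrap[i|]; last first.
    by apply: filterS => k /= hk s sN; exact: (hk (Ordinal sN)).
  have [[s si]|ns] := pselect (exists s, enc s = i); last first.
    by apply: filterS filterT => k _ /= s si; case: ns; exists s.
  have sN : (enc s < N)%N by rewrite si.
  have := dP N s sN; rewrite eval_ultraproduct => hl.
  have : ulim G (fun k => eval (psi s) (fun i => sval ((copair b (d N) \o sg s) i) k)) <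
     t s + 2 * half_pow R N by apply: le_lt_trans hl _; have := half_pow_gt0 R N; lra.
  move=> /(ulim_lt GU (eval_bounded _ _)); apply: filterS => k /=.
  by rewrite vkE => /ltW hk s'; rewrite -si => /encI->.
have [N [NA NG]] := ultra_diagonal GU Goo GA (fun k s (p : (enc s < 0)%N) =>
   match notF p with end).
(* At index k, the solution of the best approximation that is valid at k. *)
pose dk j k := sval (d (N k) j) k.
exists (fun j => uof GU (dk j)) => s; rewrite eval_ultraproduct;
  apply: (ulim_le_const GU) => [|e e0].
  exact: eval_bounded.
have e20 : 0 < e / 2 by rewrite divr_gt0.
have [r [r0 hr]] := eval_unif (psi s) e20.
have [N0 hN0] := half_pow_small (divr_gt0 e0 (ltr0Sn R 3)).
have hd : G [set k | forall i : 'I_(n s), mdist (vk dk s k i)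
      (vk (fun j => sval (uof GU (dk j))) s k i) <= r].
  apply: filter_ord => i; rewrite /vk /copair; case: (sg s i) => j.
    by apply: filterS filterT => k _ /=; rewrite mdistxx ltW.
  by apply: udist_lt => //; exact: urepr_dist.
apply: filterS (filterI (NG (maxn N0 (enc s).+1)) hd) => k /= [hk hdk].
rewrite vkE.
have := hr _ _ _ hdk; rewrite ler_norml => /andP[h1 _].
have := NA k s (leq_trans (leq_maxr _ _) hk).
have := half_pow_le R (leq_trans (leq_maxl _ _) hk).
have -> : vk (fun j => sval (d (N k) j)) s k = vk dk s k.
  by apply/funext => i; rewrite /vk /copair; case: (sg s i).
lra.
Qed.

End Saturation.

Section SaturatedModel.
Variables (R : realType) (L : language R).

Definition saturated (U : structure L) : Prop :=
  forall (I J : Type) (b : I -> U)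
    (S : Type) (enc : S -> nat) (n : S -> nat) (psi : forall s, formula L (n s))
    (t : S -> R) (sg : forall s, 'I_(n s) -> I + J),
  injective enc ->
  (forall (N : nat) (e : R), 0 < e -> exists d : J -> U,
     forall s, (enc s < N)%N -> eval (psi s) (copair b d \o sg s) <= t s + e) ->
  exists d : J -> U, forall s, eval (psi s) (copair b d \o sg s) <= t s.

Lemma exists_saturated (T : theory L) (M : model T) :
  exists U : model T, saturated U.
Proof.
have [G [GU Goo]] := ultraFilterLemma eventually_filter.
have mP : forall phi, T phi -> forall v : 'I_0 -> ustructure GU Goo M, eval phi v = 0.
  move=> phi Tphi v; rewrite eval_ultraproduct; apply: ulim_eq => e e0.
  by apply: filterS filterT => k _ /=; rewrite (modelP Tphi) subrr normr0 ltW.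
exists (Model mP) => I J b S enc n psi t sg encI h.
exact: (@ultra_saturated R G GU Goo L M I J b S enc n psi t sg encI h).
Qed.

End SaturatedModel.

(** * Elementary substructures *)

Section TarskiVaught.
Variables (R : realType) (L : language R) (U : structure L) (D : set U).

(** The Tarski-Vaught test for a set D whose closure is to be an elementary
    substructure; witnesses of suprema are only required approximately. *)
Definition tarski_vaught := forall n (phi : formula L n.+1) (v : 'I_n -> U),
  (forall i, D (v i)) -> forall e : R, 0 < e ->
  exists x, D x /\ eval (FSup phi) v - e <= eval phi (trcons v x).

Definition adherent (x : U) := forall e : R, 0 < e -> exists y, D y /\ mdist x y <= e.

Hypothesis TV : tarski_vaught.

Lemma adherent_in x : D x -> adherent x.
Proof. by move=> Dx e e0; exists x; rewrite mdistxx ltW. Qed.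

(** The test applied to -d(f(y), x) gives elements of D arbitrarily close to
    f(y), for y in D. *)
Lemma adherent_fint (f : fsym L) (a : 'I_(farity f) -> U) :
  (forall i, adherent (a i)) -> adherent (fint a).
Proof.
move=> ha e e0; have e20 : 0 < e / 2 by rewrite divr_gt0.
have f0 := fmod_gt0 f e20.
have [y yP] := choice (fun i => ha i _ (divr_gt0 f0 (ltr0Sn R 1))).
have d1 : mdist (fint a) (fint y) <= e / 2.
  apply: fint_unif => //; apply/tdist_lt => // i.
  by apply: le_lt_trans (yP i).2 _; lra.
pose phi : formula L (farity f).+1 :=
  FOpp (FDist (App (fun i => Var L (lift ord_max i))) (Var L ord_max)).
have phiE x : eval phi (trcons y x) = - mdist (fint y) x.
  rewrite eval_FOpp /=; congr (- mdist (fint _) _); last by rewrite trcons_max.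
  by apply/funext => i; rewrite trconsK.
have [x [Dx hx]] := TV phi (fun i => (yP i).1) e20.
exists x; split=> //.
have := FSup_ub phi y (fint y); rewrite !phiE mdistxx in hx * => h2.
have := metric_triangle (fint a) (fint y) x; lra.
Qed.

Lemma adherent_is_distance : is_distance adherent (fun x y : U => mdist x y).
Proof.
split; [exact: mdistxx| |exact: metric_sym|move=> y x z; exact: metric_triangle].
by move=> x y _ _; exact: mdist_positivity.
Qed.

Definition sub_carrier : metricType R := distance_on adherent_is_distance.

Lemma sub_inhabited : inhabited sub_carrier.
Proof.
have [x0] := carrier_inhabited U.
have v0 : 'I_0 -> U by case.
have [x [Dx _]] := @TV 0 (FOne L 1) v0
  (fun i => match i with Ordinal _ p => match notF p with end end) 1 ltr01.
by constructor; exists x; exact: adherent_in.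
Qed.

Lemma sub_rapid : rapid_complete sub_carrier.
Proof.
move=> x hx.
have [y yP] := @rapid_of_complete R U (@carrier_complete _ _ U) 1 0 (fun s => sval (x s))
   (fun s _ => le_trans (hx s) (eq_ind_r (fun z => half_pow R s <= z) (lexx _) (mul1r _))).
have ay : adherent y.
  move=> e e0; have [s hs] := half_pow_small (divr_gt0 e0 (ltr0Sn R 2)).
  have [z [Dz zP]] := svalP (x s) _ (half_pow_gt0 R s).
  exists z; split=> //; have := yP s isT.
  have := metric_triangle y (sval (x s)) z; have := metric_sym y (sval (x s)); lra.
exists (exist _ y ay) => s.
by have := yP s isT; rewrite distance_onE /=; have := half_pow_gt0 R s; lra.
Qed.

Definition sub_fint (f : fsym L) (a : 'I_(farity f) -> sub_carrier) : sub_carrier :=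
  exist _ (fint (fun i => sval (a i))) (adherent_fint (fun i => svalP (a i))).

Definition sub_structure : structure L :=
  @Structure R L sub_carrier sub_inhabited (complete_of_rapid sub_rapid)
    (fun x y => carrier_diam (sval x) (sval y)) sub_fint
    (fun f e a b e0 h => @fint_unif R L U f e _ _ e0 h)
    (fun P a => pint (fun i => sval (a i)))
    (fun P a => pint_bounds _)
    (fun P e a b e0 h => @pint_unif R L U P e _ _ e0 h).

Lemma teval_sub n (t : term L n) (v : 'I_n -> sub_structure) :
  sval (teval v t) = teval (fun i => sval (v i)) t.
Proof. by elim: t => [i|f ts IH] //=; congr fint; apply/funext => i; exact: IH. Qed.

(** For the supremum, a witness in U over the given tuple is replaced by one in D
    over a nearby tuple of D; uniform continuity bounds the loss. *)
Lemma eval_sub n (phi : formula L n) (v : 'I_n -> sub_structure) :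
  eval phi v = eval phi (fun i => sval (v i)).
Proof.
elim: phi v => {n}.
- by move=> n s t v; rewrite /= distance_onE !teval_sub.
- by move=> n P ts v /=; congr pint; apply/funext => i; rewrite teval_sub.
- by [].
- by move=> n phi IH psi IH' v /=; rewrite IH IH'.
- by move=> n q phi IH v /=; rewrite IH.
- by move=> n phi IH psi IH' v /=; rewrite IH IH'.
move=> n phi IH v.
have tr (x : sub_structure) : (fun i => sval (trcons v x i)) =
    trcons (fun i => sval (v i)) (sval x).
  by apply/funext => i; rewrite /trcons; case: unliftP.
apply/eqP; rewrite eq_le; apply/andP; split.
  by apply: FSup_le => x; rewrite IH tr; exact: FSup_ub.
apply/ler_addgt0Pl => e e0; have e30 : 0 < e / 3 by rewrite divr_gt0.
have [d1 [d10 h1]] := eval_unif (FSup phi) e30.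
have [d2 [d20 h2]] := eval_unif phi e30.
have d0 : 0 < Num.min d1 d2 by rewrite lt_min d10.
have [w wP] := choice (fun i => svalP (v i) _ d0).
have [x [Dx hx]] := TV phi (fun i => (wP i).1) e30.
pose x' : sub_structure := exist _ x (adherent_in Dx).
have := FSup_ub phi v x'; rewrite IH tr (_ : sval x' = x)//.
have : `|eval (FSup phi) (fun i => sval (v i)) - eval (FSup phi) w| <= e / 3.
  by apply: h1 => i; apply: le_trans (wP i).2 _; rewrite ge_min lexx.
have : `|eval phi (trcons (fun i => sval (v i)) x) - eval phi (trcons w x)| <= e / 3.
  apply: h2 => i; case: (unliftP ord_max i) => [j|] ->.
    by rewrite !trconsK; apply: le_trans (wP j).2 _; rewrite ge_min lexx orbT.
  by rewrite !trcons_max mdistxx ltW.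
rewrite !ler_norml => /andP[? ?] /andP[? ?] ?; lra.
Qed.

End TarskiVaught.

Section Submodel.
Variables (R : realType) (L : language R) (T : theory L) (U : model T).

Lemma elementary_dist (M N : structure L) (h : M -> N) : elementary h ->
  forall x y, mdist (h x) (h y) = mdist x y.
Proof.
move=> hh x y.
have := hh 2 (FDist (Var L ord0) (Var L ord_max)) (fun i => if i == ord0 then x else y).
by [].
Qed.

Lemma tarski_vaught_model (D : set U) : tarski_vaught D ->
  exists (N : model T) (h : N -> U), [/\ elementary h,
    (forall z, adherent D (h z)) & (forall x, adherent D x -> exists z, h z = x)].
Proof.
move=> TV.
have mP : forall phi, T phi -> forall v : 'I_0 -> sub_structure TV, eval phi v = 0.
  by move=> phi Tphi v; rewrite eval_sub; exact: modelP.
exists (Model mP), (fun z => sval z); split.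
- by move=> n phi v; rewrite eval_sub.
- by move=> z; exact: (svalP z).
- by move=> x ax; exists (exist _ x ax).
Qed.

Hypothesis HL : countable_language L.

(** The hull is the set of values of the finite trees whose nodes are labelled
    by operations. These are the given ones, and for each formula and each
    precision one that chooses approximate witnesses. As there are countably
    many trees, the hull is countable. *)
Lemma skolem_hull (op : nat -> seq U -> U) :
  exists D : set U, [/\ countable D, tarski_vaught D &
    forall s l, (forall x, x \in l -> D x) -> D (op s l)].
Proof.
have [c cI] := countable_formulas HL.
have [u0] := carrier_inhabited U.
have hw (k : nat * nat) : exists w : seq U -> U, forall l n (phi : formula L n.+1),
    c (existT _ n.+1 phi) = k.1 ->
    eval (FSup phi) (fun i => nth u0 l i) - half_pow R k.2 <=
      eval phi (trcons (fun i => nth u0 l i) (w l)).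
  suff h l : exists x, forall n (phi : formula L n.+1),
      c (existT _ n.+1 phi) = k.1 ->
      eval (FSup phi) (fun i => nth u0 l i) - half_pow R k.2 <=
        eval phi (trcons (fun i => nth u0 l i) x).
    by have [w wP] := choice h; exists w.
  have [[n [phi np]]|no] := pselect (exists n (phi : formula L n.+1),
    c (existT _ n.+1 phi) = k.1); last first.
    by exists u0 => n phi np; case: no; exists n, phi.
  have [x hx] : exists x, eval (FSup phi) (fun i => nth u0 l i) - half_pow R k.2 <
      eval phi (trcons (fun i => nth u0 l i) x).
    by apply/FSup_gt; have := half_pow_gt0 R k.2; lra.
  exists x => n' phi'; rewrite -np => /cI e.
  have e1 : n'.+1 = n.+1 := congr1 (@projT1 _ _) e.
  case: e1 => e1; subst n'.
  by rewrite (Eqdep_dec.inj_pair2_eq_dec nat PeanoNat.Nat.eq_dec _ _ _ _ e); exact: ltW.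
have [w wP] := choice hw.
pose op' s : seq U -> U := match (unpickle s : option (nat + nat * nat)) with
  | Some (inl s') => op s' | Some (inr k) => w k | None => fun=> u0 end.
pose fix ev (t : GenTree.tree nat) : U := match t with
  | GenTree.Leaf _ => u0 | GenTree.Node s l => op' s (map ev l) end.
have evl (l : seq U) : (forall x, x \in l -> range ev x) -> exists l', map ev l' = l.
  elim: l => [|x l IH] h; first by exists [::].
  have [y|l' <-] := IH; first by move=> yl; apply: h; rewrite inE yl orbT.
  have [t _ <-] := h x (mem_head _ _).
  by exists (t :: l').
have hop s l : (forall x, x \in l -> range ev x) -> range ev (op' s l).
  by move=> /evl[l' <-]; exists (GenTree.Node s l').
exists (range ev); split.
- by apply: (sub_countable (card_image_le _ _)); exact: countableP.
- move=> n phi v hv e e0; have [k hk] := half_pow_small e0.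
  pose l := [seq v i | i <- enum 'I_n].
  have lE : (fun i : 'I_n => nth u0 l i) = v.
    apply/funext => i; rewrite (nth_map i) ?size_enum_ord//.
    by rewrite nth_ord_enum.
  pose s := pickle (inr (c (existT _ n.+1 phi), k) : nat + nat * nat).
  exists (op' s l); split.
    by apply: hop => x /mapP[i _ ->]; exact: hv.
  rewrite /op' /s pickleK; have := wP (c (existT _ n.+1 phi), k) l n phi erefl.
  by rewrite lE /=; lra.
- move=> s l hl; have := hop (pickle (inl s : nat + nat * nat)) l hl.
  by rewrite /op' pickleK.
Qed.

End Submodel.

(** * The topology of type spaces *)

Section TypeTopology.
Variables (R : realType) (L : language R).

(** Formulas carry no decidable equality, so this is read off from the
    supremum topology directly. *)
Lemma fvalues_proj_continuous n (phi : formula L n) :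
  continuous (fun p : fvalues L n => p phi).
Proof.
move=> p A nA.
have /cvg_sup/(_ phi) h : nbhs p --> p by exact: cvg_id.
apply: h; exact: (@initial_continuous _ _ (fun f : forall _ : formula L n, R => f phi) p).
Qed.

Variables (n : nat) (A : set (fvalues L n)).
Hypothesis hA : forall p, A p -> exists (M : structure L) (a : 'I_n -> M), p = tpfun a.

Lemma type_eval_continuous (phi : formula L n) :
  continuous (fun p : set_type A => sval p phi).
Proof.
move=> p; apply: (@continuous_comp _ _ _ (fun p : set_type A => set_val p)
   (fun q : fvalues L n => q phi)).
  exact: initial_continuous.
exact: fvalues_proj_continuous.
Qed.

Lemma type_gt0_nbhs (p : set_type A) (phi : formula L n) :
  0 < sval p phi -> nbhs p [set q : set_type A | 0 < sval q phi].
Proof.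
move=> h; have /= := @type_eval_continuous phi p [set x | 0 < x].
by apply; exact: (lt_nbhsr h).
Qed.

(** The sets [psi > 0] form a base of the logic topology: they are closed under
    intersection by taking minima, and they isolate values of formulas by
    near_formula. *)
Lemma type_basis (p : set_type A) (O : set (set_type A)) : nbhs p O ->
  exists psi : formula L n, 0 < sval p psi /\
    forall q : set_type A, 0 < sval q psi -> O q.
Proof.
move=> nO.
have [M [a pa]] := hA (set_mem (svalP p)).
(* The filter generated by the sets [psi > 0] around p converges to p. *)
pose F := filter_from [set psi : formula L n | 0 < sval p psi]
  (fun psi => [set q : fvalues L n | A q /\ 0 < q psi]).
have FF : Filter F.
  apply: filter_from_filter.
    by exists (FOne L n); rewrite /= pa /tpfun /=.
  move=> psi chi; rewrite /= pa /tpfun => h1 h2.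
  exists (FMin psi chi).
    by change (0 < eval (FMin psi chi) a); rewrite eval_FMin lt_min h1.
  move=> q [Aq]; have [N [b qb]] := hA Aq; subst q; change (0 < eval (FMin psi chi) b ->
    (A `&` [set q | 0 < q psi] `&` (A `&` [set q | 0 < q chi])) (tpfun b)).
  by rewrite eval_FMin lt_min => /andP[].
have Fp : F --> sval p.
  apply/cvg_sup => phi O' [V [[B oB <-] Bp] VO].
  have : nbhs (sval p phi) B by exact: open_nbhs_nbhs.
  move=> /nbhs_ballP[e /= e0 eB].
  have [psi [[d d0 h1] h2]] := near_formula phi (sval p phi) (divr_gt0 e0 (ltr0Sn R 1)).
  exists psi.
    by rewrite /= {1}pa /tpfun; apply: h1; rewrite pa /tpfun subrr normr0 ltW.
  move=> q [Aq qpsi]; apply: VO; apply: eB; rewrite /ball /=.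
  have [N [b qb]] := hA Aq; move: qpsi; rewrite qb /tpfun => /h2 h.
  by rewrite distrC; apply: le_lt_trans h _; lra.
case: nO => V [[B oB <-] Bp] VO.
have [psi /= ppsi hpsi] : F B by apply: Fp; exact: open_nbhs_nbhs.
by exists psi; split=> // q qpsi; apply/VO/hpsi; split=> //; exact: (set_mem (svalP q)).
Qed.

Lemma type_hausdorff : hausdorff_space (set_type A).
Proof.
move=> p q pq; apply: val_inj; apply/funext => phi /=.
apply/eqP; rewrite -subr_eq0 -normr_le0; apply/ler_addgt0Pl => e e0.
have e20 : 0 < e / 2 by rewrite divr_gt0.
have np : nbhs p [set r : set_type A | ball (sval p phi) (e / 2) (sval r phi)].
  exact: (@type_eval_continuous phi p _ (nbhsx_ballx _ _ e20)).
have nq : nbhs q [set r : set_type A | ball (sval q phi) (e / 2) (sval r phi)].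
  exact: (@type_eval_continuous phi q _ (nbhsx_ballx _ _ e20)).
have [r [/= h1 h2]] := pq _ _ np nq.
move: h1 h2; rewrite /ball /= !ltr_norml ler_norml => /andP[? ?] /andP[? ?].
by apply/andP; split; lra.
Qed.

End TypeTopology.

Section Realize.
Variables (R : realType) (L : language R).

Lemma near_formulas n (fs : list (formula L n)) (p : formula L n -> R) (e : R) : 0 < e ->
  exists psi : formula L n,
    (exists2 d, 0 < d & forall (M : structure L) (v : 'I_n -> M),
       (forall phi, List.In phi fs -> `|eval phi v - p phi| <= d) -> 0 < eval psi v) /\
    forall (M : structure L) (v : 'I_n -> M),
       0 < eval psi v -> forall phi, List.In phi fs -> `|eval phi v - p phi| <= e.
Proof.
move=> e0; elim: fs => [|phi fs [psi [[d d0 h1] h2]]].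
  by exists (FOne L n); split=> //; exists 1.
have [chi [[d' d'0 h1'] h2']] := near_formula phi (p phi) e0.
exists (FMin psi chi); split.
  exists (Num.min d d'); first by rewrite lt_min d0.
  move=> M v h; rewrite eval_FMin lt_min; apply/andP; split.
    apply: h1 => f hf; apply: le_trans (h f (or_intror hf)) _.
    by rewrite ge_min lexx.
  by apply: h1'; apply: le_trans (h _ (or_introl erefl)) _; rewrite ge_min lexx orbT.
move=> M v; rewrite eval_FMin lt_min => /andP[/h2 h /h2' h'] f [<-//|]; exact: h.
Qed.

(** By proj_formula, whether an open condition has a solution over v is decided
    by the value of a formula at v, hence by the type of v. *)
Lemma transfer n q k (sg : 'I_k -> 'I_n + 'I_q) (psi : formula L k)
  (M N : structure L) (v : 'I_n -> M) (w : 'I_n -> N) (z : 'I_q -> M) :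
  tpfun v = tpfun w -> 0 < eval psi (copair v z \o sg) ->
  exists z' : 'I_q -> N, 0 < eval psi (copair w z' \o sg).
Proof.
move=> vw h; have [psi' hpsi] := proj_formula sg psi.
have : 0 < eval psi' v by apply/hpsi; exists z.
by rewrite -[eval psi' v]/(tpfun v psi') vw => /hpsi.
Qed.

Variables (U : structure L) (satU : saturated U) (HL : countable_language L).

(** Saturation for the conditions phi <= p(phi) and - phi <= - p(phi), of which
    there are countably many. *)
Lemma realize_values n q k (sg : 'I_k -> 'I_n + 'I_q) (b : 'I_n -> U)
  (p : formula L k -> R) :
  (forall (fs : list (formula L k)) (e : R), 0 < e -> exists d : 'I_q -> U,
     forall phi, List.In phi fs -> `|eval phi (copair b d \o sg) - p phi| <= e) ->
  exists d : 'I_q -> U, forall phi, eval phi (copair b d \o sg) = p phi.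
Proof.
move=> h; have [c cI] := countable_formulas HL.
pose enc (s : formula L k * bool) := pickle (c (existT _ k s.1), s.2).
have encI : injective enc.
  move=> [f x] [g y] /(pcan_inj pickleK)[/cI e ->].
  by rewrite (Eqdep_dec.inj_pair2_eq_dec nat PeanoNat.Nat.eq_dec _ _ _ _ e).
have fin N : exists fs : list (formula L k), forall s, (enc s < N)%N -> List.In s.1 fs.
  elim: N => [|N [fs IH]]; first by exists nil.
  have [[s hs]|no] := pselect (exists s, enc s = N); last first.
    exists fs => s; rewrite ltnS leq_eqVlt => /orP[/eqP e|/IH//].
    by case: no; exists s.
  exists (s.1 :: fs) => s'; rewrite ltnS leq_eqVlt => /orP[/eqP e|/IH]; last by right.
  by left; rewrite (encI s s')// hs e.
pose psi (s : formula L k * bool) := if s.2 then s.1 else FOpp s.1.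
pose t (s : formula L k * bool) := if s.2 then p s.1 else - p s.1.
have [d dP] : exists d : 'I_q -> U, forall s, eval (psi s) (copair b d \o sg) <= t s.
  apply: (@satU _ _ b _ enc (fun=> k) psi t (fun=> sg) encI) => N e e0.
  have [fs hfs] := fin N; have [d hd] := h fs e e0.
  exists d => s /hfs /hd; rewrite /psi /t ler_norml => /andP[h1 h2].
  by case: s.2; rewrite ?eval_FOpp; lra.
exists d => phi; apply/eqP; rewrite eq_le.
have := dP (phi, true); rewrite /psi /t /= => -> /=.
by have := dP (phi, false); rewrite /psi /t [_.2]/= eval_FOpp /=; lra.
Qed.

(** Saturation in the usual sense. It is applied to the type of the whole tuple,
    and all choices of variables from v and z follow by renaming. *)
Lemma realize_over n q (M : structure L) (v : 'I_n -> M) (w : 'I_n -> U) (z : 'I_q -> M) :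
  tpfun v = tpfun w -> exists z' : 'I_q -> U,
    forall k (sg : 'I_k -> 'I_n + 'I_q),      tpfun (copair v z \o sg) = tpfun (copair w z' \o sg).
Proof.
move=> vw.
have [d dP] : exists d : 'I_q -> U, forall phi,
  eval phi (copair w d \o @fintype.split n q) =
   tpfun (copair v z \o @fintype.split n q) phi; last first.
  exists d => k sg; apply/funext => phi.
  have := dP (frename phi (fun i => unsplit (sg i))); rewrite /tpfun !eval_rename => e.
  have E (N : structure L) (a : 'I_n -> N) c :
     ((copair a c \o @fintype.split n q) \o (fun i => unsplit (sg i))) = copair a c \o sg.
    by apply/funext => i /=; rewrite unsplitK.
  by rewrite !E in e.
apply: realize_values => fs e e0.
have [psi [[r r0 h1] h2]] := near_formulas fs (tpfun (copair v z \o @fintype.split n q)) e0.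
have hv : 0 < eval psi (copair v z \o @fintype.split n q).
  by apply: h1 => phi _; rewrite /tpfun subrr normr0 ltW.
have [z' hz] := transfer vw hv.
by exists z'; exact: h2.
Qed.

End Realize.

Section TypeSpaces.
Variables (R : realType) (L : language R) (T : theory L).
Hypotheses (HL : countable_language L) (HT : complete_theory T).
Variables (U : model T) (satU : saturated U).

Lemma types_realized n p : types_set T n p ->
  exists (M : structure L) (a : 'I_n -> M), p = tpfun a.
Proof. by move=> [M [a ->]]; exists M, a. Qed.

Lemma tp_eq n (M N : model T) (a : 'I_n -> M) (b : 'I_n -> N) :
  tp a = tp b <-> tpfun a = tpfun b.
Proof. by split=> [[]//|e]; apply: val_inj. Qed.

Lemma tpfun0 (M N : model T) (a : 'I_0 -> M) (b : 'I_0 -> N) : tpfun a = tpfun b.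
Proof. by apply/funext => phi; exact: HT.2. Qed.

Lemma type_realized n (p : types T n) : exists a : 'I_n -> U, p = tp a.
Proof.
have [M [a pa]] := set_mem (svalP p).
have v0 (A : Type) : 'I_0 -> A by case.
have [b hb] := realize_over satU HL a (tpfun0 (v0 M) (v0 U)).
exists b; apply: val_inj => /=; rewrite pa.
exact: (hb n inr).
Qed.

(** The limit of an ultrafilter of types is computed formula by formula; it is
    a type because finitely many of its values are approximated by an actual
    type, and U is saturated. *)
Lemma types_compact n : compact [set: types T n].
Proof.
rewrite compact_ultra => F FU _.
have bd (phi : formula L n) : bounded_seq (fun q : types T n => sval q phi).
  exists (fbound phi) => q; have [M [a ->]] := set_mem (svalP q).
  exact: eval_bound.
pose p (phi : formula L n) := ulim F (fun q : types T n => sval q phi).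
have v0 (A : Type) : 'I_0 -> A by case.
have [c hc] : exists c : 'I_n -> U, forall phi, eval phi (copair (v0 U) c \o inr) = p phi.
  2: {exists (tp c); split=> // O nO.
  have [psi [h1 h2]] := type_basis (@types_realized n) nO.
  have /ulim_gt : 0 < p psi by rewrite -hc.
  by move=> /(_ (bd psi)); apply: filterS => q; exact: h2. }
apply: (realize_values satU HL) => fs e e0.
have [psi [[r r0 h1] h2]] := near_formulas fs p e0.
have Fr : F [set q | forall phi, List.In phi fs -> `|sval q phi - p phi| <= r].
  elim: (fs) => [|phi s IH]; first by apply: filterS filterT => q _ phi [].
  apply: filterS (filterI (ulimP FU (bd phi) r0) IH) => q [hq hq'] chi [<-//|].
  exact: hq'.
have [q hq] := filter_ex Fr; have [a qa] := type_realized q.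
by exists a; apply: h2; apply: h1; rewrite qa in hq.
Qed.

Lemma restr_subproof k n (r : 'I_n -> 'I_k) (p : types T k) :
  (fun phi : formula L n => sval p (frename phi r)) \in types_set T n.
Proof.
have [M [a pa]] := set_mem (svalP p).
apply/mem_set; exists M, (a \o r); apply/funext => phi.
by rewrite pa /tpfun eval_rename.
Qed.

(** The type of a o r, when p is the type of a. *)
Definition restr k n (r : 'I_n -> 'I_k) (p : types T k) : types T n :=
  exist (fun x : fvalues L n => x \in types_set T n) _ (restr_subproof r p).

Lemma restr_tp k n (r : 'I_n -> 'I_k) (M : model T) (a : 'I_k -> M) :
  restr r (tp a) = tp (a \o r).
Proof. by apply: val_inj; apply/funext => phi /=; rewrite /tpfun eval_rename. Qed.

Lemma restr_continuous k n (r : 'I_n -> 'I_k) : continuous (restr r).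
Proof.
move=> p O nO; have [psi [h1 h2]] := type_basis (@types_realized n) nO.
by apply: filterS (type_gt0_nbhs (p := p) (phi := frename psi r) h1) => q;
  exact: (h2 (restr r q)).
Qed.

End TypeSpaces.

(** * Perturbations of types *)

Section Perturbations.
Variables (R : realType) (L : language R) (T : theory L).
Hypotheses (HL : countable_language L) (HT : complete_theory T).
Variables (U : model T) (satU : saturated U).
(* So that the arity stays an explicit argument of pp. *)
Unset Implicit Arguments.
Variables (pp : R -> type_rel T) (Hpp : pert_system pp).
Set Implicit Arguments.

Lemma closed_pre (X Y : topologicalType) (f : X -> Y) (D : set Y) :
  continuous f -> closed D -> closed (f @^-1` D).
Proof. by move=> fc; apply: preimage_closed => x _; exact: fc. Qed.

Lemma pp_refl (d : R) n (p : types T n) : 0 <= d -> pp d n (p, p).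
Proof. by move=> d0; have [h _] := pert_system_radius Hpp d0; have [_] := h n. Qed.

Lemma pp_closed (d : R) n : 0 <= d -> closed (pp d n).
Proof. by move=> d0; have [h _] := pert_system_radius Hpp d0; have [] := h n. Qed.

Lemma pp_pert (d : R) n (p q : types T n) : 0 <= d -> pp d n (p, q) ->
  exists (M N : model T) (f : M -> N) (a : 'I_n -> M),
    [/\ Pert (pp d) f, tp a = p & tp (f \o a) = q].
Proof. by move=> d0; have [_ h] := pert_system_radius Hpp d0; exact: h. Qed.

Lemma pp_sym (d : R) n (p q : types T n) : 0 <= d -> pp d n (p, q) -> pp d n (q, p).
Proof. by move=> d0; exact: pert_system_sym. Qed.

Lemma pp_trans (d d' : R) n (p q r : types T n) : 0 <= d -> 0 <= d' ->
  pp d n (p, q) -> pp d' n (q, r) -> pp (d + d') n (p, r).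
Proof.
move=> d0 d'0 pq qr; rewrite addrC.
by apply: (pert_system_comp Hpp d'0 d0); exists q.
Qed.

Lemma pp_le (d d' : R) n (p q : types T n) : 0 <= d -> d <= d' ->
  pp d n (p, q) -> pp d' n (p, q).
Proof.
move=> d0 dd' pq; have := pp_trans d0 _ pq (pp_refl q _).
by move=> /(_ (d' - d)); rewrite subr_ge0 addrC subrK; apply.
Qed.

Lemma pp0 n (p q : types T n) : pp 0 n (p, q) <-> p = q.
Proof. by rewrite (pert_system_id Hpp). Qed.

Lemma pp_restr (d : R) k n (r : 'I_n -> 'I_k) (p q : types T k) : 0 <= d ->
  pp d k (p, q) -> pp d n (restr r p, restr r q).
Proof.
move=> d0 /(pp_pert d0)[M [N [f [a [fP <- <-]]]]].
by rewrite !restr_tp; have [_ -> //] := fP n (a \o r).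
Qed.

Lemma compact_types2 k n : compact [set: types T k * types T n].
Proof.
by rewrite -setXTT; apply: compact_setX; exact: (types_compact HL HT satU).
Qed.

Lemma closed_compact_types n (C : set (types T n)) : closed C -> compact C.
Proof.
move=> cC; rewrite -(setTI C).
exact: compact_closedI (types_compact HL HT satU (n := n)) cC.
Qed.

Lemma types_closed1 n (p : types T n) : closed [set p].
Proof.
apply: accessible_closed_set1; apply: hausdorff_accessible.
exact: type_hausdorff.
Qed.

(** The types p of k-tuples with an extension of q as a perturbation form the
    projection of a compact set, hence a closed set. It contains the types of
    all k-tuples that extend a in the domain of a perturbation f that sends a to
    a realisation of q, and these are dense among the types that extend tp a
    (lemma transfer). *)
Lemma pp_extend (d : R) n k (r : 'I_n -> 'I_k) (p : types T k) (q : types T n) :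
  0 <= d -> injective r -> pp d n (restr r p, q) ->
  exists q' : types T k, restr r q' = q /\ pp d k (p, q').
Proof.
move=> d0 rI /(pp_pert d0)[M [N [f [a [fP ap aq]]]]].
pose C := pp d k `&` (snd @^-1` (restr r @^-1` [set q])).
have cC : closed C.
  apply: closedI; first exact: pp_closed.
  apply: closed_pre; first by move=> x; exact: cvg_snd.
  by apply: closed_pre; [exact: restr_continuous|exact: types_closed1].
have cK : compact C.
  by rewrite -(setTI C); apply: compact_closedI cC; exact: compact_types2.
have cS : closed (fst @` C).
  apply: compact_closed; first exact: type_hausdorff.
  apply: continuous_compact cK.
  by apply: continuous_subspaceT => x; exact: cvg_fst.
have [[p1 q1] [/= h1 h2] h3] : (fst @` C) p.
  apply: cS => O nO; have [psi [h1 h2]] := type_basis (@types_realized _ _ _ k) nO.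
  have [c pc] := type_realized HL HT satU p; subst p.
  (* Variables in the range of r are prescribed by a, the others are free. *)
  pose sg (l : 'I_k) : 'I_n + 'I_k :=
    if [pick j | r j == l] is Some j then inl j else inr l.
  have sgr j : sg (r j) = inl j.
    rewrite /sg; case: pickP => [j' /eqP/rI->//|/(_ j)]; by rewrite eqxx.
  have sgc : copair (c \o r) c \o sg = c.
    by apply/funext => l; rewrite /sg /=; case: pickP => //= j /eqP->.
  have hv : 0 < eval psi (copair (c \o r) c \o sg) by rewrite sgc.
  have va : tpfun (c \o r) = tpfun a.
    by apply/tp_eq; rewrite ap restr_tp.
  have [z hz] := transfer va hv.
  pose c1 := copair a z \o sg.
  exists (tp c1); split; last exact: h2.
  exists (tp c1, tp (f \o c1)) => //; split => /=.
    by have [_ -> //] := fP k c1.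
  rewrite /preimage /= restr_tp -aq; congr tp; apply/funext => j /=.
  by rewrite /c1 /= sgr.
by exists q1; split=> //; move: h3 h1 => /= ->.
Qed.

Lemma extend_tuple (d : R) n q (M : model T) (v : 'I_n -> M) (z : 'I_q -> M)
  (w : 'I_n -> U) :
  0 <= d -> pp d n (tp v, tp w) ->
  exists z' : 'I_q -> U, forall k (sg : 'I_k -> 'I_n + 'I_q),
    pp d k (tp (copair v z \o sg), tp (copair w z' \o sg)).
Proof.
move=> d0 vw.
have E (A : Type) (a : 'I_n -> A) (c : 'I_q -> A) :
    (copair a c \o @fintype.split n q) \o lshift q = a.
  by apply/funext => i /=; rewrite -[lshift q i]/(unsplit (inl i)) unsplitK.
have E' (A : Type) (a : 'I_n -> A) (c : 'I_q -> A) k (sg : 'I_k -> 'I_n + 'I_q) :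
    (copair a c \o @fintype.split n q) \o (fun i => unsplit (sg i)) = copair a c \o sg.
  by apply/funext => i /=; rewrite unsplitK.
have [q' [hq' hpq]] : exists q' : types T (n + q), restr (lshift q) q' = tp w /\
    pp d (n + q) (tp (copair v z \o @fintype.split n q), q').
  by apply: pp_extend => //; [exact: lshift_inj|rewrite restr_tp E].
have [e eq'] := type_realized HL HT satU q'; subst q'.
have ew : tpfun (e \o lshift q) = tpfun w by apply/tp_eq; rewrite -restr_tp.
have [z' hz'] := realize_over satU HL (e \o @rshift n q) ew.
exists z' => k sg.
have := pp_restr (fun i => unsplit (sg i)) d0 hpq; rewrite !restr_tp E'.
congr (pp d k (_, _)); apply/tp_eq; rewrite -hz'; congr tpfun.
by apply/funext => i /=; case: (sg i).
Qed.

Definition dist_formula : formula L 2 := FDist (Var L ord0) (Var L ord_max).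

Definition pair2 (A : Type) (x y : A) : 'I_2 -> A := fun i => if i == ord0 then x else y.

Lemma tp_dist n (M N : model T) (a : 'I_n -> M) (b : 'I_n -> N) i j :
  tp a = tp b -> mdist (a i) (a j) = mdist (b i) (b j).
Proof.
move=> /tp_eq ab; have := congr1 (fun f => f (FDist (Var L i) (Var L j))) ab.
by [].
Qed.

(** One inequality suffices, as the relations pp d are symmetric. *)
Definition dist_modulus (d th : R) := forall p q : types T 2,
  pp d 2 (p, q) -> sval q dist_formula <= sval p dist_formula + th.

Lemma dist_modulusP d th k (M N : model T) (a : 'I_k -> M) (b : 'I_k -> N) i j :
  0 <= d -> dist_modulus d th -> pp d k (tp a, tp b) ->
  mdist (b i) (b j) <= mdist (a i) (a j) + th.
Proof.
move=> d0 dm ab; have := dm _ _ (pp_restr (pair2 i j) d0 ab).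
by rewrite !restr_tp.
Qed.

Lemma nested_types (C : nat -> set (types T 2 * types T 2)) :
  (forall k, closed (C k)) -> (forall k, C k.+1 `<=` C k) ->
  (forall k, C k !=set0) -> exists x, forall k, C k x.
Proof.
move=> cC dC nC; have [x xP] := choice nC.
have [y [_ hy]] := @compact_types2 2 2 (x @ \oo) _ filterT.
exists y => k; apply: cC => O nO.
have sub j : (k <= j)%N -> C j `<=` C k.
  elim: j => [|j IH]; first by rewrite leqn0 => /eqP->.
  rewrite leq_eqVlt => /orP[/eqP->//|]; rewrite ltnS => /IH; exact: subset_trans (dC j).
have [] := hy (C k) O _ nO; last by move=> z hz; exists z.
by exists k => // j /= kj; exact: (sub j kj _ (xP j)).
Qed.

Lemma closed_ge_preimage (X : topologicalType) (g : X -> R) (c : R) :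
  continuous g -> closed [set x | c <= g x].
Proof.
by move=> gc; apply: (@closed_pre _ _ g [set x | c <= x]); [exact: gc|exact: closed_ge].
Qed.

Lemma dist_formula_continuous : continuous (fun p : types T 2 => sval p dist_formula).
Proof. exact: type_eval_continuous. Qed.

Lemma dist1_continuous :
  continuous (fun pq : types T 2 * types T 2 => sval pq.1 dist_formula).
Proof.
move=> pq; apply: (@continuous_comp _ _ _ (@fst _ _)
  (fun p : types T 2 => sval p dist_formula)).
  exact: cvg_fst.
exact: dist_formula_continuous.
Qed.

Lemma dist2_continuous :
  continuous (fun pq : types T 2 * types T 2 => sval pq.2 dist_formula).
Proof.
move=> pq; apply: (@continuous_comp _ _ _ (@snd _ _)
  (fun p : types T 2 => sval p dist_formula)).
  exact: cvg_snd.
exact: dist_formula_continuous.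
Qed.

(** Otherwise, by compactness some pair of types in all pp (1 / 2^k), hence in
    pp 0, would have different distances; but pp 0 is equality. *)
Lemma exists_modulus (th : R) : 0 < th -> exists2 d, 0 < d & dist_modulus d th.
Proof.
move=> th0; apply: contrapT => hn.
pose g (pq : types T 2 * types T 2) := sval pq.2 dist_formula - sval pq.1 dist_formula.
have gc : continuous g.
  by move=> pq; apply: (@cvgB R R^o); [exact: dist2_continuous|exact: dist1_continuous].
pose C k := pp (half_pow R k) 2 `&` [set pq | th <= g pq].
have [||k|[p q] hpq] := @nested_types C.
- move=> k; apply: closedI; first exact/pp_closed/ltW/half_pow_gt0.
  exact: closed_ge_preimage.
- move=> k [p q] [/= h1 h2]; split => //.
  by apply: pp_le h1; [exact/ltW/half_pow_gt0|exact: half_pow_le].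
- apply: contrapT => /nonemptyPn h0; apply: hn; exists (half_pow R k);
  first exact: half_pow_gt0.
  move=> p q pq; rewrite leNgt; apply/negP => h.
  have : C k (p, q) by split=> //=; rewrite /g /=; lra.
  by rewrite h0.
have : pp 0 2 (p, q).
  rewrite (pert_system_cont Hpp (u := half_pow R)) => //.
  - by move=> k _; have [] := hpq k.
  - by move=> k; exact: half_pow_le.
  - apply/cvgrPdist_le => e e0; have [s hs] := half_pow_small e0.
    exists s => // t /= st; rewrite sub0r normrN ger0_norm; last exact/ltW/half_pow_gt0.
    exact: le_trans (half_pow_le R st) hs.
move=> /pp0 pq; have [_ /=] := hpq 0; rewrite /g /= pq; lra.
Qed.

(** For fixed d: otherwise, by compactness some pair of types in pp d would have
    distance 0 on the left and positive distance on the right; but a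
    perturbation is a function. *)
Lemma exists_small_modulus (d eta : R) : 0 <= d -> 0 < eta ->
  exists2 xi, 0 < xi & forall p q : types T 2, pp d 2 (p, q) ->
    sval p dist_formula <= xi -> sval q dist_formula <= eta.
Proof.
move=> d0 eta0; apply: contrapT => hn.
pose C k := pp d 2 `&` ([set pq | - half_pow R k <= - sval pq.1 dist_formula] `&`
  [set pq | eta <= sval pq.2 dist_formula]).
have [||k|[p q] hpq] := @nested_types C.
- move=> k; apply: closedI; first exact/pp_closed.
  apply: closedI; apply: closed_ge_preimage.
    by move=> pq; apply: (@cvgN R R^o); exact: dist1_continuous.
  exact: dist2_continuous.
- move=> k [p q] [/= h1 [h2 h3]]; split => //; split=> //=.
  by apply: le_trans h2; rewrite lerN2 half_pow_le.
- apply: contrapT => /nonemptyPn h0; apply: hn; exists (half_pow R k);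
  first exact: half_pow_gt0.
  move=> p q pq h1; rewrite leNgt; apply/negP => h.
  have : C k (p, q) by split=> //=; split=> /=; [rewrite lerN2|exact: ltW].
  by rewrite h0.
have [pq [_ /= h2]] := hpq 0.
have [M [N [f [a [_ pa qa]]]]] := pp_pert d0 pq.
have d00 : mdist (a ord0) (a ord_max) = 0.
  apply/eqP; rewrite eq_le mdist_ge0 andbT; apply/ler_addgt0Pl => e e0.
  have [k hk] := half_pow_small e0; have [_ [/= h _]] := hpq k.
  by move: h; rewrite lerN2 -pa /tpfun /=; lra.
by move: h2; rewrite -qa /tpfun /= (mdist_positivity _ _ d00) mdistxx; lra.
Qed.

(** The type q satisfies the perturbation of p by d, with an error e in
    distance. Any realisation b of q in U has such a witness b' (fuzzy_over). *)
Definition fuzzy (d e : R) k (p q : types T k) := exists b b' : 'I_k -> U,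
  [/\ q = tp b, pp d k (p, tp b') & forall i, mdist (b i) (b' i) <= e].

Lemma fuzzy_le (d e d' e' : R) k (p q : types T k) : 0 <= d -> d <= d' -> e <= e' ->
  fuzzy d e p q -> fuzzy d' e' p q.
Proof.
move=> d0 dd ee [b [b' [-> h1 h2]]]; exists b, b'; split=> //.
  exact: pp_le h1.
by move=> i; exact: le_trans ee.
Qed.

Lemma fuzzy_restr (d e : R) k n (r : 'I_n -> 'I_k) (p q : types T k) : 0 <= d ->
  fuzzy d e p q -> fuzzy d e (restr r p) (restr r q).
Proof.
move=> d0 [b [b' [-> h1 h2]]]; exists (b \o r), (b' \o r); split.
- by rewrite restr_tp.
- by rewrite -restr_tp; exact: pp_restr.
- by move=> i; exact: h2.
Qed.

Lemma fuzzy_over d e k (p : types T k) (b : 'I_k -> U) : fuzzy d e p (tp b) ->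
  exists b' : 'I_k -> U, pp d k (p, tp b') /\ forall i, mdist (b i) (b' i) <= e.
Proof.
move=> [b1 [b1' [/tp_eq/esym bb h1 h2]]].
have [b' hb'] := realize_over satU HL b1' bb.
exists b'; split.
  by have /tp_eq <- : tpfun b1' = tpfun b' := hb' k inr.
move=> i; have /tp_eq := hb' 2 (pair2 (inl i) (inr i)).
by move=> /(tp_dist ord0 ord_max) /= <-.
Qed.

(** The witness b' of the first relation is carried along by the perturbation
    of the second, at the price of its modulus th. *)
Lemma fuzzy_comp (d e d' e' th : R) k (p q r : types T k) : 0 <= d -> 0 <= d' ->
  dist_modulus d' th -> fuzzy d e p q -> fuzzy d' e' q r ->
    fuzzy (d + d') (e + e' + th) p r.
Proof.
move=> d0 d'0 dm [b [b' [-> h1 h2]]] [c [c' [-> h3 h4]]].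
have [z hz] := extend_tuple b' d'0 h3.
exists c, z; split=> //.
  exact: pp_trans h1 (hz k inr).
move=> i; have := dist_modulusP ord0 ord_max d'0 dm (hz 2 (pair2 (inl i) (inr i))).
have := metric_triangle (c i) (c' i) (z i); have := h2 i; have := h4 i.
by rewrite /=; lra.
Qed.

Lemma pp_fuzzy d k (p q : types T k) : pp d k (p, q) -> fuzzy d 0 p q.
Proof.
move=> h; have [b qb] := type_realized HL HT satU q.
by exists b, b; split=> //; [rewrite -qb|move=> i; rewrite mdistxx].
Qed.

Lemma pp_section_closed d k (p : types T k) : 0 <= d -> closed [set q | pp d k (p, q)].
Proof.
move=> d0 q hq; apply: pp_closed => // O [[V W] [n1 n2] sO].
have [q' [h h']] := hq W n2; exists (p, q'); split=> //.
by apply: sO; split=> //=; exact: nbhs_singleton.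
Qed.

(** The set is the projection of a closed set of types of pairs (b, b'), which
    is compact. *)
Lemma fuzzy_closed d e k (p : types T k) : 0 <= d -> closed [set q | fuzzy d e p q].
Proof.
move=> d0.
pose dphi (i : 'I_k) : formula L (k + k) :=
  FDist (Var L (lshift k i)) (Var L (@rshift k k i)).
pose C : set (types T (k + k)) := [set r | pp d k (p, restr (@rshift k k) r) /\
  forall i, sval r (dphi i) <= e].
have -> : [set q | fuzzy d e p q] = restr (lshift k) @` C.
  apply/seteqP; split=> q.
    move=> [b [b' [-> h1 h2]]].
    have E1 : (copair b b' \o @fintype.split k k) \o lshift k = b.
      by apply/funext => i /=; rewrite -[lshift k i]/(unsplit (inl i)) unsplitK.
    have E2 : (copair b b' \o @fintype.split k k) \o @rshift k k = b'.
      by apply/funext => i /=; rewrite -[@rshift k k i]/(unsplit (inr i)) unsplitK.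
    exists (tp (copair b b' \o @fintype.split k k)); last by rewrite restr_tp E1.
    split=> [|i]; first by rewrite restr_tp E2.
    have := h2 i; have <- := congr1 (fun f => f i) E1; have <- := congr1 (fun f => f i) E2.
    exact.
  move=> [r [h1 h2] <-].
  have [c rc] := type_realized HL HT satU r; subst r.
  exists (c \o lshift k), (c \o @rshift k k); split.
  - by rewrite restr_tp.
  - by rewrite -restr_tp.
  - by move=> i; exact: (h2 i).
apply: compact_closed; first exact: type_hausdorff.
apply: continuous_compact.
  by apply: continuous_subspaceT; exact: restr_continuous.
apply: closed_compact_types.
have -> : C = (restr (@rshift k k) @^-1` [set q | pp d k (p, q)]) `&`
   \bigcap_i ((fun r => sval r (dphi i)) @^-1` [set x | x <= e]).
  by apply/seteqP; split=> r [h1 h2]; split=> // i; [move=> _|]; exact: h2.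
apply: closedI.
  by apply: closed_pre; [exact: restr_continuous|exact: pp_section_closed].
apply: closed_bigI => i _; apply: closed_pre; last exact: closed_le.
exact: type_eval_continuous.
Qed.

End Perturbations.

(** * One step of the back-and-forth *)

Section BackForth.
Variables (R : realType) (L : language R) (T : theory L).
Hypotheses (HL : countable_language L) (HT : complete_theory T).
Variables (U : model T) (satU : saturated U).
(* So that the arity stays an explicit argument of pp. *)
Unset Implicit Arguments.
Variables (pp : R -> type_rel T) (Hpp : pert_system pp).
Set Implicit Arguments.

Local Notation fuzzy := (fuzzy U pp).

Lemma tcatE (A : Type) n m (b : 'I_n -> A) (c : 'I_m -> A) :
  tcat b c = copair b c \o @fintype.split n m.
Proof. by []. Qed.

Lemma tcat_l (A : Type) n m (b : 'I_n -> A) (c : 'I_m -> A) :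
  tcat b c \o @lshift n m = b.
Proof. by apply/funext => i; rewrite tcatE /= -[lshift m i]/(unsplit (inl i)) unsplitK. Qed.

Lemma tcat_r (A : Type) n m (b : 'I_n -> A) (c : 'I_m -> A) :
  tcat b c \o @rshift n m = c.
Proof. by apply/funext => i;
  rewrite tcatE /= -[@rshift n m i]/(unsplit (inr i)) unsplitK. Qed.

Lemma tcat_split (A : Type) n m (e : 'I_(n + m) -> A) :
  tcat (e \o @lshift n m) (e \o @rshift n m) = e.
Proof.
apply/funext => i; rewrite tcatE /= -[in RHS](splitK i).
by case: (fintype.split i).
Qed.

(** Together with fuzzy_fuzzy_types this replaces the various extensions in the
    definition of fuzzy_types by U: the type of all the tuples involved in such
    an extension is realised in U. *)
Lemma fuzzy_types_fuzzy n m (M : model T) (a : 'I_m -> M) (p q : types_over a n)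
  (e : R) : 0 <= e ->
  fuzzy_types (pp e) e p q -> fuzzy e e (forget p) (forget q).
Proof.
move=> e0 [N [c [b [ca qbc [N' [h [b' [c' [hh hb hc [p' pE hpq]]]]]]]]]].
have {pE} pE : p' = forget p := pE; subst p'.
pose x := tcat (h \o tcat b c) (tcat b' c').
have [y xy] := type_realized HL HT satU (tp x).
exists (y \o @lshift _ _), (y \o @rshift _ _); split.
- rewrite -restr_tp -xy restr_tp tcat_l; apply: val_inj; rewrite /= qbc.
  by apply/funext => phi; rewrite /tpfun hh.
- by rewrite -restr_tp -xy restr_tp tcat_r.
- move=> i /=; rewrite -(tp_dist (@lshift _ _ i) (@rshift _ _ i) xy).
  rewrite (_ : x (lshift _ i) = h (tcat b c i));
    last by rewrite -[LHS]/((x \o @lshift _ _) i) tcat_l.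
  rewrite (_ : x (rshift _ i) = tcat b' c' i);
    last by rewrite -[LHS]/((x \o @rshift _ _) i) tcat_r.
  rewrite /tcat; case: (fintype.split i) => j.
    by have /(tdist_le _ _ e0) := hb; apply.
  by have /(tdist_le _ _ e0) := hc; apply.
Qed.

Lemma fuzzy_fuzzy_types n m (M : model T) (a : 'I_m -> M) (p q : types_over a n)
  (e : R) : 0 <= e ->
  fuzzy e e (forget p) (forget q) -> fuzzy_types (pp e) e p q.
Proof.
move=> e0 h; have [y qy] := type_realized HL HT satU (forget q).
rewrite qy in h; have [y' [h1 h2]] := fuzzy_over HL satU h.
have [N [c [b [ca qbc]]]] := set_mem (svalP q).
have qbc' : tp (tcat b c) = tp y by rewrite -qy; apply: val_inj; rewrite /= -qbc.
exists U, (y \o @rshift _ _), (y \o @lshift _ _); split.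
- by rewrite -restr_tp -qbc' restr_tp tcat_r.
- by rewrite tcat_split -[sval q]/(sval (forget q)) qy.
exists U, id, (y' \o @lshift _ _), (y' \o @rshift _ _); split=> //.
- by apply/tdist_le => // i; exact: h2.
- by apply/tdist_le => // i; exact: h2.
- by exists (forget p) => //; rewrite tcat_split.
Qed.

Lemma types_over_realized n m (M : model T) (a : 'I_m -> M) p :
  types_over_set a n p -> exists (N : structure L) (b : 'I_(n + m) -> N), p = tpfun b.
Proof. by move=> [N [c [b [_ ->]]]]; exists N, (tcat b c). Qed.

Definition tp_init (M : model T) k (c : nat -> M) : types T k := tp (fun i : 'I_k => c i).

(** Tuples of growing length are treated as initial segments of sequences, so
    that adding an element needs no reindexing; x is the value from k on. *)
Definition ext_ord (A : Type) k (f : 'I_k -> A) (x : A) : nat -> A :=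
  fun i => oapp f x (insub i).

Lemma ext_ordE (A : Type) k (f : 'I_k -> A) x : (fun i : 'I_k => ext_ord f x i) = f.
Proof. by apply/funext => i; rewrite /ext_ord valK. Qed.

Lemma ext_ord_max (A : Type) k (f : 'I_k -> A) x : ext_ord f x k = x.
Proof. by rewrite /ext_ord insubF // ltnn. Qed.

Lemma seq_trcons (A : Type) k (c : nat -> A) :
  trcons (fun i : 'I_k => c i) (c k) = (fun i : 'I_k.+1 => c i).
Proof.
apply/funext => i; case: (unliftP ord_max i) => [j|] ->; last by rewrite trcons_max.
by rewrite trconsK /= /bump leqNgt ltn_ord.
Qed.

Lemma ext_ord_trcons (A : Type) k (f : 'I_k -> A) x :
  (fun i : 'I_k.+1 => ext_ord f x i) = trcons f x.
Proof. by rewrite -seq_trcons ext_ordE ext_ord_max. Qed.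

(** For d = 0, where perturbed types are equal, this realises the type of x
    over v. *)
Lemma extend_one d n (M : model T) (v : 'I_n -> M) (x : M) (w : 'I_n -> U) :
  0 <= d -> pp d n (tp v, tp w) ->
  exists y : U, pp d n.+1 (tp (trcons v x), tp (trcons w y)).
Proof.
move=> d0 /(extend_tuple HL HT satU Hpp (fun _ : 'I_1 => x) d0)[z hz].
have E (A : Type) (f : 'I_n -> A) (g : 'I_1 -> A) :
    copair f g \o trcons inl (inr ord0) = trcons f (g ord0).
  by apply/funext => i /=; case: (unliftP ord_max i) => [j|] ->;
    rewrite ?trconsK ?trcons_max.
by exists (z ord0); have := hz _ (trcons inl (inr ord0)); rewrite !E.
Qed.

Hypothesis H1 : fuzzy_types_nonempty_interior pp 1.

Definition swap_split n m (i : 'I_(n + m)) : 'I_m + 'I_n :=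
  match fintype.split i with inl j => inr j | inr j => inl j end.

Lemma swap_splitE (A : Type) n m (f : 'I_n -> A) (g : 'I_m -> A) :
  copair g f \o @swap_split n m = tcat f g.
Proof.
by apply/funext => i; rewrite /swap_split /= tcatE /=; case: (fintype.split i).
Qed.

(** The set of types attached to tp(c_k, c_0 ... c_(k-1)) over b has an interior
    point. Hence it contains all types over b with psi > 0 for some formula psi
    that is positive somewhere, and psi is then positive at an element of M. *)
Lemma one_point (M : model T) k (c : nat -> U) (b : nat -> M) (e : R) : 0 < e ->
  tp_init k c = tp_init k b -> exists b2 : nat -> M, (forall i, (i < k)%N -> b2 i = b i) /\
    fuzzy e e (tp_init k.+1 c) (tp_init k.+1 b2).
Proof.
move=> e0 cb.
pose a := fun i : 'I_k => b i.
pose ch := fun i : 'I_k => c i.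
pose xh := fun _ : 'I_1 => c k.
have pin : tpfun (tcat xh ch) \in types_over_set a 1.
  by apply/mem_set; exists U, ch, xh.
pose p : types_over a 1 :=
  exist (fun x : fvalues L (1 + k) => x \in types_over_set a 1) _ pin.
have [q0 nq0] := H1 p e0.
have [psi [h1 h2]] := type_basis (@types_over_realized 1 k M a) nq0.
have [N [c0 [b0 [ca qbc]]]] := set_mem (svalP q0).
have hv : 0 < eval psi (copair c0 b0 \o @swap_split 1 k).
  by move: h1; rewrite qbc swap_splitE.
have [x hx] := transfer (proj1 (tp_eq c0 a) ca) hv.
rewrite swap_splitE in hx.
have qin : tpfun (tcat x a) \in types_over_set a 1.
  by apply/mem_set; exists M, a, x.
pose q : types_over a 1 :=
  exist (fun x : fvalues L (1 + k) => x \in types_over_set a 1) _ qin.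
have fq : fuzzy e e (forget p) (forget q) by apply: fuzzy_types_fuzzy;
  [exact: ltW|exact: h2].
exists (ext_ord a (x ord0)); split.
  move=> i ik; have := congr1 (fun f => f (Ordinal ik)) (ext_ordE a (x ord0)).
  by [].
pose r : 'I_k.+1 -> 'I_(1 + k) := trcons (@rshift 1 k) (@lshift 1 k ord0).
have E2 (A : Type) (f : 'I_1 -> A) (g : 'I_k -> A) : tcat f g \o r = trcons g (f ord0).
  apply/funext => i; rewrite /r /=; case: (unliftP ord_max i) => [j|] ->.
    by rewrite !trconsK -[in RHS](tcat_r f g).
  by rewrite !trcons_max -[in RHS](tcat_l f g).
have := fuzzy_restr Hpp r (ltW e0) fq.
rewrite (_ : restr r (forget p) = tp_init k.+1 c); last first.
  rewrite (_ : forget p = tp (tcat xh ch)); last exact: val_inj.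
  by rewrite restr_tp E2 seq_trcons.
rewrite (_ : restr r (forget q) = tp (trcons a (x ord0))); last first.
  rewrite (_ : forget q = tp (tcat x a)); last exact: val_inj.
  by rewrite restr_tp E2.
by rewrite /tp_init ext_ord_trcons.
Qed.

(** Instead of c_k itself, the element y that corresponds to c_k in the
    perturbed tuple is realised over b, where the exact type of b is available.
    The errors then compose. *)
Lemma one_step (M : model T) k (c : nat -> U) (b : nat -> M) (d eta e : R) :
  0 <= d -> 0 <= eta -> 0 < e -> fuzzy d eta (tp_init k c) (tp_init k b) ->
  exists b2 : nat -> M, (forall i, (i < k)%N -> b2 i = b i) /\
    fuzzy (d + e) (eta + e) (tp_init k.+1 c) (tp_init k.+1 b2).
Proof.
move=> d0 eta0 e0 [b1 [b1' [bb1 h1 h2]]].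
have [y hy] := extend_one (c k) d0 h1.
have e20 : 0 < e / 2 by rewrite divr_gt0.
have [m m0 hm] := exists_modulus HL HT satU Hpp e20.
(* The error e' is used once for the perturbation, and in the distance
   together with its modulus e / 2. *)
pose e' := Num.min m (e / 2).
have e'0 : 0 < e' by rewrite lt_min m0.
have e'm : e' <= m by rewrite ge_min lexx.
have e'e : e' <= e / 2 by rewrite ge_min lexx orbT.
have hm' : dist_modulus pp e' (e / 2).
  by move=> p q pq; apply: hm; exact: (pp_le Hpp (ltW e'0) e'm).
pose b1s := ext_ord b1 y.
have bb : tp_init k b1s = tp_init k b by rewrite /tp_init ext_ordE -bb1.
have [b2 [b2b hb2]] := one_point e'0 bb.
exists b2; split=> //.
have f1 : fuzzy d eta (tp_init k.+1 c) (tp_init k.+1 b1s).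
  exists (trcons b1 y), (trcons b1' y); split.
  - by rewrite /tp_init ext_ord_trcons.
  - by rewrite /tp_init -seq_trcons.
  - move=> i; case: (unliftP ord_max i) => [j|] ->; first by rewrite !trconsK.
    by rewrite !trcons_max mdistxx.
apply: (fuzzy_le Hpp _ _ _ (fuzzy_comp HL HT satU Hpp d0 (ltW e'0) hm' f1 hb2)).
- by rewrite addr_ge0// ltW.
- lra.
- lra.
Qed.

Lemma many_steps (M : model T) k (c : nat -> U) (b : nat -> M) (d eta e : R) s :
  0 <= d -> 0 <= eta -> 0 < e -> fuzzy d eta (tp_init k c) (tp_init k b) ->
  exists b2 : nat -> M, (forall i, (i < k)%N -> b2 i = b i) /\
    fuzzy (d + e) (eta + e) (tp_init (s + k) c) (tp_init (s + k) b2).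
Proof.
move=> d0 eta0; elim: s e => [|s IH] e e0 h.
  exists b; split=> //; apply: (fuzzy_le Hpp _ _ _ h) => //; lra.
have e20 : 0 < e / 2 by rewrite divr_gt0.
have [b1 [bb1 h1]] := IH _ e20 h.
have [||b2 [bb2 h2]] := one_step _ _ e20 h1; [lra|lra|].
exists b2; split; first by move=> i ik; rewrite bb2 ?bb1// ltn_addl.
by rewrite -!addrA -!splitr in h2.
Qed.

(** The first k elements of a and b are perturbations by d of each other, up to
    an error eta in distance on the side of a and eta' on the side of b. The
    two errors are kept apart because each step of the back-and-forth makes only
    one of them small. *)
Definition fuzzy2 (M N : model T) k (d eta eta' : R) (a : nat -> M) (b : nat -> N) :=
  exists a1 a' b' b1 : 'I_k -> U,
  [/\ tp a1 = tp_init k a, tp b1 = tp_init k b, pp d k (tp a', tp b'),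
      forall i, mdist (a1 i) (a' i) <= eta & forall i, mdist (b1 i) (b' i) <= eta'].

Lemma fuzzy2_sym (M N : model T) k d eta eta' (a : nat -> M) (b : nat -> N) : 0 <= d ->
  fuzzy2 k d eta eta' a b -> fuzzy2 k d eta' eta b a.
Proof.
move=> d0 [a1 [a' [b' [b1 [h1 h2 h3 h4 h5]]]]]; exists b1, b', a', a1; split=> //.
exact: pp_sym.
Qed.

Definition update (A : Type) (a : nat -> A) k (x : A) : nat -> A :=
  fun i => if (i == k)%N then x else a i.

Lemma update_trcons (A : Type) (a : nat -> A) k (x : A) :
  (fun i : 'I_k.+1 => update a k x i) = trcons (fun i : 'I_k => a i) x.
Proof.
rewrite -seq_trcons /update eqxx; congr trcons; apply/funext => i.
by rewrite ltn_eqF.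
Qed.

(** Besides the new element, the elements b_0 ... b_(k-1) are replaced: the
    perturbed tuple b' in U is at distance eta' from b, so its approximate
    realisation over b in N is close to b, and the error on this side becomes
    arbitrarily small. *)
Lemma forth (M N : model T) k (d eta eta' e : R) (a : nat -> M) (b : nat -> N) (x : M) :
  0 <= d -> 0 <= eta -> 0 < e -> fuzzy2 k d eta eta' a b ->
  exists b2 : nat -> N, fuzzy2 k.+1 (d + e) eta e (update a k x) b2 /\
    forall i, (i < k)%N -> mdist (b2 i) (b i) <= eta' + e.
Proof.
move=> d0 eta0 e0 [a1 [a' [b' [b1 [ha hb hab ha1 hb1]]]]].
have [xh hx] : exists y : U, tp (trcons (fun i : 'I_k => a i) x) = tp (trcons a1 y).
  have hv : pp 0 k (tp (fun i : 'I_k => a i), tp a1) by apply/(pp0 Hpp).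
  by have [y /(pp0 Hpp) hy] := extend_one x (lexx 0) hv; exists y.
have [y hy] := extend_one xh d0 hab.
have e20 : 0 < e / 2 by rewrite divr_gt0.
have [m m0 hm] := exists_modulus HL HT satU Hpp e20.
pose e' := Num.min m (e / 4).
have e'0 : 0 < e' by rewrite lt_min m0 divr_gt0.
have e'm : e' <= m by rewrite ge_min lexx.
have e'e : e' <= e / 4 by rewrite ge_min lexx orbT.
have hm' : dist_modulus pp e' (e / 2).
  by move=> p q pq; apply: hm; exact: (pp_le Hpp (ltW e'0) e'm).
(* The tuple b1, a copy of b, followed by the perturbed tuple b' and y:
   realising it over b gives the new tuple together with its distances to b. *)
pose c i := if (i < k)%N then ext_ord b1 y i else ext_ord (trcons b' y) y (i - k)%N.
have ck : (fun i : 'I_k => c i) = b1.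
  by rewrite -[RHS](ext_ordE b1 y); apply/funext => i; rewrite /c ltn_ord.
have ck' : (fun i : 'I_k.+1 => c (k + i)%N) = trcons b' y.
  rewrite -[RHS](ext_ordE (trcons b' y) y); apply/funext => i.
  by rewrite /c ltnNge leq_addr /= addKn.
have f0 : fuzzy 0 0 (tp_init k c) (tp_init k b).
  by apply: (pp_fuzzy HL HT satU); apply/(pp0 Hpp); rewrite /tp_init ck.
have [b2f [b2b hb2]] := many_steps k.+1 (lexx 0) (lexx 0) e'0 f0.
rewrite !add0r in hb2; have [bt [bt' [hbt hct hd]]] := hb2.
have rP (i : 'I_k.+1) : (k + i < k.+1 + k)%N by rewrite addnC ltn_add2r.
have rP' (i : 'I_k) : (i < k.+1 + k)%N by rewrite ltn_addl.
pose r i := Ordinal (rP i); pose r' i := Ordinal (rP' i).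
exists (fun i => b2f (k + i)%N); split.
  exists (trcons a1 xh), (trcons a' xh), (bt' \o r), (bt \o r); split.
  - by rewrite -hx /tp_init update_trcons.
  - by rewrite -restr_tp -hbt /tp_init restr_tp.
  - apply: (pp_le Hpp _ _ (pp_trans Hpp d0 (ltW e'0) hy _)).
    + by rewrite addr_ge0// ltW.
    + lra.
    + have := pp_restr Hpp r (ltW e'0) hct; rewrite /tp_init !restr_tp.
      by rewrite (_ : _ \o r = trcons b' y).
  - move=> i; case: (unliftP ord_max i) => [j|] ->; first by rewrite !trconsK.
    by rewrite !trcons_max mdistxx.
  - move=> i; apply: le_trans (hd _) _; lra.
move=> i ik; rewrite -b2b//.
have -> : mdist (b2f (k + i)%N) (b2f i) = mdist (bt (r (inord i))) (bt (r' (Ordinal ik))).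
  by rewrite -(tp_dist _ _ hbt) /= inordK// ltnS ltnW.
have h1 := hd (r (inord i)); have h2 := hd (r' (Ordinal ik)).
have h3 := dist_modulusP Hpp (r (inord i)) (r' (Ordinal ik)) (ltW e'0) hm' hct.
have h4 : mdist (c (r (inord i))) (c (r' (Ordinal ik))) <= eta'.
  have := hb1 (Ordinal ik); rewrite metric_sym -ck -[b' _]/(b' (Ordinal ik)).
  have -> : b' (Ordinal ik) = c (k + i)%N.
    have := congr1 (fun f => f (lift ord_max (Ordinal ik))) ck'.
    by rewrite trconsK /= /bump leqNgt ik => ->.
  by rewrite /= inordK// ltnS ltnW.
have h5 := metric_triangle (bt (r (inord i))) (bt' (r (inord i))) (bt (r' (Ordinal ik))).
have h6 := metric_triangle (bt' (r (inord i))) (bt' (r' (Ordinal ik)))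
  (bt (r' (Ordinal ik))).
have h7 := metric_sym (bt' (r' (Ordinal ik))) (bt (r' (Ordinal ik))).
move: h3 h4; rewrite /=; lra.
Qed.

Lemma back_and_forth_step (M N : model T) k (d eta e : R) (a : nat -> M) (b : nat -> N)
  (x : M) (y : N) : 0 <= d -> 0 <= eta -> 0 < e -> fuzzy2 k d eta eta a b ->
  exists (a2 : nat -> M) (b2 : nat -> N), [/\ fuzzy2 k.+2 (d + 2 * e) e e a2 b2,
    (forall i, (i < k)%N -> mdist (a2 i) (a i) <= eta + e),
    (forall i, (i < k)%N -> mdist (b2 i) (b i) <= eta + e),
    mdist (a2 k) x <= eta + e & b2 k.+1 = y].
Proof.
move=> d0 eta0 e0 h.
have [b1 [h1 hb1]] := forth x d0 eta0 e0 h.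
have de0 : 0 <= d + e by rewrite addr_ge0// ltW.
have [a2 [h2 ha2]] := forth y de0 (ltW e0) e0 (fuzzy2_sym de0 h1).
exists a2, (update b1 k.+1 y); split.
- have -> : d + 2 * e = d + e + e by lra.
  by apply: fuzzy2_sym h2; rewrite addr_ge0// ltW.
- by move=> i ik; have := ha2 i (ltnW ik); rewrite /update ltn_eqF.
- by move=> i ik; have := hb1 i ik; rewrite /update ltn_eqF// ltnW// ltnS.
- by have := ha2 k (ltnSn k); rewrite /update eqxx.
- by rewrite /update eqxx.
Qed.

End BackForth.

(** * The limit of the back-and-forth *)

Section Graph.
Variables (R : realType).

Definition dense_seq (M : metricType R) (u : nat -> M) :=
  forall x (e : R), 0 < e -> exists i, mdist (u i) x <= e.

Definition graph_closure (M N : metricType R) (al : nat -> M) (be : nat -> N) x y :=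
  forall e : R, 0 < e -> exists i, mdist (al i) x <= e /\ mdist (be i) y <= e.

Lemma graph_closure_sym (M N : metricType R) (al : nat -> M) (be : nat -> N) x y :
  graph_closure al be x y -> graph_closure be al y x.
Proof. by move=> h e e0; have [i [h1 h2]] := h e e0; exists i. Qed.

Definition unif_cont_seq (M N : metricType R) (al : nat -> M) (be : nat -> N) :=
  forall eta : R, 0 < eta -> exists2 xi : R, 0 < xi &
    forall i j, mdist (al i) (al j) <= xi -> mdist (be i) (be j) <= eta.

(** The y is the limit of the filter generated by the be i for which al i is
    close to x; uniform continuity makes it Cauchy. *)
Lemma graph_total (M N : metricType R) (al : nat -> M) (be : nat -> N) :
  (forall F : set_system N, ProperFilter F -> cauchy F -> exists x : N, F --> x) ->
  unif_cont_seq al be -> dense_seq al -> forall x, exists y, graph_closure al be x y.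
Proof.
move=> cN uc da x.
pose F := filter_from [set e : R | 0 < e]
  (fun e => [set y | exists2 i, mdist (al i) x <= e & y = be i]).
have PF : ProperFilter F.
  apply: filter_from_proper; last first.
    by move=> e /= e0; have [i hi] := da x e e0; exists (be i), i.
  apply: filter_from_filter; first by exists 1; rewrite /= ltr01.
  move=> e e' /= e0 e'0; exists (Num.min e e'); first by rewrite /= lt_min e0.
  by move=> y [i]; rewrite le_min => /andP[h1 h2] ->; split; exists i.
have [y Fy] : exists y : N, F --> y.
  apply: cN; apply/cauchyP => eta eta0.
  have eta20 : 0 < eta / 2 by rewrite divr_gt0.
  have [xi xi0 hxi] := uc _ eta20.
  have xi20 : 0 < xi / 2 by rewrite divr_gt0.
  have [i0 hi0] := da x _ xi20.
  exists (be i0); exists (xi / 2) => // y [i hi ->]; rewrite ballEmdist /=.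
  apply: (@le_lt_trans _ _ (eta / 2)); last by lra.
  apply: hxi; apply: le_trans (metric_triangle _ x _) _.
  by rewrite (metric_sym x); lra.
exists y => e e0; have [e' /= e'0 he'] := Fy _ (nbhsx_ballx y _ e0).
have m0 : 0 < Num.min e e' by rewrite lt_min e0.
have [i hi] := da x _ m0; exists i; split.
  by apply: le_trans hi _; rewrite ge_min lexx.
have : ball y e (be i).
  by apply: he'; exists i => //; apply: le_trans hi _; rewrite ge_min lexx orbT.
by rewrite ballEmdist /= metric_sym => /ltW.
Qed.

Lemma graph_functional (M N : metricType R) (al : nat -> M) (be : nat -> N) x y y' :
  unif_cont_seq al be -> graph_closure al be x y -> graph_closure al be x y' -> y = y'.
Proof.
move=> uc h h'; apply: (@mdist_positivity _ N); apply/eqP.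
rewrite eq_le mdist_ge0 andbT; apply/ler_addgt0Pl => e e0; rewrite addr0.
have e30 : 0 < e / 3 by rewrite divr_gt0.
have [xi xi0 hxi] := uc _ e30.
have m0 : 0 < Num.min (xi / 2) (e / 3) by rewrite lt_min e30 divr_gt0.
have [i [hi1 hi2]] := h _ m0; have [j [hj1 hj2]] := h' _ m0.
move: hi1 hi2 hj1 hj2; rewrite !le_min => /andP[a1 _] /andP[_ a2] /andP[a3 _] /andP[_ a4].
have : mdist (be i) (be j) <= e / 3.
  apply: hxi; apply: le_trans (metric_triangle _ x _) _.
  by rewrite (metric_sym x); lra.
have := metric_triangle y (be i) y'; have := metric_triangle (be i) (be j) y'.
have := metric_sym y (be i); lra.
Qed.

Lemma separable_dense_seq (M : metricType R) : inhabited M -> density_aleph0 M ->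
  exists u : nat -> M, dense_seq u.
Proof.
move=> [x0] [[D /countable_injP[f fI] dD] _].
exists (fun j => xget x0 [set y | D y /\ f y = j]) => x e e0.
have [y [Dy xy]] : (D `&` ball x e) !=set0.
  rewrite setIC; have := dD (interior (ball x e)) _ (@open_interior _ _).
  move=> /(_ _)/wrap[|[y [/interior_subset h1 h2]]]; last by exists y.
  by exists x; exact: nbhsx_ballx.
exists (f y); case: xgetP => [z _ [Dz fz]|/(_ y)]; last by case.
rewrite (fI z y) ?inE//.
by move: xy; rewrite ballEmdist /= metric_sym => /ltW.
Qed.

(** The exponent of 2 in s + 1: each integer is taken infinitely often, so that
    each element of a dense sequence is treated at arbitrarily late stages,
    where it is no longer moved much. *)
Definition repeated (s : nat) : nat := logn 2 s.+1.

Lemma repeatedP j s0 : exists s, (s0 <= s)%N /\ repeated s = j.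
Proof.
exists (2 ^ j * (2 * s0).+1).-1%N.
have p0 : (0 < 2 ^ j * (2 * s0).+1)%N by rewrite muln_gt0 expn_gt0.
split; last first.
  rewrite /repeated prednK// lognM// ?expn_gt0// pfactorK// logn_coprime ?addn0//.
  by rewrite coprime2n /= oddM.
rewrite -ltnS prednK//.
have : (1 <= 2 ^ j)%N by rewrite expn_gt0.
nia.
Qed.

End Graph.

Section Isomorphism.
Variables (R : realType) (L : language R) (T : theory L).
Hypotheses (HL : countable_language L) (HT : complete_theory T).
Variables (U : model T) (satU : saturated U).
(* So that the arity stays an explicit argument of pp. *)
Unset Implicit Arguments.
Variables (pp : R -> type_rel T) (Hpp : pert_system pp).
Set Implicit Arguments.

(** Closedness of pp d. An approximation passes from a to a1 in M, then to a
    copy a2 of a1 in U, and then to a nearby a3 in U: formulas change little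
    along this path by uniform continuity. *)
Lemma pp_limit (M N : model T) d k (a : 'I_k -> M) (b : 'I_k -> N) : 0 <= d ->
  (forall e : R, 0 < e -> exists (a1 : 'I_k -> M) (b1 : 'I_k -> N)
    (a2 a3 b2 b3 : 'I_k -> U),
    [/\ forall i, mdist (a i) (a1 i) <= e, forall i, mdist (b i) (b1 i) <= e,
        tp a2 = tp a1, tp b2 = tp b1 &
        [/\ forall i, mdist (a2 i) (a3 i) <= e, forall i, mdist (b2 i) (b3 i) <= e &
         pp d k (tp a3, tp b3)]]) -> pp d k (tp a, tp b).
Proof.
move=> d0 h; apply: (pp_closed Hpp (n := k) d0) => S [[V W] /= [nV nW] sS].
have [psi [p1 p2]] := type_basis (@types_realized _ _ _ k) nV.
have [chi [c1 c2]] := type_basis (@types_realized _ _ _ k) nW.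
have p30 : 0 < eval psi a / 3 by rewrite divr_gt0.
have c30 : 0 < eval chi b / 3 by rewrite divr_gt0.
have [e1 [e10 he1]] := eval_unif psi p30.
have [e2 [e20 he2]] := eval_unif chi c30.
have m0 : 0 < Num.min e1 e2 by rewrite lt_min e10.
have [a1 [b1 [a2 [a3 [b2 [b3 [h1 h2 h3 h4 [h5 h6 h7]]]]]]]] := h _ m0.
have l1 : Num.min e1 e2 <= e1 by rewrite ge_min lexx.
have l2 : Num.min e1 e2 <= e2 by rewrite ge_min lexx orbT.
exists (tp a3, tp b3); split=> //; apply: sS; split=> /=.
  apply: p2; change (0 < eval psi a3).
  have e12 : eval psi a2 = eval psi a1 := congr1 (fun p : types T k => sval p psi) h3.
  have := he1 M a a1 (fun i => le_trans (h1 i) l1).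
  have := he1 U a2 a3 (fun i => le_trans (h5 i) l1).
  rewrite !ler_norml e12 => /andP[? ?] /andP[? ?].
  have {}p1 : 0 < eval psi a by exact: p1.
  lra.
apply: c2; change (0 < eval chi b3).
have e12 : eval chi b2 = eval chi b1 := congr1 (fun p : types T k => sval p chi) h4.
have := he2 N b b1 (fun i => le_trans (h2 i) l2).
have := he2 U b2 b3 (fun i => le_trans (h6 i) l2).
rewrite !ler_norml e12 => /andP[? ?] /andP[? ?].
have {}c1 : 0 < eval chi b by exact: c1.
lra.
Qed.

Lemma pp_tuple (M N : model T) d (al : nat -> M) (be : nat -> N) n (io : 'I_n -> nat) :
  0 <= d -> (forall k, pp d k (tp_init k al, tp_init k be)) ->
    pp d n (tp (al \o io), tp (be \o io)).
Proof.
move=> d0 h.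
have hi i : (io i < (\max_i io i).+1)%N by rewrite ltnS; exact: leq_bigmax.
have := pp_restr Hpp (fun i => Ordinal (hi i)) d0 (h (\max_i io i).+1).
by rewrite /tp_init !restr_tp.
Qed.

Lemma pp_unif_cont (M N : model T) d (al : nat -> M) (be : nat -> N) : 0 <= d ->
  (forall k, pp d k (tp_init k al, tp_init k be)) -> unif_cont_seq al be.
Proof.
move=> d0 h eta eta0; have [xi xi0 hxi] := exists_small_modulus HL HT satU Hpp d0 eta0.
exists xi => // i j hij.
have := hxi _ _ (pp_tuple (pair2 i j) d0 h).
by apply.
Qed.

(** The closure of the correspondence al i <-> be i is the graph of a bijection:
    by exists_small_modulus it is uniformly continuous in both directions. The
    bijection is a perturbation by pp_limit. *)
Lemma bipert_of_dense (M N : model T) d (al : nat -> M) (be : nat -> N) : 0 <= d ->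
  (forall k, pp d k (tp_init k al, tp_init k be)) -> dense_seq al -> dense_seq be ->
  BiPert (pp d) M N !=set0.
Proof.
move=> d0 h da db.
have h' k : pp d k (tp_init k be, tp_init k al) by apply: (pp_sym Hpp).
have u1 := pp_unif_cont d0 h; have u2 := pp_unif_cont d0 h'.
have [f fP] := choice (graph_total (@carrier_complete _ _ N) u1 da).
have [g gP] := choice (graph_total (@carrier_complete _ _ M) u2 db).
have pert (M' N' : model T) (al' : nat -> M') (be' : nat -> N') (f' : M' -> N') :
    (forall k, pp d k (tp_init k al', tp_init k be')) ->
    (forall x, graph_closure al' be' x (f' x)) -> Pert (pp d) f'.
  move=> hab fP' n a; exists (tp a) => //; apply: pp_limit => // e e0.
  have [io ioP] := choice (fun i => fP' (a i) e e0).
  have [a2 ha2] := type_realized HL HT satU (tp (al' \o io)).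
  have [b2 hb2] := type_realized HL HT satU (tp (be' \o io)).
  exists (al' \o io), (be' \o io), a2, a2, b2, b2; split=> //.
  - by move=> i; rewrite metric_sym; exact: (ioP i).1.
  - by move=> i; rewrite metric_sym; exact: (ioP i).2.
  - split; [by move=> i; rewrite mdistxx ltW..|].
    by rewrite -ha2 -hb2; exact: pp_tuple.
exists f; split; first exact: pert fP.
exists g; split; last exact: pert gP.
- move=> x; apply: (graph_functional u2 (gP (f x))); exact/graph_closure_sym/fP.
- move=> y; apply: (graph_functional u1 (fP (g y))); exact/graph_closure_sym/gP.
Qed.

Hypothesis H1 : fuzzy_types_nonempty_interior pp 1.

(** At stage s the errors in distance are e0 / 2^s and the perturbation is
    2 e0 (1 - 1 / 2^s). The element of index 2 s is taken from u and that of
    index 2 s + 1 from w; later moves sum to at most a multiple of e0 / 2^s. *)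
Lemma back_and_forth (M N : model T) (e0 : R) (u : nat -> M) (w : nat -> N) : 0 < e0 ->
  exists (al : nat -> M) (be : nat -> N),
    [/\ forall k, pp (2 * e0) k (tp_init k al, tp_init k be),
        forall s, mdist (al s.*2) (u s) <= 8 * e0 * half_pow R s &
        forall s, mdist (be s.*2.+1) (w s) <= 8 * e0 * half_pow R s].
Proof.
move=> e00.
pose ep s := e0 * half_pow R s; pose de s := 2 * e0 * (1 - half_pow R s).
have ep0 s : 0 < ep s by rewrite mulr_gt0 // half_pow_gt0.
have hp1 s : half_pow R s <= 1 by have := half_pow_le R (leq0n s); rewrite /half_pow expr0.
have de0 s : 0 <= de s by rewrite /de !mulr_ge0 ?subr_ge0 ?hp1// ltW.
have deS s : de s.+1 = de s + 2 * ep s.+1 by rewrite /de /ep (half_powS R s); lra.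
pose P s (st : (nat -> M) * (nat -> N)) := fuzzy2 U pp s.*2 (de s) (ep s) (ep s) st.1 st.2.
pose Q s (st st' : (nat -> M) * (nat -> N)) :=
  [/\ (forall i, (i < s.*2)%N -> mdist (st'.1 i) (st.1 i) <= ep s + ep s.+1),
    (forall i, (i < s.*2)%N -> mdist (st'.2 i) (st.2 i) <= ep s + ep s.+1),
    mdist (st'.1 s.*2) (u s) <= ep s + ep s.+1 & st'.2 s.*2.+1 = w s].
have step (x : nat * ((nat -> M) * (nat -> N))) : exists st',
    P x.1 x.2 -> P x.1.+1 st' /\ Q x.1 x.2 st'.
  case: x => s st /=; have [Pst|nP] := pselect (P s st); last by exists st.
  have [a2 [b2 [h1 h2 h3 h4 h5]]] := back_and_forth_step HL HT satU Hpp H1 (u s) (w s)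
     (de0 s) (ltW (ep0 s)) (ep0 s.+1) Pst.
  by exists (a2, b2) => _; split=> //; rewrite /P /= deS doubleS.
have [F FP] := choice step.
pose st := fix st s := if s is s'.+1 then F (s', st s') else (u, w).
have Pst s : P s (st s).
  elim: s => [|s IH]; last by have [] := FP (s, st s) IH.
  rewrite /P /=.
  have v0 : 'I_0 -> U by case.
  exists v0, v0, v0, v0; split; [..|by case|by case].
  - by apply/tp_eq; exact: tpfun0.
  - by apply/tp_eq; exact: tpfun0.
  - exact: pp_refl.
have Qst s : Q s (st s) (st s.+1) by have [] := FP (s, st s) (Pst s).
have ep2 s : ep s + ep s.+1 <= 2 * e0 * half_pow R s.
  rewrite /ep (half_powS R s); have := half_pow_gt0 R s.+1 => h.
  have := mulr_gt0 e00 h; lra.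
have lt2 i s : (i./2.+1 <= s)%N -> (i < s.*2)%N by lia.
have limM i : exists y : M, forall s, (i./2.+1 <= s)%N ->
    mdist ((st s).1 i) y <= 2 * (2 * e0) * half_pow R s.
  apply: (rapid_of_complete (@carrier_complete _ _ M)) => s hs.
  have [q _ _ _] := Qst s; rewrite metric_sym.
  exact: le_trans (q i (lt2 _ _ hs)) (ep2 s).
have limN i : exists y : N, forall s, (i./2.+1 <= s)%N ->
    mdist ((st s).2 i) y <= 2 * (2 * e0) * half_pow R s.
  apply: (rapid_of_complete (@carrier_complete _ _ N)) => s hs.
  have [_ q _ _] := Qst s; rewrite metric_sym.
  exact: le_trans (q i (lt2 _ _ hs)) (ep2 s).
have [al alP] := choice limM; have [be beP] := choice limN.
exists al, be; split.
- move=> k; apply: pp_limit => [|e e0']; first by rewrite mulr_ge0// ltW.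
  have [s1 hs1] := half_pow_small (divr_gt0 e0' (mulr_gt0 (ltr0Sn R 3) e00)).
  pose s := maxn s1 k.+1.
  have ks : (k < s)%N by rewrite /s leq_maxr.
  have hs : 4 * e0 * half_pow R s <= e.
    have := le_trans (half_pow_le R (leq_maxl s1 k.+1)) hs1.
    by rewrite ler_pdivlMr ?mulr_gt0// mulrC.
  have es : ep s <= e.
    by have := ep0 s; rewrite /ep in hs *; lra.
  have := Pst s; rewrite /P => -[a1 [a2 [b2 [b1 [h1 h2 h3 h4 h5]]]]].
  have ik (i : 'I_k) : (i < s.*2)%N by have := ltn_ord i; lia.
  pose r i := Ordinal (ik i).
  have is2 (i : 'I_k) : (i./2.+1 <= s)%N by have := ltn_ord i; lia.
  exists (fun i => (st s).1 i), (fun i => (st s).2 i), (a1 \o r), (a2 \o r), (b1 \o r),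
    (b2 \o r).
  split.
  + by move=> i; rewrite metric_sym; apply: le_trans (alP i s (is2 i)) _; lra.
  + by move=> i; rewrite metric_sym; apply: le_trans (beP i s (is2 i)) _; lra.
  + by rewrite -restr_tp h1 /tp_init restr_tp.
  + by rewrite -restr_tp h2 /tp_init restr_tp.
  + split; [by move=> i; exact: le_trans (h4 _) es|by move=> i; exact: le_trans (h5 _) es|].
    rewrite -(restr_tp r a2) -(restr_tp r b2); apply: (pp_restr Hpp);
      first by rewrite mulr_ge0// ltW.
    apply: (pp_le Hpp _ _ h3) => //.
    rewrite /de -[leRHS]mulr1; apply: ler_wpM2l; first by rewrite mulr_ge0// ltW.
    by have := half_pow_gt0 R s; lra.
- move=> s; have [_ _ q _] := Qst s.
  have h1 := alP s.*2 s.+1; rewrite doubleK in h1; have {}h1 := h1 (leqnn _).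
  have := metric_triangle (al s.*2) ((st s.+1).1 s.*2) (u s).
  rewrite (metric_sym (al _) ((st s.+1).1 _)); have := ep2 s; rewrite (half_powS R s).
  have := mulr_gt0 e00 (half_pow_gt0 R s.+1); lra.
- move=> s; have [_ _ _ q] := Qst s.
  have h1 := beP s.*2.+1 s.+1; rewrite -[s.*2.+1]/((true + s.*2)%N) half_bit_double in h1.
  have {}h1 := h1 (leqnn _); rewrite -[(true + s.*2)%N]/(s.*2.+1) q metric_sym in h1.
  rewrite (half_powS R s); have := mulr_gt0 e00 (half_pow_gt0 R s.+1); lra.
Qed.

Lemma separable_isomorphic (M N : model T) : density_aleph0 M -> density_aleph0 N ->
  pert_isomorphic pp M N.
Proof.
move=> sM sN e e0.
have [u du] := separable_dense_seq (carrier_inhabited M) sM.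
have [w dw] := separable_dense_seq (carrier_inhabited N) sN.
have e20 : 0 < e / 2 by rewrite divr_gt0.
have [al [be [h ha hb]]] := back_and_forth (u \o repeated) (w \o repeated) e20.
have E : 2 * (e / 2) = e by lra.
rewrite E in h.
have dn (K : metricType R) (v : nat -> K) (x : nat -> K) (g : nat -> nat) :
    dense_seq v ->       (forall s, mdist (x (g s)) ((v \o repeated) s) <= 8 * (e / 2) * half_pow R s) ->
    dense_seq x.
  move=> dv hx y r r0.
  have r20 : 0 < r / 2 by rewrite divr_gt0.
  have [j hj] := dv y _ r20.
  have [s0 hs0] := half_pow_small (divr_gt0 r20 (mulr_gt0 (ltr0Sn R 3) e0)).
  have [s [s0s sj]] := repeatedP j s0.
  exists (g s); have := hx s; rewrite /= sj => h1.
  have := metric_triangle (x (g s)) (v j) y.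
  have := le_trans (half_pow_le R s0s) hs0.
  by rewrite ler_pdivlMr ?mulr_gt0//; lra.
apply: (bipert_of_dense (ltW e0) h).
  exact: (dn _ u al (fun s => s.*2)).
exact: (dn _ w be (fun s => s.*2.+1)).
Qed.

End Isomorphism.

(** * Infinite models and separable submodels *)

Section Infinite.
Variables (R : realType) (L : language R) (T : theory L).
Hypotheses (HT : complete_theory T).

Lemma distinct_formula k : exists psi : formula L k,
  forall (M : structure L) (z : 'I_k -> M),
  0 < eval psi z <-> injective z.
Proof.
pose ps := [seq p <- enum [set: 'I_k * 'I_k] | p.1 != p.2].
exists (FMins [seq FDist (Var L p.1) (Var L p.2) | p <- ps]) => M z.
split=> [/FMins_gt0 h i j zij|zI].
  apply/eqP; apply: contrapT => /negP ij.
  have ijp : (i, j) \in ps by rewrite mem_filter /= ij mem_enum inE.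
  have := h (index (i, j) ps); rewrite size_map index_mem ijp => /(_ isT).
  rewrite (nth_map (i, j)) ?index_mem// nth_index//= zij mdistxx.
  by rewrite ltxx.
apply/FMins_gt0 => n; rewrite size_map => nps.
have [p0 _] : exists p0 : 'I_k * 'I_k, true by case: ps nps => [//|p0 _] _; exists p0.
rewrite (nth_map p0)//=; have := mem_nth p0 nps.
rewrite mem_filter => /andP[pP _]; rewrite mdist_gt0.
by apply: contra_neq pP => /zI.
Qed.

(** A finite model would satisfy that no k elements are distinct, for some k,
    and this is expressed by a sentence. *)
Lemma infinite_models : (exists M : model T, ~ compact [set: M]) ->
  forall N : model T, infinite_set [set: N].
Proof.
move=> [M nM] N /finite_seqP[s sN].
have : infinite_set [set: M] by move=> fM; exact/nM/finite_compact.
move=> /infiniteP/card_leP[f].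
have fI : injective f by move=> x y; apply: (@inj _ _ _ f); rewrite inE.
pose t (n : nat) : set_type [set: nat] := exist (fun x => x \in [set: nat]) n (mem_set I).
pose z := fun i : 'I_(size s).+1 => sval (f (t i)) : M.
have zI : injective z.
  by move=> i j /val_inj/fI/(congr1 sval) /= /val_inj.
have [psi hpsi] := distinct_formula (size s).+1.
have v0 (A : Type) : 'I_0 -> A by case.
have hz : 0 < eval psi (copair (v0 M) z \o inr) by apply/hpsi.
have [z' /hpsi z'I] := transfer (tpfun0 HT (v0 M) (v0 N)) hz.
have zu : uniq (codom z') by apply/injectiveP.
have zs : {subset codom z' <= s}.
  by move=> x _; have : [set: N] x by []; rewrite sN.
by have := uniq_leq_size zu zs; rewrite size_codom card_ord ltnn.
Qed.

Lemma density_aleph0P (N : model T) (D : set N) : infinite_set [set: N] ->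
  countable D -> (forall x (e : R), 0 < e -> exists y, D y /\ mdist x y <= e) ->
  density_aleph0 N.
Proof.
move=> iN cD dD; split.
  exists D => // O [x Ox] oO.
  have /nbhs_ballP[e /= e0 eO] : nbhs x O by exact: open_nbhs_nbhs.
  have e20 : 0 < e / 2 by rewrite divr_gt0.
  have [y [Dy xy]] := dD x _ e20.
  exists y; split=> //; apply: eO; rewrite ballEmdist /=; lra.
move=> E dE fE; apply: iN.
have cE : closed E.
  have /accessible_finite_set_closed h : accessible_space N.
    exact/hausdorff_accessible/metric_hausdorff.
  exact: h.
suff -> : [set: N] = E by [].
apply/seteqP; split=> // x _; apply: contrapT => nEx.
have [y [nEy Ey]] := dE (~` E) (ex_intro _ x nEx) (closed_openC cE).
exact: nEy.
Qed.

(** The elementary submodel of U carried by the closure of D. *)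
Lemma separable_submodel (U : model T) (D : set U) :
  (forall N : model T, infinite_set [set: N]) ->
  countable D -> tarski_vaught D ->
  exists (N : model T) (h : N -> U), [/\ elementary h,
    (forall z, adherent D (h z)), (forall x, adherent D x -> exists z, h z = x) &
    density_aleph0 N].
Proof.
move=> iN cD TV; have [N [h [hh h1 h2]]] := tarski_vaught_model TV.
exists N, h; split=> //.
have hI : injective h.
  by move=> x y hxy; apply: (@mdist_positivity _ N);
    rewrite -(elementary_dist hh) hxy mdistxx.
apply: (@density_aleph0P N (h @^-1` D)) => //.
  have /countable_injP[f fI] := cD; apply/countable_injP; exists (f \o h) => x y.
  by rewrite !inE => Dx Dy /fI; rewrite !inE => /(_ Dx Dy)/hI.
move=> x e e0; have [y [Dy xy]] := h1 x e e0.
have [z hz] := h2 y (adherent_in Dy); exists z; split; first by rewrite /= hz.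
by rewrite -(elementary_dist hh) hz.
Qed.

End Infinite.

(** * Generic sequences *)

Section Generic.
Variables (R : realType) (L : language R).
Variables (U : structure L) (satU : saturated U) (m : nat) (a0 : 'I_m -> U).

(** Open conditions on a sequence c in U with parameters a0; a variable of the
    formula stands for a parameter (left) or for a term of c (right). *)
Definition open_cond := {k : nat & (formula L k * ('I_k -> 'I_m + nat))%type}.

Definition cond_val (x : open_cond) (c : nat -> U) : R :=
  eval (tagged x).1 (copair a0 c \o (tagged x).2).

Definition mk_cond k (psi : formula L k) (r : 'I_k -> 'I_m + nat) : open_cond :=
  existT _ k (psi, r).

Lemma cond_min (x y : open_cond) :
  exists w : open_cond, forall c, cond_val w c = Num.min (cond_val x c) (cond_val y c).
Proof.
case: x y => [k [psi r]] [k' [psi' r']].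
exists (mk_cond (FMin (frename psi (@lshift k k')) (frename psi' (@rshift k k')))
  (tcat r r')) => c.
rewrite [LHS]eval_FMin !eval_rename /cond_val.
have -> : (copair a0 c \o tcat r r') \o @lshift k k' = copair a0 c \o r.
  by rewrite -[in RHS](tcat_l r r').
have -> // : (copair a0 c \o tcat r r') \o @rshift k k' = copair a0 c \o r'.
by rewrite -[in RHS](tcat_r r r').
Qed.

Lemma cond_sub (x : open_cond) (q : rat) :
  exists w : open_cond, forall c, cond_val w c = cond_val x c - ratr q.
Proof.
case: x => [k [psi r]]; exists (mk_cond (FSub psi (FConst L k q)) r) => c.
by rewrite /cond_val [LHS]eval_FSub eval_FConst.
Qed.

(** G contains an open set that meets every nonempty open condition. *)
Definition dense_open (G : (nat -> U) -> Prop) :=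
  forall (x : open_cond) c, 0 < cond_val x c ->
  exists (y : open_cond) c', [/\ 0 < cond_val x c', 0 < cond_val y c' &
    forall c'', 0 < cond_val y c'' -> G c''].

(** The sequences in U behave like a compact space for closed conditions, by
    saturation. As in the proof of the Baire category theorem, one builds
    nonempty conditions that shrink into each G s; subtracting a rational from
    the formula makes the closure of a condition lie in the previous one. *)
Theorem baire_generic (S : Type) (enc : S -> nat) (G : S -> (nat -> U) -> Prop) :
  injective enc -> (forall s, dense_open (G s)) -> exists c, forall s, G s c.
Proof.
move=> encI Gd.
pose G' n c := forall s, enc s = n -> G s c.
have G'd n : dense_open (G' n).
  move=> x c xc; have [[s sn]|no] := pselect (exists s, enc s = n).
    have [y [c' [h1 h2 h3]]] := Gd s x c xc; exists y, c'; split=> // c'' /h3.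
    by move=> Gs s'; rewrite -sn => /encI->.
  by exists x, c; split=> // c'' _ s sn; case: no; exists s.
have step (nx : nat * open_cond) : exists x' : open_cond, (exists c, 0 < cond_val nx.2 c) ->
   (exists c, 0 < cond_val x' c) /\ forall c, 0 <= cond_val x' c ->
     G' nx.1 c /\ 0 <= cond_val nx.2 c.
  case: nx => n x /=; have [[c xc]|no] := pselect (exists c, 0 < cond_val x c);
    last by exists x.
  have [y [c' [h1 h2 h3]]] := G'd n x c xc.
  have [w hw] := cond_min x y.
  have w0 : 0 < cond_val w c' by rewrite hw lt_min h1.
  have [q] := rat_in_itvoo w0; rewrite in_itv /= => /andP[q0 qw].
  have [x' hx'] := cond_sub w q; exists x' => _; split.
    by exists c'; rewrite hx' subr_gt0.
  move=> c''; rewrite hx' subr_ge0 hw le_min => /andP[qx qy]; split.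
    by apply: h3; exact: lt_le_trans qy.
  by apply: le_trans qx; exact: ltW.
have [F FP] := choice step.
have x0 : 'I_0 -> 'I_m + nat by case.
pose X := fix X n := if n is n'.+1 then F (n', X n') else mk_cond (FOne L 0) x0.
have Xc n : exists c, 0 < cond_val (X n) c.
  elim: n => [|n IH]; last by have [] := FP (n, X n) IH.
  by have [u] := carrier_inhabited U; exists (fun=> u); rewrite /cond_val /=.
have XS n c : 0 <= cond_val (X n.+1) c -> G' n c /\ 0 <= cond_val (X n) c.
  by have [_] := FP (n, X n) (Xc n); apply.
have Xle N n c : (n <= N)%N -> 0 <= cond_val (X N) c -> 0 <= cond_val (X n) c.
  elim: N => [|N IH]; first by rewrite leqn0 => /eqP->.
  rewrite leq_eqVlt => /orP[/eqP->//|]; rewrite ltnS => nN /XS[_]; exact: IH.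
have [c hc] : exists c : nat -> U, forall n,
    eval (FOpp (tagged (X n)).1) (copair a0 c \o (tagged (X n)).2) <= 0.
  apply: (@satU _ _ a0 nat id (fun n => tag (X n)) (fun n => FOpp (tagged (X n)).1)
    (fun=> 0) (fun n => (tagged (X n)).2) (@inj_id _)) => N e e0.
  have [c hc] := Xc N; exists c => n nN; rewrite eval_FOpp.
  have := Xle N n c (ltnW nN) (ltW hc); rewrite /cond_val; lra.
exists c => s; have := hc (enc s).+1; rewrite eval_FOpp oppr_le0 => /XS[h _].
exact: h.
Qed.

(** No term of c with this index or a larger one occurs in r. *)
Definition fresh_index k (r : 'I_k -> 'I_m + nat) : nat :=
  \max_i match r i with inl _ => 0%N | inr t => t.+1 end.

Lemma fresh_indexP k (r : 'I_k -> 'I_m + nat) i t : r i = inr t -> (t < fresh_index r)%N.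
Proof.
move=> e; have := @leq_bigmax _
  (fun i => match r i with inl _ => 0%N | inr t => t.+1 end) i.
by rewrite e.
Qed.

Lemma copair_update k (r : 'I_k -> 'I_m + nat) (c : nat -> U) j w :
  (fresh_index r <= j)%N ->
  copair a0 (update c j w) \o r = copair a0 c \o r.
Proof.
move=> rj; apply/funext => i /=; case E: (r i) => [t|t] //=.
by rewrite /update ltn_eqF// (leq_trans (fresh_indexP E)).
Qed.

(** A term of c that occurs neither in the given condition nor in phi can be
    assigned an approximate witness freely. As j0 is arbitrary, there are
    infinitely many such terms, so that each point of the closure has
    approximations of arbitrarily large index. *)
Lemma dense_open_witness k (phi : formula L k.+1) (r : 'I_k -> 'I_m + nat) l j0 :
  dense_open (fun c => exists2 j, (j0 <= j)%N &
    eval (FSup phi) (copair a0 c \o r) - half_pow R l <=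
      eval phi (trcons (copair a0 c \o r) (c j))).
Proof.
move=> [kx [psi rx]] c xc.
pose j := (j0 + fresh_index r + fresh_index rx)%N.
have [q] := rat_in_itvoo (half_pow_gt0 R l); rewrite in_itv /= => /andP[q0 ql].
have [w hw] : exists w, eval (FSup phi) (copair a0 c \o r) - ratr q <
    eval phi (trcons (copair a0 c \o r) w).
  by apply/FSup_gt; lra.
pose chi := FSub phi (FSub (frename (FSup phi) (lift ord_max)) (FConst L k.+1 q)).
have E c' : copair a0 c' \o trcons r (inr j) = trcons (copair a0 c' \o r) (c' j).
  by apply/funext => i /=; case: (unliftP ord_max i) => [i'|] ->;
    rewrite ?trconsK ?trcons_max.
have chiE c' : cond_val (mk_cond chi (trcons r (inr j))) c' =
    eval phi (trcons (copair a0 c' \o r) (c' j)) -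
      (eval (FSup phi) (copair a0 c' \o r) - ratr q).
  change (cond_val (mk_cond chi (trcons r (inr j))) c') with
    (eval chi (copair a0 c' \o trcons r (inr j))).
  rewrite E !eval_FSub eval_rename eval_FConst.
  suff E2 : trcons (copair a0 c' \o r) (c' j) \o lift ord_max = copair a0 c' \o r.
    rewrite E2.
    reflexivity.
  by apply/funext => i /=; rewrite trconsK.
exists (mk_cond chi (trcons r (inr j))), (update c j w); split.
- by rewrite /cond_val copair_update// /j leq_addl.
- rewrite chiE copair_update; last by rewrite /j -addnA addnCA leq_addr.
  by rewrite /update eqxx subr_gt0.
- move=> c''; rewrite chiE subr_gt0 => h; exists j; last first.
    by apply: ltW; apply: le_lt_trans h; rewrite lerD2l lerN2 ltW.
  by rewrite /j -addnA leq_addr.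
Qed.

(** The condition psi projects to an open condition on the terms c_(io i) alone.
    Since X has empty interior (this is the hypothesis on X), these terms can be
    moved out of X within the projection, and the other terms follow. This
    needs io to be injective: terms that are equal cannot be moved
    independently. *)
Lemma dense_open_omit n (X : ('I_n -> U) -> Prop) (io : 'I_n -> nat) :
  injective io ->
  (forall (psi : formula L (n + m)) b, 0 < eval psi (tcat b a0) ->
     exists (chi : formula L (n + m)) b2, [/\ 0 < eval psi (tcat b2 a0),
       0 < eval chi (tcat b2 a0) &
       forall b3, 0 < eval chi (tcat b3 a0) -> ~ X b3]) ->
  dense_open (fun c => ~ X (c \o io)).
Proof.
move=> ioI NI [k [psi r]] c xc.
pose K := fresh_index r.
(* Free terms are named by their index in c, not by their position in psi, so
   that two occurrences of the same term receive the same value. *)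
pose sg (l : 'I_k) : 'I_(n + m) + 'I_K.+1 := match r l with
  | inl t => inl (rshift n t)
  | inr j => if [pick i | io i == j] is Some i then inl (lshift m i) else inr (inord j) end.
have [psi' hpsi'] := proj_formula sg psi.
have tl (A : Type) (b : 'I_n -> A) (a : 'I_m -> A) i : tcat b a (lshift m i) = b i.
  by rewrite -[LHS]/((tcat b a \o @lshift n m) i) tcat_l.
have tr (A : Type) (b : 'I_n -> A) (a : 'I_m -> A) i : tcat b a (@rshift n m i) = a i.
  by rewrite -[LHS]/((tcat b a \o @rshift n m) i) tcat_r.
have h0 : 0 < eval psi' (tcat (c \o io) a0).
  apply/hpsi'; exists (fun i => c i).
  rewrite (_ : (fun i => _) = copair a0 c \o r)//.
  apply/funext => l /=; rewrite /sg; case E: (r l) => [t|j] /=; first exact: tr.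
  case: pickP => [i /eqP <-|_]; first exact: tl.
  by rewrite inordK// ltnS ltnW// (fresh_indexP E).
have [chi [b2 [/hpsi'[z hz] h2 h3]]] := NI psi' _ h0.
pose c' j := if [pick i | io i == j] is Some i then b2 i else z (inord j).
have c'io : c' \o io = b2.
  apply/funext => i; rewrite /c' /=; case: pickP => [i' /eqP/ioI->//|/(_ i)].
  by rewrite eqxx.
pose y := mk_cond chi (tcat (fun i => inr (io i)) (fun i : 'I_m => inl i)).
have yE c'' : cond_val y c'' = eval chi (tcat (c'' \o io) a0).
  rewrite /cond_val /=; congr eval; apply/funext => i /=; rewrite /tcat.
  by case: (fintype.split i).
exists y, c'; split.
- rewrite /cond_val /=
  (_ : copair a0 c' \o r =
    (fun i => match sg i with inl j => tcat b2 a0 j | inr j => z j end))//.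
  apply/funext => l /=; rewrite /sg; case E: (r l) => [t|j] /=; first by rewrite tr.
  by rewrite /c'; case: pickP => [i _|_] //=; rewrite tl.
- by rewrite yE c'io.
- by move=> c''; rewrite yE; exact: h3.
Qed.

End Generic.

(** * Omitting and realising, and the equivalence *)

Section Omitting.
Variables (R : realType) (L : language R) (T : theory L).
Hypotheses (HL : countable_language L) (HT : complete_theory T).
Hypothesis (HI : forall N : model T, infinite_set [set: N]).
Variables (U : model T) (satU : saturated U).
(* So that the arity stays an explicit argument of pp. *)
Unset Implicit Arguments.
Variables (pp : R -> type_rel T) (Hpp : pert_system pp).
Set Implicit Arguments.
Local Notation fuzzy := (fuzzy U pp).

(** Strictly increasing choices are injective. *)
Lemma injective_choice n (P : 'I_n -> nat -> Prop) :
  (forall i j0, exists j, (j0 <= j)%N /\ P i j) ->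
  exists io : 'I_n -> nat, injective io /\ forall i, P i (io i).
Proof.
elim: n P => [|n IH] P h; first by exists (fun=> 0%N); split; case.
have [io [ioI ioP]] := IH (fun i => P (lift ord_max i)) (fun i => h _).
have [j [jP Pj]] := h ord_max (\max_i (io i)).+1.
have lt i : (io i < j)%N by apply: leq_trans jP; rewrite ltnS; exact: leq_bigmax.
exists (trcons io j); split.
  move=> x y; case: (unliftP ord_max x) => [x'|] ->; case: (unliftP ord_max y) => [y'|] ->;
    rewrite ?trconsK ?trcons_max.
  - by move=> /ioI->.
  - by move=> e; have := lt x'; rewrite e ltnn.
  - by move=> e; have := lt y'; rewrite -e ltnn.
  - by [].
by move=> i; case: (unliftP ord_max i) => [i'|] ->; rewrite ?trconsK ?trcons_max.
Qed.

Lemma realize_type_over n m (N : model T) (c : 'I_m -> N) (b : 'I_n -> N) (a0 : 'I_m -> U) :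
  tp c = tp a0 -> exists b0 : 'I_n -> U, tp (tcat b0 a0) = tp (tcat b c).
Proof.
move=> /tp_eq ca; have [b0 hb0] := realize_over satU HL b ca.
by exists b0; apply/tp_eq; have := hb0 _ (@swap_split n m); rewrite !swap_splitE.
Qed.

(** Empty interior, expressed by formulas at tuples of U over a fixed a0;
    a type outside the set has a neighbourhood outside it by fuzzy_closed. *)
Lemma nowhere_dense_step n m (M : model T) (a : 'I_m -> M) (p : types_over a n)
  (e : R) (a0 : 'I_m -> U) : 0 < e -> tp a0 = tp a ->
  ~ (interior (fuzzy_types (pp e) e p) !=set0) ->
  forall (psi : formula L (n + m)) b, 0 < eval psi (tcat b a0) ->
     exists (chi : formula L (n + m)) b2, [/\ 0 < eval psi (tcat b2 a0),
       0 < eval chi (tcat b2 a0) &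
       forall b3, 0 < eval chi (tcat b3 a0) ->
         ~ fuzzy e e (forget p) (tp (tcat b3 a0))].
Proof.
move=> e0 aa ni psi b hb.
have [b2 [h1 h2]] : exists b2, 0 < eval psi (tcat b2 a0) /\
    ~ fuzzy e e (forget p) (tp (tcat b2 a0)).
  apply: contrapT => no; apply: ni.
  have qin : tpfun (tcat b a0) \in types_over_set a n.
    by apply/mem_set; exists U, a0, b.
  pose q : types_over a n :=
    exist (fun x : fvalues L (n + m) => x \in types_over_set a n) _ qin.
  exists q; have nq : nbhs q [set q' : types_over a n | 0 < sval q' psi].
    exact: type_gt0_nbhs.
  apply: (filterS _ nq) => q' /= hq'.
  have [N [c [b' [ca qbc]]]] := set_mem (svalP q').
  have [z hz] := realize_type_over b' (etrans ca (esym aa)).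
  have zq : tp (tcat z a0) = forget q' by rewrite hz; apply: val_inj; rewrite /= -qbc.
  apply: (fuzzy_fuzzy_types HL HT satU (ltW e0)); rewrite -zq.
  apply: contrapT => nz; apply: no; exists z; split=> //.
  rewrite -[eval _ _]/(sval (tp (tcat z a0)) psi) zq.
  exact: hq'.
have cl : closed [set q | fuzzy e e (forget p) q].
  exact: (fuzzy_closed HL HT satU Hpp (ltW e0)).
have nb : nbhs (tp (tcat b2 a0)) (~` [set q | fuzzy e e (forget p) q]).
  by apply: open_nbhs_nbhs; split=> //; exact: closed_openC.
have [chi [c1 c2]] := type_basis (@types_realized _ _ _ _) nb.
by exists chi, b2; split=> // b3 hb3; exact: (c2 (tp (tcat b3 a0)) hb3).
Qed.

(** The generic sequence itself avoids the set with error e on all injective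
    tuples. Each tuple of the closure is within e / 2 of such a tuple, hence the
    closure avoids the set with error e / 2. *)
Lemma omitting_model n m (M : model T) (a : 'I_m -> M) (p : types_over a n) (e : R) :
  0 < e -> ~ (interior (fuzzy_types (pp e) e p) !=set0) ->
  exists (N : model T) (a1 : 'I_m -> N), [/\ density_aleph0 N, tp a1 = tp a &
    forall b : 'I_n -> N, ~ fuzzy (e / 2) (e / 2) (forget p) (tp (tcat b a1))].
Proof.
move=> e0 ni; have [a0 /esym aa] := type_realized HL HT satU (tp a).
have NI := nowhere_dense_step e0 aa ni.
have [cf cfI] := countable_formulas HL.
(* The countably many requirements: witnesses, and tuples to be kept out of the
   set; assignments and tuples are coded by finite sequences. *)
pose Idx := ({k : nat & formula L k.+1} * seq ('I_m + nat) * nat * nat + seq nat)%type.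
pose enc (s : Idx) : nat := match s with
  | inl (f, r, l, j) => pickle (inl (cf (existT _ (tag f).+1 (tagged f)), r, l, j)
      : nat * seq ('I_m + nat) * nat * nat + seq nat)
  | inr t => pickle (inr t : nat * seq ('I_m + nat) * nat * nat + seq nat) end.
have encI : injective enc.
  move=> [[[[[k f] r] l] j]|t] [[[[[k' f'] r'] l'] j']|t'] /(pcan_inj pickleK) //= [].
    move=> /cfI h -> -> ->; have kk : k.+1 = k'.+1 := congr1 (@projT1 _ _) h.
    case: kk => kk; subst k'.
    by rewrite (Eqdep_dec.inj_pair2_eq_dec nat PeanoNat.Nat.eq_dec _ _ _ _ h).
  by move=> ->.
pose rv k (r : seq ('I_m + nat)) : 'I_k -> 'I_m + nat := fun i => nth (inr 0%N) r i.
pose G (s : Idx) (c : nat -> U) : Prop := match s with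
  | inl (f, r, l, j0) => exists2 j, (j0 <= j)%N &
      eval (FSup (tagged f)) (copair a0 c \o @rv (tag f) r) - half_pow R l <=
      eval (tagged f) (trcons (copair a0 c \o @rv (tag f) r) (c j))
  | inr t => uniq t -> size t = n ->
      ~ fuzzy e e (forget p) (tp (tcat (c \o (fun i : 'I_n => nth 0%N t i)) a0)) end.
have Gd s : dense_open a0 (G s).
  case: s => [[[[f r] l] j0]|t] /=; first exact: dense_open_witness.
  have [tu|tu] := boolP (uniq t); last first.
    by move=> x c xc; exists x, c; split=> // c' _ ut; rewrite ut in tu.
  have [tn|tn] := eqVneq (size t) n; last first.
    by move=> x c xc; exists x, c; split=> // c' _ _ /eqP; rewrite (negbTE tn).
  have tI : injective (fun i : 'I_n => nth 0%N t i).
    by move=> i j /eqP; rewrite nth_uniq ?tn// => /eqP/val_inj.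
  move=> x c xc; have [y [c' [h1 h2 h3]]] := dense_open_omit tI NI xc.
  by exists y, c'; split=> // c'' /h3 hc _ _.
have [c cG] := baire_generic satU encI Gd.
pose D := range c.
have TVgen k (phi : formula L k.+1) (r : 'I_k -> 'I_m + nat) (eps : R) j0 : 0 < eps ->
    exists2 j, (j0 <= j)%N & eval (FSup phi) (copair a0 c \o r) - eps <=
      eval phi (trcons (copair a0 c \o r) (c j)).
  move=> eps0; have [l hl] := half_pow_small eps0.
  have [j jj] := cG (inl (existT _ k phi, [seq r i | i <- enum 'I_k], l, j0)).
  have -> : @rv k [seq r i | i <- enum 'I_k] = r.
    apply/funext => i; rewrite /rv (nth_map i) ?size_enum_ord//.
    by rewrite nth_ord_enum.
  by move=> h; exists j => //; apply: le_trans h; rewrite lerD2l lerN2.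
have TV : tarski_vaught D.
  move=> k phi v hv eps eps0.
  have [t ht] := choice
    (fun i => let: ex_intro2 t _ e := hv i in ex_intro (fun t => c t = v i) t e).
  have [j _ hj] := TVgen k phi (fun i => inr (t i)) eps 0%N eps0.
  have vE : copair a0 c \o (fun i => inr (t i)) = v by apply/funext => i /=.
  by exists (c j); split; [exists j|rewrite -vE].
(* The supremum of - d(x, -) is 0, so its witnesses approximate x. *)
have near (x : 'I_m + nat) (eps : R) j0 : 0 < eps ->
    exists2 j, (j0 <= j)%N & mdist (copair a0 c x) (c j) <= eps.
  move=> eps0.
  pose phi : formula L 2 := FOpp (FDist (Var L ord0) (Var L ord_max)).
  have [j jj hj] := TVgen 1 phi (fun=> x) eps j0 eps0; exists j => //.
  have phiE y : eval phi (trcons (copair a0 c \o (fun _ : 'I_1 => x)) y) =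
      - mdist (copair a0 c x) y.
    rewrite eval_FOpp /= trcons_max; congr (- mdist _ _).
    by rewrite (_ : ord0 = lift ord_max (ord0 : 'I_1)) ?trconsK//; apply: val_inj.
  have := FSup_ub phi (copair a0 c \o (fun _ : 'I_1 => x)) (copair a0 c x).
  rewrite !phiE mdistxx in hj * => h; lra.
have cD : countable D.
  by apply: (sub_countable (card_image_le _ _)); exact: countableP.
have [N [h [hh hD hD' sN]]] := separable_submodel HI cD TV.
have lift_a0 i : exists z, h z = a0 i.
  apply: hD' => eps eps0; have [j _ hj] := near (inl i) eps 0%N eps0.
  by exists (c j); split=> //; exists j.
have [a1 ha1] := choice lift_a0.
have htp k (f : 'I_k -> N) : tp f = tp (h \o f).
  by apply/tp_eq/funext => phi; rewrite /tpfun hh.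
have ha1' : h \o a1 = a0 by apply/funext.
exists N, a1; split=> //; first by rewrite htp ha1' aa.
move=> b hb.
have hcat : h \o tcat b a1 = tcat (h \o b) a0.
  by rewrite -ha1'; apply/funext => i /=; rewrite /tcat; case: (fintype.split i).
rewrite htp hcat in hb.
have e20 : 0 < e / 2 by rewrite divr_gt0.
have [io [ioI ioP]] : exists io : 'I_n -> nat, injective io /\
    forall i, mdist (h (b i)) (c (io i)) <= e / 2.
  apply: (@injective_choice n (fun i j => mdist (h (b i)) (c j) <= e / 2)) => i j0.
  have e40 : 0 < e / 4 by rewrite divr_gt0.
  have [_ [[t _ <-] ht]] := hD (b i) _ e40.
  have [j jj hj] := near (inr t) _ j0 e40; exists j; split=> //.
  apply: le_trans (metric_triangle _ (c t) _) _; rewrite /= in hj; lra.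
have [b' [h1 h2]] := fuzzy_over HL satU hb.
pose t := [seq io i | i <- enum 'I_n].
have tE : (fun i : 'I_n => nth 0%N t i) = io.
  by apply/funext => i; rewrite /t (nth_map i) ?size_enum_ord// nth_ord_enum.
have := cG (inr t); rewrite /= tE; apply.
- by rewrite map_inj_uniq// enum_uniq.
- by rewrite size_map size_enum_ord.
exists (tcat (c \o io) a0), b'; split=> //.
  by apply: (pp_le Hpp _ _ h1); lra.
move=> i; have h2i := h2 i; apply: le_trans (metric_triangle _ (tcat (h \o b) a0 i) _) _.
suff : mdist (tcat (c \o io) a0 i) (tcat (h \o b) a0 i) <= e / 2 by lra.
rewrite /tcat; case: (fintype.split i) => j /=.
  by rewrite metric_sym.
by rewrite mdistxx ltW.
Qed.

(** In U each tuple that is nearly a perturbation of a has a fuzzy realisation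
    of p over it. The hull is closed under a choice of such realisations over
    its own tuples, and a tuple of the model is close to one of the hull; this
    doubles the error in distance. *)
Lemma realizing_model n m (M : model T) (a : 'I_m -> M) (p : types_over a n) (d : R) :
  0 < d -> exists N : model T, density_aleph0 N /\
    forall a2 : 'I_m -> N, pp d m (tp a, tp a2) ->
      exists b : 'I_n -> N, fuzzy d (2 * d) (forget p) (tp (tcat b a2)).
Proof.
move=> d0; have [a0 /esym aa] := type_realized HL HT satU (tp a).
have [N0 [c0 [b0 [ca pbc]]]] := set_mem (svalP p).
have [bp hbp] := realize_type_over b0 (etrans ca (esym aa)).
have pE : tp (tcat bp a0) = forget p by rewrite hbp; apply: val_inj; rewrite /= -pbc.
have [u0] := carrier_inhabited U.
have wit (a2 : 'I_m -> U) : exists w : 'I_n -> U,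
    (exists b, fuzzy d d (forget p) (tp (tcat b a2))) ->
      fuzzy d d (forget p) (tp (tcat w a2)).
  have [[b hb]|no] := pselect (exists b, fuzzy d d (forget p) (tp (tcat b a2)));
    first by exists b.
  by exists (fun=> u0).
have [w wP] := choice wit.
pose op s (l : seq U) : U := oapp (w (fun i => nth u0 l i)) u0 (insub s).
have [D [cD TV opD]] := skolem_hull HL op.
have [N [h [hh hD hD' sN]]] := separable_submodel HI cD TV.
exists N; split=> // a2 haa.
have htp k (f : 'I_k -> N) : tp f = tp (h \o f).
  by apply/tp_eq/funext => phi; rewrite /tpfun hh.
have [v vP] := choice (fun i => hD (a2 i) d d0).
rewrite htp -aa in haa.
have [z hz] := extend_tuple HL HT satU Hpp bp (ltW d0) haa.
have {}hz := hz _ (@swap_split n m); rewrite !swap_splitE pE in hz.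
have hv : fuzzy d d (forget p) (tp (tcat (w v) v)).
  apply: wP; exists z, (tcat z v), (tcat z (h \o a2)); split=> //.
  move=> i; rewrite /tcat; case: (fintype.split i) => j /=.
    by rewrite mdistxx ltW.
  by rewrite metric_sym; exact: (vP j).2.
pose l := [seq v i | i <- enum 'I_m].
have lE : (fun i : 'I_m => nth u0 l i) = v.
  by apply/funext => i; rewrite /l (nth_map i) ?size_enum_ord// nth_ord_enum.
have wD i : D (w v i).
  have := opD i l; rewrite /op lE valK /=; apply.
  by move=> x /mapP[j _ ->]; exact: (vP j).1.
have lift_w i : exists z, h z = w v i by exact/hD'/adherent_in.
have [b hb] := choice lift_w.
exists b; rewrite htp.
have hcat : h \o tcat b a2 = tcat (w v) (h \o a2).
  by apply/funext => i /=; rewrite /tcat; case: (fintype.split i) => j //=.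
rewrite hcat; have [b' [h1 h2]] := fuzzy_over HL satU hv.
exists (tcat (w v) (h \o a2)), b'; split=> // i.
apply: le_trans (metric_triangle _ (tcat (w v) v i) _) _.
suff : mdist (tcat (w v) (h \o a2) i) (tcat (w v) v i) <= d by have := h2 i; lra.
rewrite /tcat; case: (fintype.split i) => j /=; first by rewrite mdistxx ltW.
exact: (vP j).2.
Qed.

(** A realisation b of p over f(a1), with errors d and 2 d, is pulled back by g,
    which adds d to the perturbation and the modulus e / 4 to the distance. With
    d <= e / 8 both stay below the e / 2 that N1 avoids. *)
Lemma categorical_interior : pert_aleph0_categorical pp ->
  forall n, fuzzy_types_nonempty_interior pp n.
Proof.
move=> [_ cat] n M m a p e e0; apply: contrapT => ni.
have e40 : 0 < e / 4 by rewrite divr_gt0.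
have [mo mo0 hmo] := exists_modulus HL HT satU Hpp e40.
pose d := Num.min mo (e / 8).
have d0 : 0 < d by rewrite lt_min mo0 divr_gt0.
have dm : dist_modulus pp d (e / 4).
  by move=> q r qr; apply: hmo; apply: (pp_le Hpp (ltW d0)) qr; rewrite ge_min lexx.
have de : d <= e / 8 by rewrite ge_min lexx orbT.
have [N1 [a1 [s1 aa omit]]] := omitting_model e0 ni.
have [N2 [s2 real]] := realizing_model p d0.
have [f [fP [g [fK gK gP]]]] := cat N1 N2 s1 s2 d d0.
have haf : pp d m (tp a, tp (f \o a1)).
  by have [_ -> ] := fP m a1; rewrite aa.
have [b hb] := real _ haf.
have hg : pp d (n + m)%N (tp (tcat b (f \o a1)), tp (tcat (g \o b) a1)).
  have [_ ->] := gP _ (tcat b (f \o a1)).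
  suff -> : g \o tcat b (f \o a1) = tcat (g \o b) a1 by [].
  by apply/funext => i /=; rewrite /tcat; case: (fintype.split i) => j //=; rewrite fK.
apply: (omit (g \o b)).
apply: (fuzzy_le Hpp _ _ _ (fuzzy_comp HL HT satU Hpp (ltW d0) (ltW d0) dm hb
   (pp_fuzzy HL HT satU hg))); rewrite ?addr_ge0//; [exact: ltW..|lra|lra].
Qed.

Lemma interior_categorical : fuzzy_types_nonempty_interior pp 1 ->
  pert_aleph0_categorical pp.
Proof.
move=> H1; split; last exact: (separable_isomorphic HL HT satU Hpp H1).
have [u0] := carrier_inhabited U.
have [D [cD TV _]] := skolem_hull HL (fun _ _ => u0).
by have [N [h [_ _ _ sN]]] := separable_submodel HI cD TV; exists N.
Qed.

End Omitting.

Local Close Scope ring_scope.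

Theorem theorem3p5 (R : realType) (L : language R) (T : theory L)
    (pp : R -> type_rel T)
    (HL : countable_language L)
    (HT : complete_theory T)
    (HN : exists M : model T, ~ compact [set: M])
    (Hpp : pert_system pp) :
  (pert_aleph0_categorical pp <->
     forall n : nat, fuzzy_types_nonempty_interior pp n) /\
  ((forall n : nat, fuzzy_types_nonempty_interior pp n) <->
     fuzzy_types_nonempty_interior pp 1).
Proof.
have HI := infinite_models HT HN.
have [M _] := HN; have [U satU] := exists_saturated M.
have AB := categorical_interior HL HT HI satU Hpp.
have CA := interior_categorical HL HT HI satU Hpp.
split; split.
- exact: AB.
- by move=> h; exact: CA (h 1%N).
- by move=> h; exact: h 1%N.
- by move=> h; exact: AB (CA h).
Qed.
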